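(* Let $X=(X(n))_{n\in\mathbb{Z}_+}$ be a standard subproduct system in the $C^*$-setting, and let $T$ be a completely contractive, covariant representation of $X$ on a Hilbert space $\mathcal{H}$. Let $Q$ be the strong operator limit of $\widetilde{T}_n\widetilde{T}_n^*$ as $n\to\infty$. Assume that $T$ is relatively isometric and $$\lim_{\ell\to\infty}\bigl\|(p_\ell\otimes Q)(\eta\otimes\widetilde{T}_{\ell-m}^*h)\bigr\|_{X(\ell)\otimes_\sigma\mathcal{H}}=\|T_m(\eta)Qh\|_{\mathcal{H}}$$ for all $m\in\mathbb{N}$, $\eta\in X(m)$ and $h\in\mathcal{H}$. Then there exist a Hilbert space $\mathcal{U}$, a unitary operator $W:\mathcal{H}\to(\mathcal{F}_X\otimes_\sigma\mathcal{D})\oplus\mathcal{U}$ and a fully coisometric, covariant representation $Z=(Z_n)_{n\in\mathbb{Z}_+}$ of $X$ on $\mathcal{U}$, which extends to a $C^*$-representation, such that $WT_n(\zeta)W^{-1}=(S_n(\zeta)\otimes I_{\mathcal{D}})\oplus Z_n(\zeta)$ for all $n\in\mathbb{Z}_+$, $\zeta\in X(n)$. In particular, $T$ extends to a $C^*$-representation.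
   Context: Conventions ($C^*$-setting). Hilbert spaces are complex; $C^*$-algebras need not be unital; all representations on Hilbert spaces are assumed nondegenerate. $\mathcal{M}$ is a $C^*$-algebra; a correspondence over $\mathcal{M}$ is a right Hilbert $C^*$-module $F$ over $\mathcal{M}$ (inner product $\langle\cdot,\cdot\rangle$ linear in the second variable) with a left action $a\zeta=\varphi(a)\zeta$ given by a $*$-homomorphism $\varphi:\mathcal{M}\to\mathcal{L}(F)$ into the adjointable operators; tensor products are interior tensor products. For a representation $\sigma$ of $\mathcal{M}$ on $\mathcal{H}$, $F\otimes_\sigma\mathcal{H}$ is the Hilbert space with $(\zeta_1\otimes h_1,\zeta_2\otimes h_2)=(h_1,\sigma(\langle\zeta_1,\zeta_2\rangle)h_2)$. Standard subproduct system: a family $X=(X(n))_{n\in\mathbb{Z}_+}$ of correspondences over $\mathcal{M}$ with $X(0)=\mathcal{M}$ such that $X(n+m)$ is an orthogonally complementable sub-bimodule of $X(n)\otimes X(m)$ for all $n,m$ (where $X(n)\otimes\mathcal{M}$ and $\mathcal{M}\otimes X(n)$ are identified with $X(n)$ via the module actions, so the left actions are nondegenerate). Put $E=X(1)$; then $X(n)\subseteq E^{\otimes n}$ ($E^{\otimes 0}=\mathcal{M}$), and $p_n\in\mathcal{L}(E^{\otimes n})$ is the orthogonal projection onto $X(n)$. Completely contractive, covariant representation of $X$ on $\mathcal{H}$: a family $T=(T_n)_{n\in\mathbb{Z}_+}$ of linear maps $T_n:X(n)\to B(\mathcal{H})$ such that $\sigma:=T_0$ is a $C^*$-representation of $\mathcal{M}$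 on $\mathcal{H}$; each $T_n$ is completely contractive (with $X(n)$ viewed inside its linking algebra); $T_n(\zeta a)=T_n(\zeta)\sigma(a)$ and $T_n(a\zeta)=\sigma(a)T_n(\zeta)$; and $T_{n+m}(p_{n+m}(\zeta\otimes\eta))=T_n(\zeta)T_m(\eta)$ for $\zeta\in X(n),\eta\in X(m)$. For each $n$, $\widetilde{T}_n:X(n)\otimes_\sigma\mathcal{H}\to\mathcal{H}$ is the contraction $\widetilde{T}_n(\zeta\otimes h)=T_n(\zeta)h$. A fully coisometric, covariant representation is a completely contractive, covariant representation $T$ such that $\widetilde{T}_n$ is coisometric for all $n$. The sequence $\widetilde{T}_n\widetilde{T}_n^*$ is a decreasing sequence of positive contractions, so its strong limit $Q$ exists; $Q$ commutes with $\sigma(\mathcal{M})$, so $p_\ell\otimes Q$ makes sense. For $\ell\ge m$, $\eta\otimes\widetilde{T}_{\ell-m}^*h$ is an element of $X(m)\otimes X(\ell-m)\otimes_\sigma\mathcal{H}\subseteq E^{\otimes\ell}\otimes_\sigma\mathcal{H}$. $\Delta_*=\Delta_*(T):=(I_{\mathcal{H}}-\widetilde{T}_1\widetilde{T}_1^* )^{1/2}$ and $\mathcal{D}:=\overline{\operatorname{Im}\Delta_*(T)}$. $\Delta_*(T)$ commutes with $\sigma(\mathcal{M})$, so $\mathcal{D}$ reduces $\sigma$; the restriction of $\sigma$ to $\mathcal{D}$ is again denoted $\sigma$. $T$ is relatively isometric if all the maps $\widetilde{T}_n$, $n\in\mathbb{Z}_+$, are partial isometries and one (equivalently, both) of the following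 conditions holds: (a) $X(n)\otimes_\sigma\operatorname{Im}\Delta_*\subseteq\operatorname{Im}\widetilde{T}_n^*$ for all $n\in\mathbb{Z}_+$; (b) $\Delta_*T_n(\zeta)^*T_n(\zeta)\Delta_*=\sigma(\langle\zeta,\zeta\rangle)\Delta_*$ for all $n\in\mathbb{Z}_+$, $\zeta\in X(n)$. $X$-Fock space and shift: $\mathcal{F}_X=\bigoplus_{n\in\mathbb{Z}_+}X(n)$, and for $\zeta\in X(n)$, $S_n(\zeta)\in\mathcal{L}(\mathcal{F}_X)$ is given by $S_n(\zeta)\eta=p_{n+m}(\zeta\otimes\eta)$ for $\eta\in X(m)$; $S_n(\zeta)\otimes I_{\mathcal{D}}$ is the induced operator on $\mathcal{F}_X\otimes_\sigma\mathcal{D}$. The Toeplitz algebra $\mathcal{T}(X)$ is the $C^*$-subalgebra of $\mathcal{L}(\mathcal{F}_X)$ generated by all $S_n(\zeta)$. A completely contractive, covariant representation $T$ on $\mathcal{H}$ extends to a $C^*$-representation if there is a $C^*$-representation $\pi$ of $\mathcal{T}(X)$ on $\mathcal{H}$ with $\pi(S_n(\zeta))=T_n(\zeta)$ for all $n\in\mathbb{Z}_+$, $\zeta\in X(n)$. *)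

(* Defs.v *)
From HB Require Import structures.
From mathcomp Require Import all_boot all_order all_algebra complex.
From mathcomp Require Import boolp classical_sets reals topology normedtype sequences.

Set Implicit Arguments.
Unset Strict Implicit.
Unset Printing Implicit Defensive.

Import Order.TTheory GRing.Theory Num.Theory.
Import numFieldNormedType.Exports.

Local Open Scope classical_set_scope.
Local Open Scope ring_scope.

(* Completeness and all limits below are those of the library's normed modules
   over R[i]; norms are therefore nonnegative elements of R[i]. *)

Section Span.
Context {K : numFieldType} {V : normedModType K}.

Definition lin_span (S : set V) : set V :=
  [set v | exists (n : nat) (c : 'I_n -> K) (s : 'I_n -> V),
     (forall i, S (s i)) /\ v = \sum_(i < n) c i *: s i].

Definition closed_span (S : set V) : set V := closure (lin_span S).

End Span.

HB.mixin Record isHilbertSpace (R : realType) H & CompleteNormedModule R[i] H := {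
  inner : H -> H -> R[i];
  inner_linear : forall x, scalar (inner x);
  inner_conj : forall x y, (inner x y)^* = inner y x;
  inner_norm : forall x, `|x| ^+ 2 = inner x x
}.

#[short(type="hilbertType")]
HB.structure Definition HilbertSpace (R : realType) :=
  {H of CompleteNormedModule R[i] H & isHilbertSpace R H}.

(* Not necessarily unital. *)
HB.mixin Record isCStarAlgebra (R : realType) A & CompleteNormedModule R[i] A := {
  cmul : A -> A -> A;
  cstar : A -> A;
  cmulA : associative cmul;
  cmul_linearl : forall b, linear (fun a => cmul a b);
  cmul_linearr : forall a, linear (cmul a);
  cstarK : involutive cstar;
  cstarM : forall a b, cstar (cmul a b) = cmul (cstar b) (cstar a);
  cstar_antilinear : forall (c : R[i]) a b,
    cstar (c *: a + b) = c^* *: cstar a + cstar b;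
  cnormM : forall a b, `|cmul a b| <= `|a| * `|b|;
  cnorm_star : forall a, `|cmul (cstar a) a| = `|a| ^+ 2
}.

#[short(type="cstarType")]
HB.structure Definition CStarAlgebra (R : realType) :=
  {A of CompleteNormedModule R[i] A & isCStarAlgebra R A}.

(* Right Hilbert A-modules. *)
HB.mixin Record isHilbertModule (R : realType) (A : cstarType R) F
    & CompleteNormedModule R[i] F := {
  ract : F -> A -> F;
  minner : F -> F -> A;
  ract_linearl : forall a, linear (fun x => ract x a);
  ract_linearr : forall x, linear (ract x);
  ractA : forall x a b, ract (ract x a) b = ract x (cmul a b);
  minner_linear : forall x, linear (minner x);
  minner_ract : forall x y a, minner x (ract y a) = cmul (minner x y) a;
  minner_star : forall x y, cstar (minner x y) = minner y x;
  minner_pos : forall x, exists b, minner x x = cmul (cstar b) b;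
  minner_norm : forall x, `|x| ^+ 2 = `|minner x x|
}.

#[short(type="hmodType")]
HB.structure Definition HilbertModule (R : realType) (A : cstarType R) :=
  {F of CompleteNormedModule R[i] F & isHilbertModule R A F}.

(* [lact_adj] says that [lact a] is adjointable, hence linear, bounded and
   right A-linear, with adjoint [lact (cstar a)]. *)
HB.mixin Record isCorrespondence (R : realType) (A : cstarType R) F
    & HilbertModule R A F := {
  lact : A -> F -> F;
  lact_linear : forall x, linear (fun a => lact a x);
  lactA : forall a b x, lact (cmul a b) x = lact a (lact b x);
  lact_adj : forall a x y, minner (lact a x) y = minner x (lact (cstar a) y)
}.

#[short(type="corrType")]
HB.structure Definition Correspondence (R : realType) (A : cstarType R) :=
  {F of HilbertModule R A F & isCorrespondence R A F}.

(* B(H, K). The adjoint is uniquely determined by the operator and always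
   exists; it is stored with the operator to have it at hand as a function. *)
Record bop (R : realType) (H K : hilbertType R) := Bop {
  bop_fun :> {linear H -> K};
  bop_adj : K -> H;
  bop_continuous : continuous bop_fun;
  bop_adjP : forall x y, inner (bop_fun x) y = inner x (bop_adj y)
}.

(* L(F, G) for Hilbert modules. *)
Record aop (R : realType) (A : cstarType R) (F G : hmodType A) := Aop {
  aop_fun :> F -> G;
  aop_adj : G -> F;
  aop_adjP : forall x y, minner (aop_fun x) y = minner x (aop_adj y)
}.

Section HilbertOperators.
Context {R : realType} {H K : hilbertType R}.

Definition partial_isometry (V : bop H K) : Prop :=
  forall x, (forall y, V y = 0 -> inner x y = 0) -> `|V x| = `|x|.

Definition coisometric (V : bop H K) : Prop := forall y, V (bop_adj V y) = y.

Definition is_sqrt (B S : H -> H) : Prop :=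
  (forall h, 0 <= inner h (B h)) /\ (forall h, B (B h) = S h).

End HilbertOperators.

(* Unitary operators onto the Hilbert space direct sum of K and L, whose inner
   product is written out (the library's norm on K * L is the sup norm). *)
Definition unitary_sum (R : realType) (H K L : hilbertType R)
    (W : H -> K * L) (W' : K * L -> H) : Prop :=
  [/\ linear W, cancel W W', cancel W' W &
      forall x y, inner (W x).1 (W y).1 + inner (W x).2 (W y).2 = inner x y].

Section AdjointableAlgebra.
Context {R : realType} {A : cstarType R} {F : hmodType A}.
Implicit Types a b : aop F F.

Lemma minnerDr (x y z : F) : minner x (y + z) = minner x y + minner x z.
Proof. by rewrite -[y]scale1r minner_linear !scale1r. Qed.

Lemma cstarD (u v : A) : cstar (u + v) = cstar u + cstar v.
Proof. by rewrite -[u]scale1r cstar_antilinear conjC1 !scale1r. Qed.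

Lemma minner0r (x : F) : minner x 0 = 0.
Proof.
by apply: (addrI (minner x 0)); rewrite -minnerDr !addr0.
Qed.

Lemma minnerZr (c : R[i]) (x y : F) : minner x (c *: y) = c *: minner x y.
Proof. by rewrite -[c *: y]addr0 minner_linear minner0r addr0. Qed.

Lemma cstar0 : cstar (0 : A) = 0.
Proof. by apply: (addrI (cstar 0)); rewrite -cstarD !addr0. Qed.

Lemma cstarZ (c : R[i]) (u : A) : cstar (c *: u) = c^* *: cstar u.
Proof. by rewrite -[c *: u]addr0 cstar_antilinear cstar0 addr0. Qed.

Lemma minnerDl (x y z : F) : minner (x + y) z = minner x z + minner y z.
Proof. by rewrite -minner_star minnerDr cstarD !minner_star. Qed.

Lemma minnerZl (c : R[i]) (x y : F) : minner (c *: x) y = c^* *: minner x y.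
Proof. by rewrite -minner_star minnerZr cstarZ minner_star. Qed.

Fact aop_add_subproof a b x y :
  minner (a x + b x) y = minner x (aop_adj a y + aop_adj b y).
Proof. by rewrite minnerDl minnerDr !aop_adjP. Qed.
Definition aop_add a b : aop F F := Aop (aop_add_subproof a b).

Fact aop_scale_subproof (c : R[i]) a x y :
  minner (c *: a x) y = minner x (c^* *: aop_adj a y).
Proof. by rewrite minnerZl minnerZr aop_adjP. Qed.
Definition aop_scale (c : R[i]) a : aop F F := Aop (aop_scale_subproof c a).

Fact aop_mul_subproof a b x y :
  minner (a (b x)) y = minner x (aop_adj b (aop_adj a y)).
Proof. by rewrite !aop_adjP. Qed.
Definition aop_mul a b : aop F F := Aop (aop_mul_subproof a b).

Fact aop_star_subproof a x y : minner (aop_adj a x) y = minner x (a y).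
Proof. by rewrite -minner_star -aop_adjP minner_star. Qed.
Definition aop_star a : aop F F := Aop (aop_star_subproof a).

Definition cstar_subalgebra (B : set (aop F F)) : Prop :=
  [/\ (forall a b, B a -> B b -> B (aop_add a b)),
      (forall (c : R[i]) a, B a -> B (aop_scale c a)),
      (forall a b, B a -> B b -> B (aop_mul a b)),
      (forall a, B a -> B (aop_star a)) &
      forall a, (forall e : R[i], 0 < e ->
        exists2 b, B b & forall x, `|a x - b x| <= e * `|x|) -> B a].

Definition generated_cstar (G : set (aop F F)) : set (aop F F) :=
  [set a | forall B, cstar_subalgebra B -> G `<=` B -> B a].

(* Nondegenerate representation of the C*-subalgebra B of L(F); the values of
   pi outside B are irrelevant. *)
Definition subalgebra_representation (B : set (aop F F)) (H : hilbertType R)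
    (pi : aop F F -> bop H H) : Prop :=
  [/\ (forall (c : R[i]) a b h, B a -> B b ->
         pi (aop_add (aop_scale c a) b) h = c *: pi a h + pi b h),
      (forall a b h, B a -> B b -> pi (aop_mul a b) h = pi a (pi b h)),
      (forall a h, B a -> pi (aop_star a) h = bop_adj (pi a) h) &
      closed_span [set v | exists a h, B a /\ v = pi a h] = setT].

End AdjointableAlgebra.

Definition representation (R : realType) (A : cstarType R) (H : hilbertType R)
    (sigma : A -> bop H H) : Prop :=
  [/\ (forall (c : R[i]) a b h,
         sigma (c *: a + b) h = c *: sigma a h + sigma b h),
      (forall a b h, sigma (cmul a b) h = sigma a (sigma b h)),
      (forall a h, sigma (cstar a) h = bop_adj (sigma a) h) &
      closed_span [set v | exists a h, v = sigma a h] = setT].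

(* Interior tensor products are characterized, not constructed: P together
   with t : (x, y) |-> x (x) y is a realization of F (x) G when inner products
   of elementary tensors are the prescribed ones and elementary tensors are
   total. This determines (P, t) up to a unique unitary; that t is bilinear,
   A-balanced and compatible with the right actions follows. *)
Definition is_interior_tensor (R : realType) (A : cstarType R)
    (F G P : corrType A) (t : F -> G -> P) : Prop :=
  [/\ (forall x1 x2 y1 y2,
         minner (t x1 y1) (t x2 y2) = minner y1 (lact (minner x1 x2) y2)),
      (forall a x y, lact a (t x y) = t (lact a x) y) &
      closed_span [set v | exists x y, v = t x y] = setT].

(* (K, t) is a realization of F (x)_sigma D, for D a closed subspace of H that
   reduces sigma; the values of t outside F * D are irrelevant. *)
Definition is_hilbert_tensor (R : realType) (A : cstarType R) (F : hmodType A)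
    (H : hilbertType R) (sigma : A -> bop H H) (D : set H)
    (K : hilbertType R) (t : F -> H -> K) : Prop :=
  (forall x1 x2 h1 h2, D h1 -> D h2 ->
     inner (t x1 h1) (t x2 h2) = inner h1 (sigma (minner x1 x2) h2)) /\
  closed_span [set v | exists x h, D h /\ v = t x h] = setT.

(* V = f (x) g, as an operator from F (x) D (realized by t) to G (x) H'
   (realized by t'). *)
Definition is_tensor_op (F G : Type) (R : realType) (H H' K K' : hilbertType R)
    (D : set H) (t : F -> H -> K) (t' : G -> H' -> K')
    (f : F -> G) (g : H -> H') (V : bop K K') : Prop :=
  forall x h, D h -> V (t x h) = t' (f x) (g h).

(* The tensor powers of the correspondence E = tpow 1, with the identifications
   of tpow n (x) tpow m with tpow (n + m) and, through tvac, of A with tpow 0.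
   Equalities across the fibres are stated in the total space. *)
Record tensor_powers (R : realType) (A : cstarType R) := TensorPowers {
  tpow :> nat -> corrType A;
  tmul : forall n m, tpow n -> tpow m -> tpow (n + m);
  tmulP : forall n m, is_interior_tensor (@tmul n m);
  tmulA : forall n m k (x : tpow n) (y : tpow m) (z : tpow k),
    existT (fun i => tpow i : Type) _ (tmul x (tmul y z)) =
    existT (fun i => tpow i : Type) _ (tmul (tmul x y) z);
  tvac : A -> tpow 0;
  tvac_linear : linear tvac;
  tvac_bij : bijective tvac;
  tvac_minner : forall a b, minner (tvac a) (tvac b) = cmul (cstar a) b;
  tvac_lact : forall a b, lact a (tvac b) = tvac (cmul a b);
  tvac_ract : forall a b, ract (tvac a) b = tvac (cmul a b);
  tmul_vacl : forall n a (x : tpow n), tmul (tvac a) x = lact a x;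
  tmul_vacr : forall n a (x : tpow n),
    existT (fun i => tpow i : Type) _ (tmul x (tvac a)) =
    existT (fun i => tpow i : Type) _ (ract x a)
}.

(* A standard subproduct system X. The isometric inclusion of X(n) in the n-th
   tensor power of E = X(1) is adjointable, i.e. X(n) is orthogonally
   complementable in that power (equivalently, in each X(k) (x) X(n - k)). *)
Record subproduct_system (R : realType) (A : cstarType R) := SubproductSystem {
  sp_fib :> nat -> corrType A;
  sp_pow : tensor_powers A;
  sp_incl : forall n, aop (sp_fib n) (sp_pow n);
  sp_incl_isom : forall n (x y : sp_fib n),
    minner (sp_incl n x) (sp_incl n y) = minner x y;
  sp_incl_lact : forall n a (x : sp_fib n),
    sp_incl n (lact a x) = lact a (sp_incl n x);
  sp_incl0 : forall x : sp_pow 0, exists y, sp_incl 0 y = x;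
  sp_incl1 : forall x : sp_pow 1, exists y, sp_incl 1 y = x;
  sp_sub : forall n m (x : sp_fib (n + m)),
    closed_span [set v | exists y z, v = tmul (sp_incl n y) (sp_incl m z)]
      (sp_incl (n + m) x)
}.

Section Subproduct.
Context {R : realType} {A : cstarType R}.
Variable X : subproduct_system A.

(* p_n, with values in X(n). *)
Definition sp_proj n (x : sp_pow X n) : X n := aop_adj (sp_incl X n) x.

Definition sp_vac (a : A) : X 0 := sp_proj (tvac (sp_pow X) a).

(* p_(n + m) (x (x) y) *)
Definition sp_mul n m (x : X n) (y : X m) : X (n + m) :=
  sp_proj (tmul (sp_incl X n x) (sp_incl X m y)).

(* A realization of the Fock module, the direct sum of the X(n), with the
   X-shift. *)
Record fock_module := FockModule {
  fock :> hmodType A;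
  fock_in : forall n, X n -> fock;
  fock_in_isom : forall n (x y : X n),
    minner (fock_in x) (fock_in y) = minner x y;
  fock_in_orth : forall n m (x : X n) (y : X m),
    n != m -> minner (fock_in x) (fock_in y) = 0;
  fock_total : closed_span [set v | exists n (x : X n), v = fock_in x] = setT;
  xshift : forall n, X n -> aop fock fock;
  xshiftE : forall n m (x : X n) (y : X m),
    xshift x (fock_in y) = fock_in (sp_mul x y)
}.

Definition toeplitz (F : fock_module) : set (aop F F) :=
  generated_cstar [set a | exists n (x : X n), a = xshift F x].

Section CompletelyContractive.
Context {F : hmodType A} {H : hilbertType R}.

(* The linking algebra of F acts on the Hilbert module F + A, with x in F acting
   by (y, a) |-> (x a, 0); hence k * k matrices over F act on (F + A)^k.
   [linking_bound z c] says that the operator norm of z is at most c. *)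
Definition linking_bound k (z : 'I_k -> 'I_k -> F) (c : R[i]) : Prop :=
  forall (y : 'I_k -> F) (a : 'I_k -> A),
    `|\sum_i minner (\sum_j ract (z i j) (a j)) (\sum_j ract (z i j) (a j))|
    <= c ^+ 2 * `|\sum_j (minner (y j) (y j) + cmul (cstar (a j)) (a j))|.

Definition matrix_bound k (b : 'I_k -> 'I_k -> bop H H) (c : R[i]) : Prop :=
  forall h : 'I_k -> H,
    \sum_i `|\sum_j b i j (h j)| ^+ 2 <= c ^+ 2 * \sum_j `|h j| ^+ 2.

Definition completely_contractive (T : F -> bop H H) : Prop :=
  forall k (z : 'I_k -> 'I_k -> F) (c : R[i]), 0 <= c ->
    linking_bound z c -> matrix_bound (fun i j => T (z i j)) c.

End CompletelyContractive.

Section Representations.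
Context {H : hilbertType R}.
Variable T : forall n, X n -> bop H H.

Definition rep0 (a : A) : bop H H := T (sp_vac a).

Record is_cc_covariant_rep : Prop := IsCCCovariantRep {
  ccr_linear : forall n (c : R[i]) (x y : X n) h,
    T (c *: x + y) h = c *: T x h + T y h;
  ccr_rep0 : representation rep0;
  ccr_cc : forall n, completely_contractive (@T n);
  ccr_ract : forall n (x : X n) a h, T (ract x a) h = T x (rep0 a h);
  ccr_lact : forall n a (x : X n) h, T (lact a x) h = rep0 a (T x h);
  ccr_mul : forall n m (x : X n) (y : X m) h, T (sp_mul x y) h = T x (T y h)
}.

(* The Hilbert spaces X(n) (x)_sigma H with the operators T_n^~ on them. *)
Record tilde_ops := TildeOps {
  tl_space : nat -> hilbertType R;
  tl_tens : forall n, X n -> H -> tl_space n;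
  tl_tensP : forall n, is_hilbert_tensor rep0 setT (@tl_tens n);
  tl_op : forall n, bop (tl_space n) H;
  tl_opE : forall n (x : X n) h, tl_op n (tl_tens x h) = T x h
}.

Definition fully_coisometric : Prop :=
  exists r : tilde_ops, forall n, coisometric (tl_op r n).

Definition extends_to_cstar_rep (F : fock_module) : Prop :=
  exists pi : aop F F -> bop H H,
    subalgebra_representation (@toeplitz F) pi /\
    forall n (x : X n) h, pi (xshift F x) h = T x h.

Definition is_defect (r : tilde_ops) (Delta : bop H H) : Prop :=
  is_sqrt Delta (fun h => h - tl_op r 1 (bop_adj (tl_op r 1) h)).

Definition relatively_isometric (r : tilde_ops) (Delta : bop H H) : Prop :=
  (forall n, partial_isometry (tl_op r n)) /\
  ((forall n, closed_span [set v | exists (x : X n) h, v = tl_tens r x (Delta h)]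
                `<=` range (bop_adj (tl_op r n))) \/
   (forall n (x : X n) h,
      Delta (bop_adj (T x) (T x (Delta h))) = rep0 (minner x x) (Delta h))).

(* The Hilbert spaces E^(x)n (x)_sigma H and, for x in X(m), the operators
   v |-> x (x) v from X(k) (x)_sigma H to E^(x)(m + k) (x)_sigma H. *)
Record power_space (r : tilde_ops) := PowerSpace {
  pw_space : nat -> hilbertType R;
  pw_tens : forall n, sp_pow X n -> H -> pw_space n;
  pw_tensP : forall n, is_hilbert_tensor rep0 setT (@pw_tens n);
  pw_creation : forall m k, X m -> bop (tl_space r k) (pw_space (m + k));
  pw_creationP : forall m k (x : X m),
    is_tensor_op setT (@tl_tens r k) (@pw_tens (m + k))
      (fun y : X k => tmul (sp_incl X m x) (sp_incl X k y)) id
      (pw_creation k x)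
}.

End Representations.
End Subproduct.

Arguments sp_proj {R A X} n x.
Arguments tl_tens {R A X H T} t n x h.
Arguments tl_tensP {R A X H T} t n.
Arguments pw_tens {R A X H T r} p n x h.
Arguments pw_tensP {R A X H T r} p n.
Arguments xshift {R A X} f {n} x.

(* Main.v *)
Require Import Defs.
From HB Require Import structures.
From mathcomp Require Import all_boot all_order all_algebra complex.
From mathcomp Require Import boolp classical_sets functions reals topology normedtype sequences.
From mathcomp Require Import ring lra.

Set Implicit Arguments.
Unset Strict Implicit.
Unset Printing Implicit Defensive.

Import Order.TTheory GRing.Theory Num.Theory.
Import numFieldNormedType.Exports.

Local Open Scope classical_set_scope.
Local Open Scope ring_scope.

(* The projections P_n = T~_n T~_n^* decrease to a projection Q, and relative
   isometry makes Delta = 1 - P_1 a projection with T~_n^* T_n(x) d = x (x) d for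
   d in the range D of Delta.  Hence x (x) d |-> T_n(x) d is an isometry V of
   F_X (x) D into H; its range contains the ranges of all P_n - P_(n+1), so it is
   the range of 1 - Q.  As T~_j^* maps QH into X(j) (x) QH, both parts are invariant
   under all T_n(x), and Z, the restriction of T to U = QH, is fully coisometric.

   The hypothesis on the limits says that (S_m(x) (x) I) J_l u - J_(m+l) Z_m(x) u
   tends to 0, where J_l u = T~_l^* u is isometric on U, whereas
   (S_m(x)^* (x) I) J_(m+l) u = J_l Z_m(x)^* u holds exactly.  So the isometries
   N^(-1/2) sum_(N <= l < 2N) J_l of U into F_X (x) H intertwine S_m(x) (x) I and
   Z_m(x), and their adjoints, asymptotically.  The a in L(F_X) that are intertwined
   in this way, together with a^*, with some operator pi(a) form a C*-subalgebra, as
   |pi(a)| is at most a constant times |a|; hence pi is a representation of the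
   Toeplitz algebra.

   F_X (x) H itself is not constructed: its vectors are used through the functionals
   (y, h) |-> <y (x) h, v> on F_X * H. *)

(** * Real-valued norms *)

(** [J_l] sends U into the degree l part of F_X (x) H, so one [J_l] compares S_m(x) only with a map
    into degree m + l. The window N <= l < 2N removes this shift of degrees: moving it by m changes
    2m terms, whatever N is, and as different degrees are orthogonal the sum has norm N^(1/2) |u|.
    Being isometric, the averages also make pi unique: an operator intertwined with a small a is
    small, so linearity, products and adjoints of pi follow by comparing two candidates, without any
    limit space.

    The limit hypothesis speaks of norms only. It yields convergence of vectors because T~_{m+l}
    maps (S_m(x) (x) Q) J_l u exactly to T_m(x) u, so that J_{m+l} T_m(x) u is an orthogonal
    projection of that vector.

    Boundedness of adjointable maps, of sigma and of a (x) I is derived from the bare definitions,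
    without the order on A. This is the origin of the constants: 4 in the Cauchy-Schwarz inequality
    for modules, 2 for representations, and 8, 40, 64 derived from them. Only their finiteness
    matters. *)

Section RealNorm.
Variable (R : realType).

(** Norms of complex spaces are values in [R[i]]; their real parts make [lra], [field] and the total
    order of R available. *)
Definition nr (V : normedZmodType R[i]) (x : V) : R := complex.Re `|x|.

Lemma nrE (V : normedZmodType R[i]) (x : V) : `|x| = (nr x)%:C%C.
Proof. by rewrite RRe_real // ger0_real. Qed.

Lemma nr_ge0 (V : normedZmodType R[i]) (x : V) : 0 <= nr x.
Proof. by rewrite -ler0c -nrE. Qed.

Lemma nr0 (V : normedZmodType R[i]) : nr (0 : V) = 0.
Proof. by rewrite /nr normr0. Qed.

Lemma nr0_eq0 (V : normedZmodType R[i]) (x : V) : nr x = 0 -> x = 0.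
Proof. by move=> x0; apply/eqP; rewrite -normr_eq0 nrE x0. Qed.

Lemma nrN (V : normedZmodType R[i]) (x : V) : nr (- x) = nr x.
Proof. by rewrite /nr normrN. Qed.

Lemma nrB (V : normedZmodType R[i]) (x y : V) : nr (x - y) = nr (y - x).
Proof. by rewrite /nr distrC. Qed.

Lemma nrD (V : normedZmodType R[i]) (x y : V) : nr (x + y) <= nr x + nr y.
Proof. by rewrite -lecR rmorphD /= -!nrE ler_normD. Qed.

Lemma nr_le_add (V : normedZmodType R[i]) (x y : V) : nr x <= nr y + nr (x - y).
Proof. by rewrite -{1}(subrK y x) addrC; exact: nrD. Qed.

Lemma nr_tri (V : normedZmodType R[i]) (x a b : V) : nr (a - b) <= nr (x - a) + nr (x - b).
Proof.
rewrite (_ : a - b = (x - b) - (x - a)); last by rewrite opprB [RHS]addrC subrKA.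
by apply: le_trans (nrD _ _) _; rewrite nrN addrC.
Qed.

Lemma nr_sum (V : normedZmodType R[i]) I (s : seq I) (P : pred I) (f : I -> V) :
  nr (\sum_(i <- s | P i) f i) <= \sum_(i <- s | P i) nr (f i).
Proof.
elim/big_rec2 : _ => [|i y x _ h]; first by rewrite nr0.
by apply: le_trans (nrD _ _) _; rewrite lerD2l.
Qed.

Lemma nrZ (V : normedModType R[i]) (c : R[i]) (x : V) : nr (c *: x) = nr c * nr x.
Proof. by apply: complexI; rewrite rmorphM /= -!nrE normrZ. Qed.

Lemma nrM (c d : R[i]) : nr (c * d) = nr c * nr d.
Proof. by apply: complexI; rewrite rmorphM /= -!nrE normrM. Qed.

Lemma nr_real (r : R) : nr (r%:C%C) = `|r|.
Proof. by rewrite /nr normc_def /= expr0n /= addr0 sqrtr_sqr. Qed.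

Lemma nr_conj (c : R[i]) : nr c^* = nr c.
Proof. by rewrite /nr norm_conjC. Qed.

Lemma Re_le_nr (c : R[i]) : complex.Re c <= nr c.
Proof.
rewrite -lecR -nrE; apply: le_trans (normc_ge_Re c).
by rewrite lecR ler_norm.
Qed.

Lemma closureR (V : normedModType R[i]) (S : set V) x :
  closure S x <-> forall e : R, 0 < e -> exists2 y, S y & nr (x - y) < e.
Proof.
split=> [cSx e e0|h].
  have [|y [Sy]] := cSx (ball x (e%:C%C)); first by apply: nbhsx_ballx; rewrite ltcR.
  by rewrite -ball_normE /= nrE ltcR; exists y.
move=> B /nbhs_ballP[e /= e0]; rewrite -ball_normE => sB.
have ee : e = (complex.Re e)%:C%C by rewrite RRe_real // gtr0_real.
have [|y Sy xy] := h (complex.Re e); first by rewrite -ltcR -ee.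
by exists y; split => //; apply: sB => /=; rewrite ee nrE ltcR.
Qed.

(** Sequential convergence over a bare normed group, so that vectors, scalars and module elements
    are treated alike, without filters. *)
Definition tends (V : normedZmodType R[i]) (u : nat -> V) (l : V) :=
  forall e : R, 0 < e -> exists N, forall n, (N <= n)%N -> nr (u n - l) < e.

Lemma cvgR (V : normedModType R[i]) (u : nat -> V) (l : V) :
  u n @[n --> \oo] --> l <-> tends u l.
Proof.
split.
  move=> /cvgrPdist_lt h e e0; have /h : 0 < e%:C%C by rewrite ltcR.
  case=> N _ hN; exists N => n /hN /=; by rewrite distrC nrE ltcR.
move=> h; apply/cvgrPdist_lt => e e0.
have ee : e = (complex.Re e)%:C%C by rewrite RRe_real // gtr0_real.
have [|N hN] := h (complex.Re e); first by rewrite -ltcR -ee.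
by exists N => // n /= /hN; rewrite distrC nrE ee ltcR.
Qed.

Lemma cvgR_complete (V : completeNormedModType R[i]) (u : nat -> V) :
  (forall e : R, 0 < e -> exists N, forall m n, (N <= m)%N -> (N <= n)%N -> nr (u m - u n) < e) ->
  exists l, tends u l.
Proof.
move=> h; suff /cauchy_cvg : cauchy (u @ \oo).
  by move=> /cvg_ex[l /cvgR]; exists l.
apply/cauchyP => e e0.
have ee : e = (complex.Re e)%:C%C by rewrite RRe_real // gtr0_real.
have [|N hN] := h (complex.Re e); first by rewrite -ltcR -ee.
exists (u N); exists N => // n /= Nn.
by rewrite -ball_normE /= nrE ee ltcR hN.
Qed.

Lemma boundedR (V W : normedModType R[i]) (f : {linear V -> W}) :
  continuous f -> exists2 C : R, 0 < C & forall x, nr (f x) <= C * nr x.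
Proof.
move=> /(_ 0) /continuous_linear_bounded /linear_boundedP [M [Mr h]].
have MM : M = (complex.Re M)%:C%C by rewrite RRe_real.
exists (`|complex.Re M| + 1); first by rewrite ltr_pwDr.
move=> x; have := h ((`|complex.Re M| + 1)%:C%C); rewrite MM ltcR.
move=> /(_ _ x); rewrite !nrE -rmorphM lecR; apply.
by rewrite (le_lt_trans (ler_norm _)) // ltrDl.
Qed.

Lemma continuousR (V W : normedModType R[i]) (f : {linear V -> W}) (C : R) :
  (forall x, nr (f x) <= C * nr x) -> continuous f.
Proof.
move=> h; apply: bounded_linear_continuous; apply/linear_boundedP.
exists (C%:C%C); split; first by apply/complex_realP; exists C.
move=> r Cr x; rewrite (nrE (f x)); apply: (@le_trans _ _ ((C * nr x)%:C%C)).
  by rewrite lecR; exact: h.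
by rewrite rmorphM /= -nrE ler_wpM2r // ltW.
Qed.

Lemma tends_unique (V : normedZmodType R[i]) (u : nat -> V) l l' :
  tends u l -> tends u l' -> l = l'.
Proof.
move=> h h'; apply/eqP; rewrite -subr_eq0; apply/eqP; apply: nr0_eq0.
apply/eqP; rewrite eq_le nr_ge0 andbT; apply/ler_addgt0Pr => e e0; rewrite add0r.
have e20 : 0 < e / 2 by rewrite divr_gt0.
have [N hN] := h _ e20; have [N' hN'] := h' _ e20.
have := hN (maxn N N') (leq_maxl _ _); have := hN' (maxn N N') (leq_maxr _ _).
set w := u _ => a b; rewrite (_ : l - l' = (w - l') - (w - l)); last first.
  by rewrite opprB [RHS]addrC subrKA.
by apply: le_trans (nrD _ _) _; rewrite nrN; lra.
Qed.

(** The explicit tail estimate is what the sliding hump of [aop_bounded] needs; bare convergence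
    serves [cstar_sqrt]. *)
Lemma geometric_limit (V : completeNormedModType R[i]) (u : nat -> V) (C q : R) :
  0 <= q < 1 -> (forall n, nr (u n.+1 - u n) <= C * q ^+ n) ->
  exists l, tends u l /\ forall n, nr (u n - l) <= C * q ^+ n / (1 - q).
Proof.
move=> /andP[q0 q1] us; have C0 : 0 <= C by have := us 0; rewrite expr0 mulr1; exact/le_trans/nr_ge0.
have q10 : 0 < 1 - q by rewrite subr_gt0.
have ud n k : nr (u (n + k)%N - u n) <= C * q ^+ n / (1 - q) * (1 - q ^+ k).
  elim: k => [|k IH]; first by rewrite addn0 subrr nr0 expr0 subrr mulr0.
  rewrite addnS -[u _.+1](subrK (u (n + k)%N)) -addrA.
  apply: le_trans (nrD _ _) _; have := us (n + k)%N; rewrite exprD exprS => h.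
  have -> : C * q ^+ n / (1 - q) * (1 - q * q ^+ k) =
     C * (q ^+ n * q ^+ k) + C * q ^+ n / (1 - q) * (1 - q ^+ k) by field; rewrite gt_eqF.
  by rewrite lerD.
have ud' n m : (n <= m)%N -> nr (u n - u m) <= C * q ^+ n / (1 - q).
  move=> nm; rewrite -(subnKC nm) nrB; apply: le_trans (ud _ _) _.
  rewrite ler_piMr ?divr_ge0 ?mulr_ge0 ?exprn_ge0 // ?(ltW q10) //.
  by rewrite gerBl exprn_ge0.
have pw (e : R) : 0 < e -> exists N, forall n, (N <= n)%N -> C * q ^+ n / (1 - q) < e.
  move=> e0; have C1 : 0 < C + 1 by rewrite ltr_wpDl.
  have : GRing.exp q @ \oo --> (0 : R) by apply: cvg_expr; rewrite ger0_norm.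
  move=> /cvgrPdist_lt /(_ (e * (1 - q) / (C + 1)) ltac:(by rewrite divr_gt0 ?mulr_gt0)).
  case=> N _ hN; exists N => n /hN /=; rewrite sub0r normrN ger0_norm ?exprn_ge0 //.
  rewrite ltr_pdivrMr // ltr_pdivlMr // => h; apply: le_lt_trans h; rewrite mulrC.
  by rewrite ler_wpM2l ?exprn_ge0 // lerDl.
have [|l ul] := @cvgR_complete V u.
  move=> e e0; have [|N hN] := pw (e / 2); first by rewrite divr_gt0.
  exists N => m n Nm Nn; apply: le_lt_trans (nr_tri (u N) _ _) _.
  by have := ud' N m Nm; have := ud' N n Nn; have := hN N (leqnn _); lra.
exists l; split => // n; apply/ler_addgt0Pr => e e0; have [N hN] := ul e e0.
apply: le_trans (nr_tri (u (maxn N n)) _ _) _; rewrite lerD //.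
  by rewrite nrB; apply: ud'; exact: leq_maxr.
by apply/ltW/hN; exact: leq_maxl.
Qed.

Lemma small_inv (d : R) : 0 < d -> exists N, forall n, (N <= n)%N -> n.+1%:R^-1 < d.
Proof.
move=> d0; exists (Num.truncn d^-1) => n Nn.
rewrite invf_plt ?posrE //; apply: (@lt_le_trans _ _ (Num.truncn d^-1).+1%:R).
  exact: truncnS_gt.
by rewrite ler_nat.
Qed.

End RealNorm.

(** * Hilbert spaces and closed subspaces *)

Section Inner.
Variables (R : realType) (H : hilbertType R).
Implicit Types (x y z : H).

Lemma innerDr x y z : inner x (y + z) = inner x y + inner x z.
Proof. by rewrite -[y]scale1r inner_linear scale1r mul1r. Qed.

Lemma inner0r x : inner x 0 = 0.
Proof. by apply: (addrI (inner x 0)); rewrite -innerDr !addr0. Qed.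

Lemma innerZr x c y : inner x (c *: y) = c * inner x y.
Proof. by rewrite -[c *: y]addr0 inner_linear inner0r addr0. Qed.

Lemma innerNr x y : inner x (- y) = - inner x y.
Proof. by rewrite -scaleN1r innerZr mulN1r. Qed.

Lemma innerBr x y z : inner x (y - z) = inner x y - inner x z.
Proof. by rewrite innerDr innerNr. Qed.

Lemma innerC x y : inner y x = (inner x y)^*.
Proof. by rewrite inner_conj. Qed.

Lemma innerDl x y z : inner (x + y) z = inner x z + inner y z.
Proof. by rewrite -inner_conj innerDr rmorphD /= !inner_conj. Qed.

Lemma inner0l x : inner 0 x = 0.
Proof. by rewrite -inner_conj inner0r conjC0. Qed.

Lemma innerZl c x y : inner (c *: x) y = c^* * inner x y.
Proof. by rewrite -inner_conj innerZr rmorphM /= inner_conj. Qed.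

Lemma innerNl x y : inner (- x) y = - inner x y.
Proof. by rewrite -inner_conj innerNr rmorphN /= inner_conj. Qed.

Lemma innerBl x y z : inner (x - y) z = inner x z - inner y z.
Proof. by rewrite innerDl innerNl. Qed.

Lemma inner_sumr x I (s : seq I) (P : pred I) (f : I -> H) :
  inner x (\sum_(i <- s | P i) f i) = \sum_(i <- s | P i) inner x (f i).
Proof. exact: (big_morph _ (innerDr x) (inner0r x)). Qed.

Lemma inner_suml x I (s : seq I) (P : pred I) (f : I -> H) :
  inner (\sum_(i <- s | P i) f i) x = \sum_(i <- s | P i) inner (f i) x.
Proof. exact: (big_morph (fun y => inner y x) (fun y z => innerDl y z x) (inner0l x)). Qed.

Lemma inner_nr x : inner x x = (nr x ^+ 2)%:C%C.
Proof. by rewrite -inner_norm nrE rmorphXn. Qed.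

Lemma nr_inner x : nr x ^+ 2 = complex.Re (inner x x).
Proof. by rewrite inner_nr. Qed.

Lemma inner0_eq0 x : inner x x = 0 -> x = 0.
Proof.
by rewrite -inner_norm => /eqP; rewrite sqrf_eq0 normr_eq0 => /eqP.
Qed.

Lemma innerPl x y : (forall z, inner z x = inner z y) -> x = y.
Proof.
by move=> h; apply/eqP; rewrite -subr_eq0; apply/eqP/inner0_eq0; rewrite innerBr !h subrr.
Qed.

Lemma innerPr x y : (forall z, inner x z = inner y z) -> x = y.
Proof. by move=> h; apply: innerPl => z; rewrite !(innerC _ z) h. Qed.

Lemma Re_conj (c : R[i]) : complex.Re c^* = complex.Re c.
Proof. by case: c. Qed.

Lemma nr_addsq x y : nr (x + y) ^+ 2 = nr x ^+ 2 + nr y ^+ 2 + 2 * complex.Re (inner x y).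
Proof.
rewrite !nr_inner innerDl !innerDr (innerC x y) !raddfD /= Re_conj; ring.
Qed.

Lemma nr_subsq x y : nr (x - y) ^+ 2 = nr x ^+ 2 + nr y ^+ 2 - 2 * complex.Re (inner x y).
Proof. by rewrite nr_addsq nrN innerNr raddfN /= mulrN. Qed.

End Inner.

(** Semidefinite forms are allowed because [amplification_bound] applies this to [qform xi], a form
    on the space of maps F -> F. *)
Lemma psd_cauchy_schwarz (R : realType) (V : lmodType R[i]) (B : V -> V -> R[i]) :
  (forall x, scalar (B x)) -> (forall x y, (B x y)^* = B y x) ->
  (forall x, 0 <= complex.Re (B x x)) ->
  forall x y, nr (B x y) ^+ 2 <= complex.Re (B x x) * complex.Re (B y y).
Proof.
move=> lin conjB pos.
have BDr x y z : B x (y + z) = B x y + B x z.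
  by rewrite -[y]scale1r lin scale1r mul1r.
have B0r x : B x 0 = 0 by apply: (addrI (B x 0)); rewrite -BDr !addr0.
have BZr x c y : B x (c *: y) = c * B x y by rewrite -[c *: y]addr0 lin B0r addr0.
have BDl x y z : B (x + y) z = B x z + B y z by rewrite -conjB BDr rmorphD /= !conjB.
have BZl c x y : B (c *: x) y = c^* * B x y by rewrite -conjB BZr rmorphM /= conjB.
have ReM (r : R) (c : R[i]) : complex.Re (r%:C%C * c) = r * complex.Re c.
  by case: c => a b /=; rewrite mul0r subr0.
have BRe x : B x x = (complex.Re (B x x))%:C%C.
  have := conjB x x; case: (B x x) => a b; rewrite /Num.conj_op /= => -[] h.
  by congr (_ +i* _)%C; lra.
move=> x y; set a := complex.Re (B x x); set b := complex.Re (B y y); set c := B x y.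
have key (t : R) : 0 <= a - 2 * t * nr c ^+ 2 + t ^+ 2 * nr c ^+ 2 * b.
  have := pos (x - ((t%:C)%C * c^*) *: y).
  rewrite -scaleNr BDl !BDr !BZl !BZr -/c -(conjB x y) -/c (BRe x) (BRe y) -/a -/b.
  rewrite !rmorphN /= !rmorphM /= conjCK.
  have -> : (t%:C%C)^* = t%:C%C :> R[i] by rewrite /Num.conj_op /= oppr0.
  have -> : (a%:C%C + - (t%:C%C * c^*) * c + (- (t%:C%C * c) * c^* + - (t%:C%C * c) * (- (t%:C%C * c^*) * b%:C%C)) : R[i]) =
     (a - 2 * t * nr c ^+ 2 + t ^+ 2 * nr c ^+ 2 * b)%:C%C.
    have e : (nr c ^+ 2)%:C%C = c^* * c :> R[i] by rewrite rmorphXn /= -nrE normCKC.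
    rewrite (_ : a - _ + _ = a - t * nr c ^+ 2 - t * nr c ^+ 2 + t * t * nr c ^+ 2 * b); last by ring.
    rewrite !(rmorphD, rmorphN) /= (rmorphM _ (t * t * _)) (rmorphM _ (t * t)) !(rmorphM _ t) /= e.
    by ring.
  by [].
have c0 : 0 <= nr c := nr_ge0 _; have a0 : 0 <= a := pos x; have b0 : 0 <= b := pos y.
have [bz|bz] := eqVneq b 0.
  (* If B y y = 0, [key] is affine in t, and this t gives it the value -1 unless c = 0. *)
  have := key ((a + 1) / (2 * nr c ^+ 2)).
  have [->|cn] := eqVneq (nr c) 0; first by rewrite expr0n /= mulr_ge0.
  have -> : 2 * ((a + 1) / (2 * nr c ^+ 2)) * nr c ^+ 2 = a + 1 by field.
  rewrite bz mulr0; lra.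
have := key b^-1.
have -> : a - 2 / b * nr c ^+ 2 + b^-1 ^+ 2 * nr c ^+ 2 * b = (a * b - nr c ^+ 2) / b by field.
by rewrite pmulr_lge0 ?subr_ge0 // invr_gt0 lt_def bz b0.
Qed.

Section InnerCS.
Variables (R : realType) (H : hilbertType R).
Implicit Types (x y z : H).

Lemma cauchy_schwarz x y : nr (inner x y) <= nr x * nr y.
Proof.
rewrite -(ler_pXn2r (n := 2)) // ?nnegrE ?mulr_ge0 ?nr_ge0 // exprMn !nr_inner.
apply: psd_cauchy_schwarz => [z|z w|z]; [exact: inner_linear|exact: inner_conj|].
by rewrite -nr_inner exprn_ge0 // nr_ge0.
Qed.

End InnerCS.

Section ClosedSubspaces.
Variables (R : realType) (V : normedModType R[i]).

(** All density arguments run through this predicate: a property of vectors holds everywhere once it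
    cuts out a closed subspace that contains a total set ([total_sub]). *)
Definition clsub (P : set V) : Prop :=
  [/\ P 0, (forall (c : R[i]) x y, P x -> P y -> P (c *: x + y)) & closure P `<=` P].

Lemma clsubD P x y : clsub P -> P x -> P y -> P (x + y).
Proof. by move=> [_ h _] Px Py; rewrite -[x]scale1r; apply: h. Qed.

Lemma clsub_tends P (u : nat -> V) l :
  clsub P -> (forall n, P (u n)) -> tends u l -> P l.
Proof.
move=> [_ _ hP] Pu ul; apply/hP/closureR => e e0.
have [N /(_ N (leqnn N))] := ul e e0; rewrite nrB; by exists (u N).
Qed.

Lemma lin_span_in (S : set V) x : S x -> lin_span S x.
Proof.
move=> Sx; exists 1%N, (fun=> 1), (fun=> x); split => //.
by rewrite big_ord1 scale1r.
Qed.

Lemma lin_spanP (S : set V) x :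
  lin_span S x <-> exists2 s : seq (R[i] * V), (forall p, p \in s -> S p.2) & x = \sum_(p <- s) p.1 *: p.2.
Proof.
split=> [[n [c [s [Ss ->]]]]|[s Ss ->]].
  exists [seq (c i, s i) | i <- index_enum 'I_n]; last by rewrite big_map.
  by move=> p /mapP[i _ ->] /=.
pose d := (0, 0) : R[i] * V.
exists (size s), (fun i => (nth d s i).1), (fun i => (nth d s i).2); split.
  by move=> i; apply: Ss; rewrite mem_nth.
by rewrite (big_nth d) big_mkord.
Qed.

Lemma lin_span_sub (P S : set V) :
  P 0 -> (forall (c : R[i]) x y, P x -> P y -> P (c *: x + y)) ->
  S `<=` P -> lin_span S `<=` P.
Proof.
move=> P0 PD SP x [n [c [s [Ss ->]]]]; elim/big_rec : _ => // i y _ Py.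
by apply: PD => //; apply: SP.
Qed.

Lemma lin_span0 (S : set V) : lin_span S 0.
Proof. by apply/lin_spanP; exists [::] => //; rewrite big_nil. Qed.

Lemma lin_spanD (S : set V) c x y : lin_span S x -> lin_span S y -> lin_span S (c *: x + y).
Proof.
move=> /lin_spanP[s Ss ->] /lin_spanP[s' Ss' ->]; apply/lin_spanP.
exists ([seq (c * p.1, p.2) | p <- s] ++ s').
  move=> p; rewrite mem_cat => /orP[/mapP[q /Ss Sq ->]//|/Ss'//].
rewrite big_cat big_map /= scaler_sumr; congr (_ + _).
by apply: eq_bigr => p _; rewrite scalerA.
Qed.

Lemma closed_span_in (S : set V) x : S x -> closed_span S x.
Proof. by move=> Sx; apply: subset_closure; apply: lin_span_in. Qed.

Lemma clsub_span (S : set V) : clsub (closed_span S).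
Proof.
split; first by apply: subset_closure; apply: lin_span0.
  move=> c x y /closureR Sx /closureR Sy; apply/closureR => e e0.
  have c1 : 0 < nr c + 1 by rewrite ltr_wpDl ?nr_ge0.
  have [x' Sx' xx'] := Sx (e / (2 * (nr c + 1))) ltac:(by rewrite divr_gt0 // mulr_gt0).
  have [y' Sy' yy'] := Sy (e / 2) ltac:(by rewrite divr_gt0).
  exists (c *: x' + y'); first exact: lin_spanD.
  rewrite opprD addrACA -scalerBr; apply: le_lt_trans (nrD _ _) _; rewrite nrZ.
  have : nr c * nr (x - x') <= (nr c + 1) * (e / (2 * (nr c + 1))).
    by apply: ler_pM; rewrite ?nr_ge0 ?lerDl // ltW.
  have -> : (nr c + 1) * (e / (2 * (nr c + 1))) = e / 2 by field; lra.
  by lra.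
by move=> x; rewrite /closed_span -(proj1 (closure_id _)) //; exact: closed_closure.
Qed.

Lemma closed_span_sub (P S : set V) : clsub P -> S `<=` P -> closed_span S `<=` P.
Proof.
move=> [P0 PD Pc] SP x Sx; apply: Pc; move: x Sx; apply: closure_subset.
exact: lin_span_sub.
Qed.

Lemma total_sub (P S : set V) : closed_span S = setT -> clsub P -> S `<=` P -> forall x, P x.
Proof. by move=> ST hP SP x; apply: (closed_span_sub hP SP); rewrite ST. Qed.

End ClosedSubspaces.

Section Operators.
Variables (R : realType).

Lemma clsub_preim (V W : normedModType R[i]) (f : V -> W) (C : R) (P : set W) :
  linear f -> (forall x, nr (f x) <= C * nr x) -> clsub P -> clsub [set x | P (f x)].
Proof.
move=> lf bf hP; have f0 : f 0 = 0.
  have := lf 1 0 0; rewrite !scale1r addr0 => h.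
  by apply: (addrI (f 0)); rewrite -h !addr0.
have fB x y : f (x - y) = f x - f y.
  by rewrite -[- y]scaleN1r addrC lf scaleN1r addrC.
split; first by rewrite /= f0; case: hP.
  by move=> c x y /= Px Py; rewrite lf; case: hP => _ h _; apply: h.
move=> x /closureR cx /=; have [_ _] := hP; apply; apply/closureR => e e0.
have c1 : 0 < `|C| + 1 by rewrite ltr_wpDl.
have [y Py xy] := cx (e / (`|C| + 1)) ltac:(by rewrite divr_gt0).
exists (f y) => //; rewrite -fB; apply: le_lt_trans (bf _) _.
apply: (@le_lt_trans _ _ ((`|C| + 1) * nr (x - y))).
  by rewrite ler_wpM2r ?nr_ge0 // ler_wpDr // ler_norm.
by rewrite mulrC -ltr_pdivlMr.
Qed.

Lemma clsub0 (V : normedModType R[i]) : clsub [set x : V | x = 0].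
Proof.
split => //=; first by move=> c x y -> ->; rewrite scaler0 addr0.
move=> x /closureR cx /=; apply: nr0_eq0; apply/eqP; rewrite eq_le nr_ge0 andbT.
apply/ler_addgt0Pr => e e0; rewrite add0r; have [y /= ->] := cx e e0.
by rewrite subr0 => /ltW.
Qed.

Lemma clsub_ker (V W : normedModType R[i]) (f : V -> W) (C : R) :
  linear f -> (forall x, nr (f x) <= C * nr x) -> clsub [set x | f x = 0].
Proof. by move=> lf bf; exact: (clsub_preim lf bf (@clsub0 W)). Qed.

Lemma clsub_eq (V W : normedModType R[i]) (f g : V -> W) (C D : R) :
  linear f -> (forall x, nr (f x) <= C * nr x) ->
  linear g -> (forall x, nr (g x) <= D * nr x) -> clsub [set x | f x = g x].
Proof.
move=> lf bf lg bg.
have : clsub [set x | f x - g x = 0].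
  apply: (@clsub_ker _ _ _ (C + D)) => [c x y|x].
    by rewrite lf lg scalerBr opprD addrACA.
  by rewrite mulrDl; apply: le_trans (nrD _ _) _; rewrite nrN lerD.
congr clsub; apply/seteqP; split => x /=; first by move=> /eqP; rewrite subr_eq0 => /eqP.
by move=> ->; rewrite subrr.
Qed.

Lemma clsub_orth (H : hilbertType R) (z : H) : clsub [set x | inner z x = 0].
Proof.
split => /=; first exact: inner0r.
  by move=> c x y hx hy; rewrite innerDr innerZr hx hy mulr0 addr0.
move=> x /closureR cx /=; apply: nr0_eq0; apply/eqP; rewrite eq_le nr_ge0 andbT.
apply/ler_addgt0Pr => e e0; rewrite add0r.
have c1 : 0 < nr z + 1 by rewrite ltr_wpDl ?nr_ge0.
have [y /= zy xy] := cx (e / (nr z + 1)) ltac:(by rewrite divr_gt0).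
rewrite -[x](subrK y) innerDr zy addr0; apply: le_trans (cauchy_schwarz _ _) _.
apply: (@le_trans _ _ ((nr z + 1) * nr (x - y))); first by rewrite ler_wpM2r ?nr_ge0 ?lerDl.
by rewrite mulrC -ler_pdivlMr // ltW.
Qed.

Lemma clsub_orthl (H : hilbertType R) (z : H) : clsub [set x | inner x z = 0].
Proof.
have := clsub_orth z; congr clsub; apply/seteqP; split => x /=.
  by rewrite (innerC z x) => ->; rewrite conjC0.
by rewrite (innerC x z) => ->; rewrite conjC0.
Qed.

Lemma total_orth (H : hilbertType R) (S : set H) (z : H) :
  closed_span S = setT -> (forall x, S x -> inner x z = 0) -> z = 0.
Proof. by move=> ST Sz; apply: inner0_eq0; apply: (total_sub ST (clsub_orthl z)). Qed.

Lemma total_innerP (H : hilbertType R) (S : set H) (z w : H) :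
  closed_span S = setT -> (forall x, S x -> inner x z = inner x w) -> z = w.
Proof.
move=> ST Szw; apply/eqP; rewrite -subr_eq0; apply/eqP; apply: (total_orth ST) => x Sx.
by rewrite innerBr Szw // subrr.
Qed.

(** Replaces an orthogonal decomposition of the whole space: if z is close to f + g with f, g in the
    two spans, then g is orthogonal to z and to f, so by Pythagoras f alone is at least as close. *)
Lemma orth_split (H : hilbertType R) (S F G : set H) (z : H) :
  closed_span S = setT ->
  (forall x, S x -> exists f g, [/\ F f, G g & x = f + g]) ->
  (forall f g, F f -> G g -> inner f g = 0) ->
  (forall g, G g -> inner g z = 0) -> closed_span F z.
Proof.
move=> ST SFG FG Gz; apply/closureR => e e0.
have : closed_span S z by rewrite ST.
move=> /closureR /(_ e e0)[y Sy zy].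
have [f [g [Ff Gg yE]]] : exists f g, [/\ lin_span F f, lin_span G g & y = f + g].
  move: Sy; move: (y); apply: lin_span_sub.
  - by exists 0, 0; split; [exact: lin_span0|exact: lin_span0|rewrite addr0].
  - move=> c _ _ [f [g [Ff Gg ->]]] [f' [g' [Ff' Gg' ->]]].
    exists (c *: f + f'), (c *: g + g'); split; [exact: lin_spanD|exact: lin_spanD|].
    by rewrite scalerDr addrACA.
  - move=> x /SFG[f [g [Ff Gg ->]]]; exists f, g; split => //; exact: lin_span_in.
have Gz0 : inner g z = 0.
  have [P0 PD _] := clsub_orthl z; exact: (lin_span_sub P0 PD Gz).
have FG0 : inner f g = 0.
  have [P0 PD _] := clsub_orthl g; apply: (lin_span_sub P0 PD _ Ff) => f' Ff' /=.
  have [P0' PD' _] := clsub_orth f'; apply: (lin_span_sub P0' PD' _ Gg) => g' Gg' /=.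
  exact: FG.
exists f => //; apply: le_lt_trans zy.
rewrite -(ler_pXn2r (n := 2)) // ?nnegrE ?nr_ge0 // yE opprD addrA (nr_subsq (z - f)).
rewrite innerBl FG0 subr0 (innerC g z) Gz0 conjC0 /= mulr0 subr0 lerDl.
by rewrite exprn_ge0 // nr_ge0.
Qed.

End Operators.

(** The vectors [e i] may be linearly dependent, so the map is obtained as a relation [G] between
    common limits of formal combinations on both sides. The bound makes [G] single-valued,
    completeness of [F] makes it total. *)
Lemma extend_total (R : realType) (E : normedModType R[i]) (F : completeNormedModType R[i])
    (I : Type) (e : I -> E) (f : I -> F) (C : R) (S : set E) :
  closed_span S = setT -> (forall x, S x -> exists i, x = e i) ->
  (forall s : seq (R[i] * I),
     nr (\sum_(p <- s) p.1 *: f p.2) <= C * nr (\sum_(p <- s) p.1 *: e p.2)) ->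
  exists g : {linear E -> F}, (forall i, g (e i) = f i) /\ (forall x, nr (g x) <= C * nr x).
Proof.
move=> ST Se bnd.
have C0 : 0 <= `|C| + 1 by rewrite addr_ge0.
pose G x y := forall d : R, 0 < d -> exists s : seq (R[i] * I),
  nr (x - \sum_(p <- s) p.1 *: e p.2) < d /\ nr (y - \sum_(p <- s) p.1 *: f p.2) < d.
have dense x (d : R) : 0 < d -> exists s : seq (R[i] * I), nr (x - \sum_(p <- s) p.1 *: e p.2) < d.
  move=> d0; have : closed_span S x by rewrite ST.
  move=> /closureR /(_ d d0)[y Sy xy].
  suff [s yE] : exists s : seq (R[i] * I), y = \sum_(p <- s) p.1 *: e p.2 by exists s; rewrite -yE.
  move: (y) Sy; apply: lin_span_sub.
  - by exists [::]; rewrite big_nil.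
  - move=> c _ _ [s ->] [s' ->]; exists ([seq (c * p.1, p.2) | p <- s] ++ s').
    rewrite big_cat big_map /= scaler_sumr; congr (_ + _).
    by apply: eq_bigr => p _; rewrite scalerA.
  - by move=> v /Se[i ->]; exists [:: (1, i)]; rewrite big_seq1 scale1r.
clear ST Se.
have diff (s s' : seq (R[i] * I)) :
    nr (\sum_(p <- s) p.1 *: f p.2 - \sum_(p <- s') p.1 *: f p.2) <=
    C * nr (\sum_(p <- s) p.1 *: e p.2 - \sum_(p <- s') p.1 *: e p.2).
  have := bnd (s ++ [seq (- p.1, p.2) | p <- s']).
  rewrite !big_cat !big_map /=.
  have N (W : lmodType R[i]) (h : I -> W) : \sum_(p <- s') - p.1 *: h p.2 = - \sum_(p <- s') p.1 *: h p.2.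
    by rewrite -sumrN; apply: eq_bigr => p _; rewrite scaleNr.
  by rewrite !N.
have Cle (r : R) : 0 <= r -> C * r <= (`|C| + 1) * r.
  by move=> r0; rewrite ler_wpM2r // ler_wpDr // ler_norm.
have Gbnd x y : G x y -> nr y <= C * nr x.
  move=> Gxy; apply/ler_addgt0Pr => d d0.
  have [|s [xs ys]] := Gxy (d / (`|C| + 2)); first by rewrite divr_gt0 // ltr_wpDl.
  have h1 := nr_le_add y (\sum_(p <- s) p.1 *: f p.2).
  have h2 := bnd s.
  have h3 : C * nr (\sum_(p <- s) p.1 *: e p.2) <= C * nr x + `|C| * nr (x - \sum_(p <- s) p.1 *: e p.2).
    set X := \sum_(p <- s) _.
    have a1 := nr_le_add x X; have a2 := nr_le_add X x; rewrite (nrB X x) in a2.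
    have := ler_norm (C * (nr X - nr x)); rewrite normrM mulrBr => h.
    have : `|nr X - nr x| <= nr (x - X) by rewrite ler_norml; lra.
    move=> /(ler_wpM2l (normr_ge0 C)); lra.
  have h4 : `|C| * nr (x - \sum_(p <- s) p.1 *: e p.2) <= `|C| * (d / (`|C| + 2)).
    by apply: ler_wpM2l => //; exact: ltW.
  have h5 : `|C| * (d / (`|C| + 2)) + d / (`|C| + 2) <= d.
    rewrite -{2}[d / _]mul1r -mulrDl mulrA ler_pdivrMr ?ltr_wpDl // mulrC ler_pM2l //; lra.
  lra.
have Glin c x y x' y' : G x y -> G x' y' -> G (c *: x + x') (c *: y + y').
  move=> Gx Gx' d d0.
  have c1 : 0 < nr c + 1 by rewrite ltr_wpDl ?nr_ge0.
  have [s [xs ys]] := Gx (d / (2 * (nr c + 1))) ltac:(by rewrite divr_gt0 // mulr_gt0).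
  have [s' [xs' ys']] := Gx' (d / 2) ltac:(by rewrite divr_gt0).
  exists ([seq (c * p.1, p.2) | p <- s] ++ s').
  have sc (W : lmodType R[i]) (h : I -> W) :
      \sum_(p <- [seq (c * p.1, p.2) | p <- s] ++ s') p.1 *: h p.2 =
      c *: (\sum_(p <- s) p.1 *: h p.2) + \sum_(p <- s') p.1 *: h p.2.
    rewrite big_cat big_map /= scaler_sumr; congr (_ + _).
    by apply: eq_bigr => p _; rewrite scalerA.
  rewrite !sc.
  have aux (W : normedModType R[i]) (u v u' v' : W) : nr (u - u') < d / (2 * (nr c + 1)) ->
      nr (v - v') < d / 2 -> nr (c *: u + v - (c *: u' + v')) < d.
    move=> hu hv; rewrite opprD addrACA -scalerBr; apply: le_lt_trans (nrD _ _) _; rewrite nrZ.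
    have : nr c * nr (u - u') <= (nr c + 1) * (d / (2 * (nr c + 1))).
      by apply: ler_pM; rewrite ?nr_ge0 ?lerDl // ltW.
    have -> : (nr c + 1) * (d / (2 * (nr c + 1))) = d / 2 by field; lra.
    by lra.
  by split; apply: aux.
have Gex x : exists y, G x y.
  have [s_ hs] : {s_ : nat -> seq (R[i] * I) &
      forall n, nr (x - \sum_(p <- s_ n) p.1 *: e p.2) < n.+1%:R^-1}.
    apply: (@choice _ _ (fun n s => nr (x - \sum_(p <- s) p.1 *: e p.2) < n.+1%:R^-1)) => n.
    by apply: dense; rewrite invr_gt0.
  have [|y hy] := @cvgR_complete R F (fun n => \sum_(p <- s_ n) p.1 *: f p.2).
    move=> d d0.
    have [|N hN] := small_inv (d := d / (2 * (`|C| + 1))); first by rewrite divr_gt0 // mulr_gt0 // ltr_wpDl.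
    exists N => m n Nm Nn /=; apply: le_lt_trans (diff _ _) _.
    apply: le_lt_trans (Cle _ (nr_ge0 _)) _.
    have -> : d = (`|C| + 1) * (d / (2 * (`|C| + 1)) + d / (2 * (`|C| + 1))).
      by field; rewrite gt_eqF // ltr_wpDl.
    have C1 : 0 < `|C| + 1 by rewrite ltr_wpDl.
    rewrite ltr_pM2l //.
    apply: le_lt_trans (nr_tri x _ _) _; rewrite addrC ltrD //.
      exact: lt_trans (hs n) (hN _ Nn).
    exact: lt_trans (hs m) (hN _ Nm).
  exists y => d d0; have [N hN] := small_inv d0; have [M hM] := hy d d0.
  exists (s_ (maxn N M)); split.
    apply: lt_trans (hs _) _; apply: hN; exact: leq_maxl.
  by rewrite nrB; apply: hM; exact: leq_maxr.
have [g hg] : {g : E -> F & forall x, G x (g x)} by apply: choice.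
have G0 : G 0 0.
  by move=> d d0; exists [::]; rewrite !big_nil !subr0 !nr0.
have Guniq x y y' : G x y -> G x y' -> y = y'.
  move=> Gy Gy'; apply/eqP; rewrite -subr_eq0; apply/eqP; apply: nr0_eq0.
  have /Gbnd := Glin (- 1) _ _ _ _ Gy' Gy; rewrite !scaleN1r addNr nr0 mulr0 addrC => h.
  by apply/eqP; rewrite eq_le h nr_ge0.
have lg : linear g.
  by move=> c x y; apply: (Guniq (c *: x + y)); [exact: hg|exact: Glin].
pose gl : {linear E -> F} := HB.pack g (GRing.isLinear.Build _ _ _ _ _ lg).
exists gl; split => [i|x]; last exact: Gbnd.
apply: (Guniq (e i)); first exact: hg.
by move=> d d0; exists [:: (1, i)]; rewrite !big_seq1 !scale1r !subrr !nr0.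
Qed.

(** * Closed subspaces as Hilbert spaces *)

Section SubHilbert.
Variables (R : realType) (H : hilbertType R) (P : set H).

Definition sub_pred (hP : clsub P) : {pred H} := fun x => `[< P x >].

Record subspace (hP : clsub P) := Subspace {
  sub_val :> H;
  _ : sub_val \in sub_pred hP
}.

Arguments sub_val {hP} _.

Variable hP : clsub P.

Fact sub_pred_submod : submod_closed (sub_pred hP).
Proof.
split; first by apply/asboolP; case: hP.
move=> c x y /asboolP Px /asboolP Py; apply/asboolP; case: hP => _ h _; exact: h.
Qed.
HB.instance Definition _ := GRing.isSubmodClosed.Build R[i] H (sub_pred hP) sub_pred_submod.

HB.instance Definition _ := [isSub for (@sub_val hP)].
HB.instance Definition _ := [Choice of subspace hP by <:].
HB.instance Definition _ := [SubChoice_isSubLmodule of subspace hP by <:].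

Implicit Types u v : subspace hP.

Lemma subP u : P (sub_val u).
Proof. by case: u => x /= /asboolP. Qed.

Definition sub_norm u : R[i] := `|sub_val u|.

Fact sub_normD u v : sub_norm (u + v) <= sub_norm u + sub_norm v.
Proof. exact: ler_normD. Qed.
Fact sub_normZ (c : R[i]) u : sub_norm (c *: u) = `|c| * sub_norm u.
Proof. exact: normrZ. Qed.
Fact sub_norm0 u : sub_norm u = 0 -> u = 0.
Proof. by move=> /eqP; rewrite normr_eq0 => /eqP h; apply: val_inj. Qed.

HB.instance Definition _ := Lmodule_isNormed.Build R[i] (subspace hP) sub_normD sub_normZ sub_norm0.

Definition to_sub (x : H) (Px : P x) : subspace hP :=
  Subspace (introT (asboolP (P x)) Px : x \in sub_pred hP).

Fact sub_complete (F : set_system (subspace hP)) : ProperFilter F -> cauchy F -> cvg F.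
Proof.
move=> FF Fc; have cH : cauchy (sub_val @ F).
  apply/cauchyP => e e0; have /cauchyP/(_ e e0)[x Fx] := Fc.
  exists (sub_val x); rewrite /fmap /=.
  apply: filterS Fx => y; by rewrite -!ball_normE.
have /cauchy_cvg/cvg_ex[l /= Fl] := cH.
have Pl : P l.
  case: hP => _ _; apply; move=> B /Fl FB.
  have [u Bu] := @filter_ex _ F _ _ FB; exists (sub_val u); split => //; exact: subP.
apply/cvg_ex; exists (to_sub Pl); apply/cvgrPdist_lt => e e0.
have /cvgrPdist_lt /(_ e e0) := Fl; exact: filterS.
Qed.
HB.instance Definition _ := Uniform_isComplete.Build (subspace hP) sub_complete.

Fact sub_inner_linear u : scalar (fun v => inner (sub_val u) (sub_val v)).
Proof. by move=> c v w /=; rewrite innerDr innerZr. Qed.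

HB.instance Definition _ := isHilbertSpace.Build R (subspace hP)
  sub_inner_linear (fun u v => inner_conj (sub_val u) (sub_val v)) (fun u => inner_norm (sub_val u)).

Definition sub_space : hilbertType R := subspace hP.

Lemma sub_innerE (u v : sub_space) : inner u v = inner (sub_val u) (sub_val v).
Proof. by []. Qed.

Lemma sub_nrE (u : sub_space) : nr u = nr (sub_val u).
Proof. by []. Qed.

Lemma sub_val_inj (u v : sub_space) : sub_val u = sub_val v -> u = v.
Proof. exact: val_inj. Qed.

End SubHilbert.

Arguments sub_val {R H P hP} _.
Arguments to_sub {R H P} hP {x} Px.

(** * Bounded linear maps and adjoints *)

Section BoundedLinear.
Variable R : realType.

(** A predicate on plain functions, so that unbundled maps such as x |-> t x h and adjoints qualify,
    also between Hilbert modules. *)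
Definition blin (V W : normedModType R[i]) (f : V -> W) : Prop :=
  linear f /\ exists C : R, forall x, nr (f x) <= C * nr x.

Section Basics.
Variables (V W : normedModType R[i]).
Implicit Types (f g : V -> W).

Lemma blin_pos f : blin f -> exists2 C : R, 0 < C & forall x, nr (f x) <= C * nr x.
Proof.
move=> [lf [C fC]]; exists (`|C| + 1); first by rewrite ltr_wpDl.
move=> x; apply: le_trans (fC x) _; rewrite ler_wpM2r ?nr_ge0 // ler_wpDr //.
exact: ler_norm.
Qed.

Lemma blinD f : blin f -> {morph f : x y / x + y}.
Proof. by move=> [lf _] x y; rewrite -[x]scale1r lf !scale1r. Qed.

Lemma blin0 f : blin f -> f 0 = 0.
Proof. by move=> bf; apply: (addrI (f 0)); rewrite -blinD // !addr0. Qed.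

Lemma blinZ f c x : blin f -> f (c *: x) = c *: f x.
Proof. by move=> bf; have [lf _] := bf; rewrite -[c *: x]addr0 lf blin0 // addr0. Qed.

Lemma blinB f x y : blin f -> f (x - y) = f x - f y.
Proof. by move=> bf; rewrite blinD // -scaleN1r blinZ // scaleN1r. Qed.

Lemma blin_sum f I (s : seq I) (P : pred I) (F : I -> V) : blin f ->
  f (\sum_(i <- s | P i) F i) = \sum_(i <- s | P i) f (F i).
Proof. by move=> bf; apply: big_morph; [exact: blinD|exact: blin0]. Qed.

Lemma blin_tends f u l : blin f -> tends u l -> tends (fun n => f (u n)) (f l).
Proof.
move=> bf ul e e0; have [C C0 fC] := blin_pos bf.
have [|N hN] := ul (e / C); first by rewrite divr_gt0.
exists N => n /hN; rewrite -blinB // ltr_pdivlMr // mulrC => h.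
exact: le_lt_trans (fC _) h.
Qed.

Lemma blin_preim f P : blin f -> clsub P -> clsub [set x | P (f x)].
Proof. by move=> [lf [C fC]]; exact: clsub_preim lf fC. Qed.

Lemma blin_eq f g : blin f -> blin g -> clsub [set x | f x = g x].
Proof. by move=> [lf [C fC]] [lg [D gD]]; exact: clsub_eq lf fC lg gD. Qed.

Lemma blin_id : blin (@id V).
Proof. by split => //; exists 1 => x; rewrite mul1r. Qed.

Lemma blin_add f g : blin f -> blin g -> blin (fun x => f x + g x).
Proof.
move=> [lf [C fC]] [lg [D gD]]; split => [c x y|].
  by rewrite lf lg scalerDr addrACA.
by exists (C + D) => x; rewrite mulrDl; apply: le_trans (nrD _ _) _; rewrite lerD.
Qed.

Lemma blin_scale c f : blin f -> blin (fun x => c *: f x).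
Proof.
move=> [lf [C fC]]; split => [d x y|].
  by rewrite lf scalerDr !scalerA mulrC.
by exists (nr c * C) => x; rewrite nrZ -mulrA ler_wpM2l ?nr_ge0.
Qed.

Lemma blin_sub f g : blin f -> blin g -> blin (fun x => f x - g x).
Proof.
move=> bf /(blin_scale (- 1)) bg; have := blin_add bf bg.
by congr blin; apply: funext => x; rewrite scaleN1r.
Qed.

End Basics.

Lemma blin_comp (V W Y : normedModType R[i]) (f : V -> W) (g : W -> Y) : blin f -> blin g -> blin (fun x => g (f x)).
Proof.
move=> bf bg; split => [c x y|]; first by have [-> _] := bf; have [-> _] := bg.
have [C C0 fC] := blin_pos bf; have [D D0 gD] := blin_pos bg.
exists (D * C) => x; apply: le_trans (gD _) _; rewrite -mulrA ler_wpM2l //.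
exact: ltW.
Qed.

End BoundedLinear.

Section BoundedOperators.
Variable R : realType.
Implicit Types H K L : hilbertType R.

Lemma bop_blin H K (V : bop H K) : blin V.
Proof.
split; first exact: linearP.
by have [C _ h] := boundedR (@bop_continuous _ _ _ V); exists C.
Qed.

Lemma bop_adjPl H K (V : bop H K) x y : inner (bop_adj V y) x = inner y (V x).
Proof. by rewrite innerC -bop_adjP inner_conj. Qed.

Lemma adj_le H K (f : H -> K) (g : K -> H) (C : R) : 0 <= C ->
  (forall x y, inner (f x) y = inner x (g y)) -> (forall x, nr (f x) <= C * nr x) ->
  forall y, nr (g y) <= C * nr y.
Proof.
move=> C0 fg fC y; have [->|y0] := eqVneq (nr (g y)) 0.
  by rewrite mulr_ge0 // nr_ge0.
have p : 0 < nr (g y) by rewrite lt_def y0 nr_ge0.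
rewrite -(ler_pM2r p) -expr2 nr_inner -fg.
apply: le_trans (Re_le_nr _) _; apply: le_trans (cauchy_schwarz _ _) _.
by rewrite mulrAC ler_wpM2r ?nr_ge0.
Qed.

Lemma bop_adj_le H K (V : bop H K) (C : R) : 0 <= C ->
  (forall x, nr (V x) <= C * nr x) -> forall y, nr (bop_adj V y) <= C * nr y.
Proof. by move=> C0; exact: adj_le (@bop_adjP _ _ _ V). Qed.

Lemma bop_adj_blin H K (V : bop H K) : blin (bop_adj V).
Proof.
split => [c x y|].
  apply: innerPl => z.
  by rewrite innerDr innerZr -!bop_adjP innerDr innerZr.
have [C C0 VC] := blin_pos (bop_blin V); exists C; apply: bop_adj_le => //; exact: ltW.
Qed.

Fact blin_linear H K (f : H -> K) : blin f -> linear f.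
Proof. by case. Qed.

Definition blin_pack H K (f : H -> K) (bf : blin f) : {linear H -> K} :=
  HB.pack f (GRing.isLinear.Build _ _ _ _ _ (blin_linear bf)).

Fact blin_pack_continuous H K (f : H -> K) (bf : blin f) : continuous (blin_pack bf).
Proof. by have [_ [C fC]] := bf; exact: (@continuousR _ _ _ (blin_pack bf) C fC). Qed.

Definition mk_bop H K (f : H -> K) (g : K -> H) (bf : blin f)
    (fg : forall x y, inner (f x) y = inner x (g y)) : bop H K :=
  Bop (@blin_pack_continuous H K f bf) (fg : forall x y, inner (blin_pack bf x) y = inner x (g y)).

(** With y = f x, testing at y + x gives <y, f x> + <x, f y> = 0, and testing at y + 'i x gives <y,
    f x> = <x, f y>. *)
Lemma polarization0 H (f : H -> H) : linear f -> (forall x, inner x (f x) = 0) ->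
  forall x, f x = 0.
Proof.
move=> lf h x; have fD y z : f (y + z) = f y + f z by rewrite -[y]scale1r lf !scale1r.
have f0 : f 0 = 0 by apply: (addrI (f 0)); rewrite -fD !addr0.
have fZ c y : f (c *: y) = c *: f y by rewrite -[c *: y]addr0 lf f0 addr0.
apply: inner0_eq0; set y := f x.
have := h (y + x); rewrite fD innerDl !innerDr !h add0r addr0 => e1.
have := h (y + 'i *: x).
rewrite fD fZ innerDl !innerDr !innerZl !innerZr !h !mulr0 add0r addr0 conjCi => e2.
have : 'i * (inner y (f x) - inner x (f y)) = 0 by rewrite mulrBr -mulNr.
move=> /eqP; rewrite mulf_eq0 (negbTE (neq0Ci _)) /= subr_eq0 => /eqP e3.
move: e1; rewrite -e3 => /eqP; rewrite -mulr2n mulrn_eq0 /= => /eqP.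
by [].
Qed.

End BoundedOperators.

(** * C*-algebras and Hilbert modules *)

Section CStar.
Variables (R : realType) (A : cstarType R).
Implicit Types (a b c d : A).

Lemma cmulDl a b c : cmul (a + b) c = cmul a c + cmul b c.
Proof. by rewrite -[a]scale1r (cmul_linearl c) !scale1r. Qed.

Lemma cmulDr a b c : cmul a (b + c) = cmul a b + cmul a c.
Proof. by rewrite -[b]scale1r (cmul_linearr a) !scale1r. Qed.

Lemma cmul0r a : cmul a 0 = 0.
Proof. by apply: (addrI (cmul a 0)); rewrite -cmulDr !addr0. Qed.

Lemma cmul0l a : cmul 0 a = 0.
Proof. by apply: (addrI (cmul 0 a)); rewrite -cmulDl !addr0. Qed.

Lemma cmulZl (k : R[i]) a b : cmul (k *: a) b = k *: cmul a b.
Proof. by rewrite -[k *: a]addr0 (cmul_linearl b) cmul0l addr0. Qed.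

Lemma cmulZr (k : R[i]) a b : cmul a (k *: b) = k *: cmul a b.
Proof. by rewrite -[k *: b]addr0 (cmul_linearr a) cmul0r addr0. Qed.

Lemma cmulBr a b c : cmul a (b - c) = cmul a b - cmul a c.
Proof. by rewrite cmulDr -scaleN1r cmulZr scaleN1r. Qed.

Lemma cmulBl a b c : cmul (a - b) c = cmul a c - cmul b c.
Proof. by rewrite cmulDl -scaleN1r cmulZl scaleN1r. Qed.

Lemma nr_cmul a b : nr (cmul a b) <= nr a * nr b.
Proof. by rewrite -lecR rmorphM /= -!nrE cnormM. Qed.

Lemma nr_cstar_mul a : nr (cmul (cstar a) a) = nr a ^+ 2.
Proof. by apply: complexI; rewrite rmorphXn /= -!nrE cnorm_star. Qed.

Lemma nr_cstar a : nr (cstar a) = nr a.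
Proof.
suff h b : nr b <= nr (cstar b).
  by apply/eqP; rewrite eq_le h -{2}[a]cstarK h.
have [->|b0] := eqVneq (nr b) 0; first exact: nr_ge0.
have p : 0 < nr b by rewrite lt_def b0 nr_ge0.
by rewrite -(ler_pM2r p) -expr2 -nr_cstar_mul nr_cmul.
Qed.

Lemma cstarB a b : cstar (a - b) = cstar a - cstar b.
Proof.
by rewrite cstarD -scaleN1r cstarZ rmorphN /= conjC1 scaleN1r.
Qed.

(* With [c] self-adjoint, this is the square root [1 - d] of [1 - c]. *)
Lemma cstar_sqrt c : cstar c = c -> nr c <= 4^-1 ->
  exists d, cstar d = d /\ d + d = c + cmul d d.
Proof.
(* The wanted d is a fixed point of [f], which maps the ball of radius 1/2 into itself and at least
   halves distances there. *)
move=> cc c4; pose f d := (2^-1 : R[i]) *: (c + cmul d d).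
pose u n := iter n f 0.
have half0 : 0 <= 2^-1 :> R by rewrite invr_ge0 ler0n.
have n2 : nr (2^-1 : R[i]) = 2^-1.
  have -> : (2^-1 : R[i]) = (2^-1 : R)%:C%C by rewrite fmorphV (rmorph_nat (real_complex R) 2).
  by rewrite nr_real ger0_norm ?invr_ge0 ?ler0n.
have u12 n : nr (u n) <= 2^-1.
  elim: n => [|n IH]; first by rewrite nr0.
  rewrite /u iterS -/(u n) /f nrZ n2.
  have h : nr (cmul (u n) (u n)) <= 2^-1 * 2^-1.
    by apply: le_trans (nr_cmul _ _) _; rewrite ler_pM // nr_ge0.
  have := nrD c (cmul (u n) (u n)); lra.
have fl d d' : nr d <= 2^-1 -> nr d' <= 2^-1 -> nr (f d - f d') <= 2^-1 * nr (d - d').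
  move=> hd hd'; rewrite -scalerBr nrZ n2 ler_wpM2l //.
  have -> : c + cmul d d - (c + cmul d' d') = cmul d (d - d') + cmul (d - d') d'.
    by rewrite opprD addrACA subrr add0r cmulBr cmulBl subrKA.
  apply: le_trans (nrD _ _) _.
  have h1 : nr (cmul d (d - d')) <= 2^-1 * nr (d - d').
    by apply: le_trans (nr_cmul _ _) _; rewrite ler_wpM2r ?nr_ge0.
  have h2 : nr (cmul (d - d') d') <= nr (d - d') * 2^-1.
    by apply: le_trans (nr_cmul _ _) _; rewrite ler_wpM2l ?nr_ge0.
  lra.
have us n : nr (u n.+1 - u n) <= 2^-1 ^+ n * 2^-1.
  elim: n => [|n IH]; first by rewrite /= subr0 expr0 mul1r (u12 1%N).
  rewrite /u [in X in X - _]iterS [in X in _ - X]iterS -/(u n.+1) -/(u n).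
  apply: le_trans (fl _ _ (u12 _) (u12 _)) _.
  by rewrite exprS -mulrA ler_wpM2l.
have [||d [ud' _]] := @geometric_limit R A u 2^-1 2^-1.
- by rewrite half0 invf_lt1 ?ltr0n // ltr1n.
- by move=> n; rewrite mulrC.
have d12 : nr d <= 2^-1.
  apply/ler_addgt0Pr => e e0; have [N hN] := ud' e e0.
  have := hN N (leqnn _); have := u12 N; have := nr_le_add d (u N); rewrite nrB; lra.
have fd : f d = d.
  apply/esym/(tends_unique (u := fun n => u n.+1)).
    by move=> e e0; have [N hN] := ud' e e0; exists N => n Nn; apply: hN; exact: leqW.
  move=> e e0; have [N hN] := ud' e e0; exists N => n Nn.
  rewrite /u iterS -/(u n); apply: le_lt_trans (fl _ _ (u12 _) d12) _.
  have := hN n Nn; have := nr_ge0 (u n - d); lra.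
have uc n : cstar (u n) = u n.
  elim: n => [|n IH]; first by rewrite cstar0.
  rewrite /u iterS -/(u n) /f cstarZ cstarD cstarM IH cc fmorphV /= conjC_nat.
  by [].
exists d; split.
  apply: (tends_unique (u := u)) => // e e0; have [N hN] := ud' e e0.
  by exists N => n /hN h; rewrite -nr_cstar cstarB uc cstarK.
have : (2 : R[i]) *: f d = 2 *: d by rewrite fd.
rewrite /f scalerA mulfV ?pnatr_eq0 // scale1r => ->.
by rewrite scaler_nat mulr2n.
Qed.

Section Representation.
Variables (H : hilbertType R) (sigma : A -> bop H H).
Hypothesis rep : representation sigma.

Lemma repD a b h : sigma (a + b) h = sigma a h + sigma b h.
Proof. by have [l _ _ _] := rep; rewrite -[a]scale1r l !scale1r. Qed.

Lemma rep_zero h : sigma 0 h = 0.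
Proof. by apply: (addrI (sigma 0 h)); rewrite -repD !addr0. Qed.

Lemma repZ (k : R[i]) a h : sigma (k *: a) h = k *: sigma a h.
Proof. by have [l _ _ _] := rep; rewrite -[k *: a]addr0 l rep_zero addr0. Qed.

Lemma repM a b h : sigma (cmul a b) h = sigma a (sigma b h).
Proof. by have [_ m _ _] := rep. Qed.

Lemma rep_star a x y : inner (sigma a x) y = inner x (sigma (cstar a) y).
Proof. by have [_ _ s _] := rep; rewrite s bop_adjP. Qed.

(* With 1 - a^* a = (1 - d)^2, |h|^2 - |sigma(a) h|^2 = |(1 - sigma(d)) h|^2. *)
Lemma rep_bounded a h : nr (sigma a h) <= 2 * nr a * nr h.
Proof.
have small b : nr b = 2^-1 -> nr (sigma b h) <= nr h.
  move=> b2; have [||d [dd dE]] := cstar_sqrt (c := cmul (cstar b) b).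
  - by rewrite cstarM cstarK.
  - by rewrite nr_cstar_mul b2 exprVn -natrX.
  rewrite -(ler_pXn2r (n := 2)) // ?nnegrE ?nr_ge0 // -subr_ge0.
  have -> : nr h ^+ 2 - nr (sigma b h) ^+ 2 = nr (h - sigma d h) ^+ 2.
    rewrite nr_subsq !(nr_inner (sigma _ _)) !rep_star dd -!repM.
    have : inner h (sigma (d + d) h) = inner h (sigma (cmul (cstar b) b + cmul d d) h) by rewrite dE.
    rewrite !repD !innerDr => /(congr1 (@complex.Re R)); rewrite !raddfD /=; lra.
  by rewrite exprn_ge0 // nr_ge0.
have [a0|a0] := eqVneq (nr a) 0.
  by rewrite (nr0_eq0 a0) rep_zero !nr0 mulr0 mul0r.
have ap : 0 < nr a by rewrite lt_def a0 nr_ge0.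
(* Scaling to norm 1/2 makes |b^* b| = 1/4, which [cstar_sqrt] still admits; this costs the factor
   2. *)
have t0 : 0 < (2 * nr a)^-1 by rewrite invr_gt0 mulr_gt0.
have := small (((2 * nr a)^-1)%:C%C *: a).
rewrite nrZ nr_real gtr0_norm // => /(_ ltac:(by field)).
rewrite repZ nrZ nr_real gtr0_norm // => h1.
rewrite -ler_pdivrMl ?mulr_gt0 //.
Qed.

End Representation.
End CStar.

Section HilbertModules.
Variables (R : realType) (A : cstarType R) (F : hmodType A).
Implicit Types (x y z : F) (a b : aop F F).

Lemma minnerBr x y z : minner x (y - z) = minner x y - minner x z.
Proof. by rewrite minnerDr -scaleN1r minnerZr scaleN1r. Qed.

Lemma minnerBl x y z : minner (x - y) z = minner x z - minner y z.
Proof. by rewrite minnerDl -scaleN1r minnerZl rmorphN /= conjC1 scaleN1r. Qed.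

Lemma minner0l x : minner 0 x = 0.
Proof. by rewrite -minner_star minner0r cstar0. Qed.

Lemma minner_nr x : nr (minner x x) = nr x ^+ 2.
Proof. by apply: complexI; rewrite rmorphXn /= -!nrE minner_norm. Qed.

Lemma minner0_eq0 x : minner x x = 0 -> x = 0.
Proof.
by move=> h; apply: nr0_eq0; apply/eqP; rewrite -sqrf_eq0 -minner_nr h nr0.
Qed.

Lemma minnerPl x y : (forall z, minner z x = minner z y) -> x = y.
Proof.
by move=> h; apply/eqP; rewrite -subr_eq0; apply/eqP/minner0_eq0; rewrite minnerBr !h subrr.
Qed.

(* By polarization; the constant 1 would need the order on A. *)
Lemma nr_minner x y : nr (minner x y) <= 4 * nr x * nr y.
Proof.
have polar (u v : F) : nr u = 1 -> nr v = 1 -> nr (minner u v) <= 4.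
  move=> u1 v1; pose B (w : F) := minner w w.
  have Bn w : nr w <= 2 -> nr (B w) <= 4.
    move=> h; rewrite minner_nr; have -> : 4 = 2 ^+ 2 :> R by rewrite -natrX.
    by rewrite lerXn2r // nnegrE ?nr_ge0 ?ler0n.
  have nrI : nr ('i : R[i]) = 1.
    by rewrite /nr normCi.
  pose D w := B (u + w) - B (u - w).
  have DE w : D w = (minner u w + minner w u) *+ 2.
    rewrite /D /B minnerBl !minnerBr minnerDl !minnerDr.
    set p := minner u u; set q := minner u w; set r := minner w u; set s := minner w w.
    have -> : p + q + (r + s) - (p - q - (r - s)) = (q - p) + (p + q) + ((r - s) + (s + r)).
      by rewrite !opprB (addrC (r - s)) addrACA (addrC (p + q)) (addrC (r + s)) (addrC r s).
    by rewrite !subrKA -!mulr2n -mulrnDl.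
  have P : (4 : R[i]) *: minner u v = D v - 'i *: D ('i *: v).
    rewrite !DE minnerZl minnerZr conjCi -scalerMnr scalerDr !scalerA mulrN -expr2 sqrCi opprK.
    rewrite scaleN1r scale1r -mulrnBl opprD opprK addrACA subrr addr0 -mulr2n -mulrnA.
    by rewrite scaler_nat.
  have : nr ((4 : R[i]) *: minner u v) <= 16.
    have T (s w z t : A) : nr (s - w - 'i *: (z - t)) <= nr s + nr w + nr z + nr t.
      have h1 := nrD (s - w) (- ('i *: (z - t))); have h2 := nrD s (- w); have h3 := nrD z (- t).
      rewrite !nrN nrZ nrI mul1r in h1 h2 h3; lra.
    rewrite P; apply: le_trans (T _ _ _ _) _.
    have S w z : nr w = 1 -> nr z = 1 -> nr (B (w + z)) <= 4.
      by move=> w1 z1; apply: Bn; have := nrD w z; lra.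
    have vi : nr ('i *: v) = 1 by rewrite nrZ nrI v1 mulr1.
    have h1 := S u v u1 v1; have h2 := S u (- v) u1 ltac:(by rewrite nrN).
    have h3 := S u ('i *: v) u1 vi; have h4 := S u (- ('i *: v)) u1 ltac:(by rewrite nrN).
    lra.
  have n4 : nr (4 : R[i]) = 4.
    have -> : (4 : R[i]) = (4 : R)%:C%C by rewrite (rmorph_nat (real_complex R) 4).
    by rewrite nr_real ger0_norm ?ler0n.
  by rewrite nrZ n4; lra.
have [x0|x0] := eqVneq (nr x) 0; first by rewrite (nr0_eq0 x0) minner0l !nr0 mulr0 mul0r.
have [y0|y0] := eqVneq (nr y) 0; first by rewrite (nr0_eq0 y0) minner0r !nr0 mulr0.
have xp : 0 < nr x by rewrite lt_def x0 nr_ge0.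
have yp : 0 < nr y by rewrite lt_def y0 nr_ge0.
have := polar (((nr x)^-1)%:C%C *: x) (((nr y)^-1)%:C%C *: y).
rewrite minnerZl minnerZr !nrZ nr_conj !nr_real !gtr0_norm ?invr_gt0 // !mulVf //.
move=> /(_ erefl erefl); rewrite ler_pdivrMl // ler_pdivrMl //.
by have -> : nr y * (nr x * 4) = 4 * nr x * nr y by ring.
Qed.

End HilbertModules.

Section Adjointable.
Variables (R : realType) (A : cstarType R) (F G : hmodType A).
Implicit Types (x y : F) (a : aop F G).

Lemma aopD a x y : a (x + y) = a x + a y.
Proof.
by apply: minnerPl => z; rewrite minnerDr -!(minner_star _ z) !aop_adjP -cstarD -minnerDl.
Qed.

Lemma aopZ a c x : a (c *: x) = c *: a x.
Proof.
by apply: minnerPl => z; rewrite minnerZr -!(minner_star _ z) !aop_adjP minnerZl cstarZ conjCK.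
Qed.

Lemma aop_linear a : linear a.
Proof. by move=> c x y; rewrite aopD aopZ. Qed.

Lemma aop0 a : a 0 = 0.
Proof. by apply: (addrI (a 0)); rewrite -aopD !addr0. Qed.

Lemma aop_adj_le a (e : R) : 0 <= e ->
  (forall x, nr (a x) <= e * nr x) -> forall y : G, nr (aop_adj a y) <= 4 * e * nr y.
Proof.
move=> e0 ae y; have [->|y0] := eqVneq (nr (aop_adj a y)) 0.
  by rewrite !mulr_ge0 ?ler0n // nr_ge0.
have p : 0 < nr (aop_adj a y) by rewrite lt_def y0 nr_ge0.
rewrite -(ler_pM2r p) -expr2 -minner_nr -aop_adjP; apply: le_trans (nr_minner _ _) _.
have -> : 4 * e * nr y * nr (aop_adj a y) = 4 * (e * nr (aop_adj a y)) * nr y by ring.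
by rewrite ler_wpM2r ?nr_ge0 // ler_wpM2l ?ler0n.
Qed.

Lemma aop_adj_linear a : linear (aop_adj a).
Proof.
by move=> c x y; apply: minnerPl => z; rewrite minnerDr minnerZr -!aop_adjP minnerDr minnerZr.
Qed.

End Adjointable.

Section AdjointableBounded.
Variables (R : realType) (A : cstarType R) (F : hmodType A).
Implicit Types (x y z : F) (a b : aop F F).

(* Uniform boundedness by a sliding hump: if [a y_n] grows fast enough on unit
   vectors [y_n], steps of length [16^-n] lead to a point where all
   [<a y_n, .>] are large, whereas [<a y_n, x> = <y_n, a^* x>] is bounded in n. *)
Lemma aop_bounded a : exists2 C : R, 0 < C & forall x, nr (a x) <= C * nr x.
Proof.
have [//|unb] := pselect (exists2 C : R, 0 < C & forall x, nr (a x) <= C * nr x).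
have [y hy] : {y : nat -> F & forall n, nr (y n) = 1 /\ n.+1%:R * 16 ^+ n < nr (a (y n))}.
  apply: (@choice _ _ (fun n y => nr y = 1 /\ n.+1%:R * 16 ^+ n < nr (a y))) => n.
  have Cp : 0 < n.+1%:R * 16 ^+ n :> R by rewrite mulr_gt0 ?exprn_gt0 ?ltr0n.
  have [x] : exists x, n.+1%:R * 16 ^+ n * nr x < nr (a x).
    apply: contrapT => h; apply: unb; exists (n.+1%:R * 16 ^+ n) => // x.
    by rewrite leNgt; apply/negP => hx; apply: h; exists x.
  have [x0|x0] := eqVneq (nr x) 0; first by rewrite (nr0_eq0 x0) aop0 !nr0 mulr0 ltxx.
  have xp : 0 < nr x by rewrite lt_def x0 nr_ge0.
  move=> hx; exists (((nr x)^-1)%:C%C *: x).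
  rewrite aopZ !nrZ !nr_real !gtr0_norm ?invr_gt0 // mulVf //; split => //.
  by rewrite ltr_pdivlMl // mulrC.
have ay0 n : 0 < nr (a (y n)).
  by case: (hy n) => _; apply: lt_trans; rewrite mulr_gt0 ?exprn_gt0 ?ltr0n.
pose p n x := nr (minner (a (y n)) x).
pose xi n := ((16^-1 ^+ n) / nr (a (y n)))%:C%C *: a (y n).
have r0 n : 0 < 16^-1 ^+ n :> R by rewrite exprn_gt0 // invr_gt0 ltr0n.
have xin n : nr (xi n) = 16^-1 ^+ n.
  by rewrite nrZ nr_real gtr0_norm ?divr_gt0 // divfK // gt_eqF.
have pxi n : p n (xi n) = 16^-1 ^+ n * nr (a (y n)).
  rewrite /p minnerZr nrZ nr_real gtr0_norm ?divr_gt0 // minner_nr expr2 mulrA divfK //.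
  by rewrite gt_eqF.
(* Since 2 xi = (x + xi) - (x - xi), at least one of the two signs leads to a value of [p n] not
   below [p n (xi n)]. *)
pose f n x := if p n (xi n) <= p n (x + xi n) then x + xi n else x - xi n.
have pf n x : p n (xi n) <= p n (f n x).
  rewrite /f; case: ifPn => //; rewrite -ltNge => h.
  have : p n (xi n + xi n) <= p n (x + xi n) + p n (x - xi n).
    rewrite (_ : xi n + xi n = x + xi n - (x - xi n)); last first.
      by rewrite opprB [RHS]addrC subrKA.
    by rewrite /p minnerBr; apply: le_trans (nrD _ _) _; rewrite nrN.
  have -> : p n (xi n + xi n) = 2 * p n (xi n).
    rewrite /p -mulr2n -scaler_nat minnerZr nrZ.
    have -> : (2%:R : R[i]) = (2 : R)%:C%C by rewrite (rmorph_nat (real_complex R) 2).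
    by rewrite nr_real ger0_norm ?ler0n.
  lra.
have ff n x : nr (f n x - x) = 16^-1 ^+ n.
  by rewrite /f; case: ifP => _; rewrite addrAC subrr add0r ?nrN xin.
pose u := fix u n := if n is k.+1 then f k (u k) else 0.
have [||l [_ ul]] := @geometric_limit R F u 1 16^-1.
- by rewrite invr_ge0 ler0n invf_lt1 ?ltr0n // ltr1n.
- by move=> n; rewrite mul1r /= ff.
have low n : n.+1%:R * 2^-1 < p n l.
  have h1 := pf n (u n); rewrite pxi -/(u n.+1) in h1.
  have h2 := ul n.+1.
  have h3 : p n (u n.+1) <= p n l + p n (u n.+1 - l).
    by rewrite /p -{1}[u n.+1](subrK l) minnerDr addrC; exact: nrD.
  (* The steps after the n-th move the point by at most 16^-n / 15; with the 4 of [nr_minner] they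
     lose at most 4/15 of what the n-th step gained, so more than half of it survives. *)
  have h4 : p n (u n.+1 - l) <= 4 * nr (a (y n)) * (16^-1 ^+ n / 15).
    apply: le_trans (nr_minner _ _) _; rewrite ler_wpM2l ?mulr_ge0 ?ler0n ?nr_ge0 //.
    apply: le_trans h2 _; rewrite exprS mul1r; set t := 16^-1 ^+ n.
    have -> : 1 - 16^-1 = 15 / 16 :> R by lra.
    by have -> : 16^-1 * t / (15 / 16) = t / 15 by field.
  have h5 : n.+1%:R < 16^-1 ^+ n * nr (a (y n)).
    have [_ h] := hy n; rewrite exprVn ltr_pdivlMl ?exprn_gt0 ?ltr0n //.
    by rewrite mulrC.
  have : 4 * nr (a (y n)) * (16^-1 ^+ n / 15) = (16^-1 ^+ n * nr (a (y n))) * (4 / 15) by field.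
  set z := _ * nr (a (y n)) in h1 h5 *; move=> h6; rewrite h6 in h4.
  have := ler0n R n.+1; lra.
have up n : p n l <= 4 * nr (aop_adj a l).
  rewrite /p aop_adjP; apply: le_trans (nr_minner _ _) _.
  by have [-> _] := hy n; rewrite mulr1.
have := truncnS_gt (8 * nr (aop_adj a l)); set N := Num.truncn _ => hN.
have := low N; have := up N; lra.
Qed.

Lemma aop_blin a : blin a.
Proof.
have [C _ aC] := aop_bounded a; split; [exact: aop_linear|by exists C].
Qed.

End AdjointableBounded.

(** * Relatively isometric representations *)

Section HilbertTensor.
Variables (R : realType) (A : cstarType R) (F : hmodType A) (H K : hilbertType R).
Variables (sigma : A -> bop H H) (D : set H) (t : F -> H -> K).
Hypotheses (rep : representation sigma) (clD : clsub D) (tP : is_hilbert_tensor sigma D t).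
Implicit Types (x y : F) (h k : H).

Lemma tens_inner x y h k : D h -> D k -> inner (t x h) (t y k) = inner h (sigma (minner x y) k).
Proof. by case: tP => e _; exact: e. Qed.

(** Linearity is not part of [is_hilbert_tensor]: both sides have the same inner products with the
    elementary tensors, which are total. *)
Lemma tens_linearl h : D h -> linear (fun x => t x h).
Proof.
move=> Dh c x y; case: tP => _ total; apply: (total_innerP total) => _ [z [k [Dk ->]]].
rewrite innerDr innerZr !tens_inner // minnerDr minnerZr (repD rep) (repZ rep).
by rewrite innerDr innerZr.
Qed.

Lemma tens_linearr x c h k : D h -> D k -> t x (c *: h + k) = c *: t x h + t x k.
Proof.
move=> Dh Dk; case: tP => _ total; apply: (total_innerP total) => _ [z [l [Dl ->]]].
have Dhk : D (c *: h + k) by case: clD => _ lin _; exact: lin.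
by rewrite innerDr innerZr !tens_inner // (blinD (bop_blin _)) (blinZ _ _ (bop_blin _)) innerDr innerZr.
Qed.

Lemma tens_bound x h : D h -> nr (t x h) <= 2 * nr x * nr h.
Proof.
move=> Dh; rewrite -(ler_pXn2r (n := 2)) // ?nnegrE ?mulr_ge0 ?nr_ge0 ?ler0n //.
rewrite nr_inner tens_inner //; apply: le_trans (Re_le_nr _) _.
apply: le_trans (cauchy_schwarz _ _) _.
have h1 : nr (sigma (minner x x) h) <= 2 * nr x ^+ 2 * nr h.
  by rewrite -minner_nr; exact: rep_bounded.
have h2 : nr h * nr (sigma (minner x x) h) <= nr h * (2 * nr x ^+ 2 * nr h).
  by rewrite ler_wpM2l // nr_ge0.
apply: le_trans h2 _; have : 0 <= nr x ^+ 2 * nr h ^+ 2 by rewrite mulr_ge0 // exprn_ge0 ?nr_ge0.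
by rewrite !expr2; nra.
Qed.

Lemma tens_blin h : D h -> blin (fun x => t x h).
Proof.
move=> Dh; split; first exact: tens_linearl.
by exists (2 * nr h) => x; apply: le_trans (tens_bound _ Dh) _; rewrite mulrAC.
Qed.

End HilbertTensor.

Section PartialIsometries.
Variables (R : realType) (H K : hilbertType R) (V : bop H K).
Hypothesis Vpi : partial_isometry V.

(** V^* h is orthogonal to the kernel of V, so V preserves its norm; hence V V^* and its square have
    the same quadratic form, and polarization applies. *)
Lemma pi_proj y : V (bop_adj V (V (bop_adj V y))) = V (bop_adj V y).
Proof.
have iso h : nr (V (bop_adj V h)) = nr (bop_adj V h).
  rewrite /nr Vpi // => z Vz; by rewrite bop_adjPl Vz inner0r.
have bV := bop_blin V; have bVa := bop_adj_blin V.
have bp : blin (fun h => V (bop_adj V h)) := blin_comp bVa bV.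
apply/eqP; rewrite -subr_eq0; apply/eqP; move: y.
apply: (polarization0 (f := fun y => V (bop_adj V (V (bop_adj V y))) - V (bop_adj V y))).
  by have [] := blin_sub (blin_comp bp bp) bp.
move=> h; rewrite innerBr -!bop_adjPl.
have -> : inner (bop_adj V h) (bop_adj V (V (bop_adj V h))) = inner (V (bop_adj V h)) (V (bop_adj V h)).
  by rewrite bop_adjP.
by rewrite !inner_nr iso subrr.
Qed.

Lemma pi_adjK y : bop_adj V (V (bop_adj V y)) = bop_adj V y.
Proof.
have bVa := bop_adj_blin V; apply/eqP; rewrite -subr_eq0 -(blinB _ _ bVa); apply/eqP.
apply: inner0_eq0; rewrite bop_adjPl (blinB _ _ bVa) (blinB _ _ (bop_blin V)) pi_proj.
by rewrite subrr inner0r.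
Qed.

Lemma piK x : V (bop_adj V (V x)) = V x.
Proof. by apply: innerPl => z; rewrite -bop_adjPl -bop_adjP -bop_adjPl pi_adjK bop_adjPl. Qed.

Lemma pi_nr x : V (bop_adj V x) = x -> nr (bop_adj V x) = nr x.
Proof.
move=> Vx; apply/eqP; rewrite -(eqrXn2 (n := 2)) ?nr_ge0 // !nr_inner.
by rewrite bop_adjPl Vx.
Qed.

End PartialIsometries.

(** Positivity makes B self-adjoint, and then B vanishes on the range of p. The vector v = B h - (h
    - p h) satisfies B v = - v, which positivity of B allows only for v = 0. *)
Lemma sqrt_projection (R : realType) (H : hilbertType R) (B : bop H H) (p : H -> H) :
  blin p -> (forall h, p (p h) = p h) -> (forall h k, inner (p h) k = inner h (p k)) ->
  is_sqrt B (fun h => h - p h) -> forall h, B h = h - p h.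
Proof.
move=> bp pp padj [Bpos BB] h; have bB := bop_blin B.
have Bsa x y : inner (B x) y = inner x (B y).
  have : forall z, bop_adj B z - B z = 0.
    apply: polarization0; first by have [] := blin_sub (bop_adj_blin B) bB.
    move=> z; rewrite innerBr -bop_adjP (innerC z).
    by have := Bpos z; rewrite lecE => /andP[/eqP /=]; case: (inner z (B z)) => a b /= -> _; apply/eqP; rewrite subr_eq0 eq_complex /= oppr0 !eqxx.
  by move=> /(_ y)/eqP; rewrite subr_eq0 => /eqP <-; rewrite bop_adjP.
have Bp x : B (p x) = 0 by apply: inner0_eq0; rewrite Bsa BB pp subrr inner0r.
have By : B (B h - (h - p h)) = - (B h - (h - p h)).
  by rewrite (blinB _ _ bB) BB (blinB _ _ bB) Bp subr0 opprB.
have := Bpos (B h - (h - p h)); rewrite By innerNr inner_nr oppr_ge0.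
move=> h0; have {}h0 : nr (B h - (h - p h)) ^+ 2 <= 0 by rewrite -lecR.
apply/eqP; rewrite -subr_eq0; apply/eqP; apply: nr0_eq0; apply/eqP.
by rewrite -sqrf_eq0 eq_le h0 exprn_ge0 // nr_ge0.
Qed.
Section InteriorTensor.
Variables (R : realType) (A : cstarType R) (F G K : corrType A) (t : F -> G -> K).
Hypothesis tP : is_interior_tensor t.

Lemma lact_bounded (a : A) : exists2 C : R, 0 < C & forall x : G, nr (lact a x) <= C * nr x.
Proof. exact: (aop_bounded (Aop (fun x y : G => lact_adj a x y))). Qed.

Lemma interior_tensor_blin x : blin (t x).
Proof.
have [ti _ _] := tP; split.
  move=> c y y'; apply/eqP; rewrite -subr_eq0; apply/eqP; apply: minner0_eq0.
  set v := t x (c *: y + y'); set w := c *: _ + _.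
  have ll : lact (minner x x) (c *: y + y') = c *: lact (minner x x) y + lact (minner x x) y'.
    exact: (aop_linear (Aop (fun x y : G => lact_adj _ x y))).
  have e z : minner (t x z) (v - w) = 0.
    by rewrite minnerBr minnerDr minnerZr !ti ll minnerDr minnerZr subrr.
  by rewrite minnerBl e minnerDl minnerZl !e scaler0 addr0 subr0.
have [C C0 lC] := lact_bounded (minner x x).
exists (2 * (C + 1)) => y; have C1 : 0 <= 2 * (C + 1) by rewrite mulr_ge0 ?addr_ge0 ?ler0n // ltW.
have C2 : 0 <= 2 * (C + 1) * nr y by rewrite mulr_ge0 // nr_ge0.
rewrite -(ler_pXn2r (n := 2)) // ?nnegrE ?nr_ge0 // -minner_nr ti.
apply: le_trans (nr_minner _ _) _.
have h : 4 * nr y * nr (lact (minner x x) y) <= 4 * nr y * (C * nr y).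
  by rewrite ler_wpM2l ?mulr_ge0 ?ler0n ?nr_ge0.
apply: le_trans h _.
have -> : 4 * nr y * (C * nr y) = 4 * C * nr y ^+ 2 by ring.
by rewrite exprMn ler_wpM2r ?exprn_ge0 ?nr_ge0 //; nra.
Qed.

End InteriorTensor.

(** * Products in a subproduct system *)

Section SubproductProduct.
Variables (R : realType) (A : cstarType R) (X : subproduct_system A).

Lemma sp_proj_incl n (x : X n) : sp_proj n (sp_incl X n x) = x.
Proof. by apply: minnerPl => z; rewrite -aop_adjP sp_incl_isom. Qed.

Lemma sp_incl_nr n (x : X n) : nr (sp_incl X n x) = nr x.
Proof.
by apply/eqP; rewrite -(eqrXn2 (n := 2)) ?nr_ge0 // -!minner_nr sp_incl_isom.
Qed.

Lemma sp_proj_blin n : blin (@sp_proj R A X n).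
Proof.
split; first exact: aop_adj_linear.
by exists (4 * 1); apply: aop_adj_le => // x; rewrite mul1r sp_incl_nr.
Qed.

Lemma sp_incl_blin n : blin (sp_incl X n).
Proof. by split; [exact: aop_linear|exists 1 => x; rewrite mul1r sp_incl_nr]. Qed.

Lemma sp_mul_blin m (y : X m) n : blin (fun x : X n => sp_mul y x).
Proof.
apply: blin_comp (sp_proj_blin (m + n)).
exact: blin_comp (sp_incl_blin n) (interior_tensor_blin (@tmulP _ _ (sp_pow X) m n) (sp_incl X m y)).
Qed.

(** [sp_sub] is a statement inside the tensor power; [sp_proj] carries it into X(n + m). *)
Lemma sp_mul_total n m (x : X (n + m)) :
  closed_span [set v | exists (y : X n) (z : X m), v = sp_mul y z] x.
Proof.
have := @sp_sub _ _ X n m x; set S := [set v | _] => Sx.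
rewrite -[x]sp_proj_incl.
have hP := blin_preim (sp_proj_blin (n + m)) (clsub_span [set v | exists (y : X n) (z : X m), v = sp_mul y z]).
apply: (closed_span_sub hP _ Sx) => _ [y [z ->]]; apply: closed_span_in.
by exists y, z.
Qed.

Arguments sp_mul_total {n m} x.

Lemma sp_incl_proj0 (x : sp_pow X 0) : sp_incl X 0 (sp_proj 0 x) = x.
Proof. by have [y <-] := sp_incl0 x; rewrite sp_proj_incl. Qed.

Lemma sp_vac_surj (x : X 0) : exists a, x = sp_vac X a.
Proof.
have [f fK Kf] := tvac_bij (sp_pow X); exists (f (sp_incl X 0 x)).
by rewrite /sp_vac Kf sp_proj_incl.
Qed.

Lemma sp_mul_vac n a (x : X n) : sp_mul (sp_vac X a) x = lact a x.
Proof.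
rewrite /sp_mul /sp_vac sp_incl_proj0 tmul_vacl -sp_incl_lact.
exact: (@sp_proj_incl n).
Qed.

End SubproductProduct.

Arguments sp_mul_total {R A X n m} x.

(** * Covariant representations and the projections P_n *)

Section Covariant.
Variables (R : realType) (A : cstarType R) (X : subproduct_system A) (H : hilbertType R).
Variable (T : forall n, X n -> bop H H).
Hypothesis T_rep : is_cc_covariant_rep T.
Variable r : tilde_ops T.

Let sigma := rep0 T.
Local Notation t n := (tl_tens r n).
Local Notation J n := (bop_adj (tl_op r n)).

Definition range_proj n h := tl_op r n (J n h).
Local Notation P := range_proj.

Let rep : representation sigma := ccr_rep0 T_rep.

Lemma clsub_setT (V : normedModType R[i]) : clsub [set: V].
Proof. by split. Qed.

Lemma tl_inner n (x y : X n) h k : inner (t n x h) (t n y k) = inner h (sigma (minner x y) k).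
Proof. exact: (tens_inner (tl_tensP r n)). Qed.

Lemma tl_blinl n h : blin (fun x : X n => t n x h).
Proof. exact: (tens_blin rep (tl_tensP r n)). Qed.

Lemma tl_blinr n (x : X n) : blin (t n x).
Proof.
split; first by move=> c h k; rewrite (tens_linearr (@clsub_setT H) (tl_tensP r n)).
by exists (2 * nr x) => h; exact: (tens_bound rep (tl_tensP r n)).
Qed.

Lemma tl_total n : closed_span [set v | exists (x : X n) h, v = t n x h] = setT.
Proof.
have [_ total] := tl_tensP r n; rewrite -total; congr closed_span.
by apply/seteqP; split => v [x [h]]; [move=> ->; exists x, h|case=> _ ->; exists x, h].
Qed.

Lemma T_blin n h : blin (fun x : X n => T x h).
Proof.
have := blin_comp (tl_blinl n h) (bop_blin (tl_op r n)).
by congr blin; apply: funext => x; rewrite tl_opE.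
Qed.

Lemma range_proj_blin n : blin (P n).
Proof. exact: (blin_comp (bop_adj_blin _) (bop_blin _)). Qed.

Lemma range_proj_sa n h k : inner (P n h) k = inner h (P n k).
Proof. by rewrite bop_adjP bop_adjPl. Qed.

Lemma tl_op_range n v : closed_span [set h | exists (x : X n) k, h = T x k] (tl_op r n v).
Proof.
move: v; apply: (total_sub (tl_total n) (blin_preim (bop_blin _) (clsub_span _))).
by move=> _ [x [h ->]] /=; apply: closed_span_in; exists x, h; rewrite tl_opE.
Qed.

(** Stands for the factorization of T~_{n+m} through T~_n and T~_m, without building X(n) (x) X(m)
    (x) H. *)
Lemma T_split n m (x : X (n + m)) h :
  closed_span [set v | exists (y : X n) (z : X m) k, v = T y (T z k)] (T x h).
Proof.
set S := [set v | _].
have hP := blin_preim (@T_blin (n + m) h) (clsub_span S).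
apply: (closed_span_sub hP _ (sp_mul_total x)).
move=> _ [y [z ->]] /=; apply: closed_span_in; exists y, z, h.
exact: (ccr_mul T_rep).
Qed.

Arguments T_split {n m} x h.
Arguments tl_op_range {n} v.

Hypothesis pi_T : forall n, partial_isometry (tl_op r n).

Lemma range_projK n h : P n (P n h) = P n h.
Proof. exact: pi_proj. Qed.

Lemma range_proj_T n (x : X n) h : P n (T x h) = T x h.
Proof. by rewrite -(tl_opE r x h); exact: piK. Qed.

Lemma clsub_range_proj n : clsub [set h | P n h = h].
Proof. exact: (blin_eq (range_proj_blin n) (blin_id H)). Qed.

Lemma range_proj_TD n m (x : X (n + m)) h : P n (T x h) = T x h.
Proof.
apply: (closed_span_sub (clsub_range_proj n) _ (T_split x h)) => _ [y [z [k ->]]] /=.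
exact: range_proj_T.
Qed.

Lemma range_proj_le n m h : (n <= m)%N -> P n (P m h) = P m h.
Proof.
move=> /subnKC <-; apply: (closed_span_sub (clsub_range_proj n) _ (tl_op_range _)).
by move=> _ [x [k ->]]; exact: range_proj_TD.
Qed.

(** Nondegeneracy of T_0 enters here; this is the start of the telescoping sum in [Q_compl]. *)
Lemma range_proj_0 h : P 0 h = h.
Proof.
have [_ _ _ total] := rep; move: h; apply: (total_sub total (clsub_range_proj 0)).
by move=> _ [a [h ->]]; exact: (@range_proj_T 0 (sp_vac X a)).
Qed.

Lemma sigma_T n a (x : X n) h : sigma a (T x h) = T (lact a x) h.
Proof. by rewrite (ccr_lact T_rep). Qed.

Lemma range_proj_sigmaP n a h : P n (sigma a (P n h)) = sigma a (P n h).
Proof.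
have hP := blin_preim (bop_blin (sigma a)) (clsub_range_proj n).
apply: (closed_span_sub hP _ (tl_op_range (J n h))) => _ [x [k ->]] /=.
by rewrite sigma_T range_proj_T.
Qed.

(** The range of P_n is invariant under sigma of both [a] and [cstar a], hence reducing. *)
Lemma range_proj_sigma n a h : P n (sigma a h) = sigma a (P n h).
Proof.
apply: innerPr => k.
rewrite range_proj_sa (rep_star rep) -range_proj_sigmaP -range_proj_sa.
by rewrite -(rep_star rep) -range_proj_sa range_proj_sigmaP.
Qed.

End Covariant.

Arguments T_split {R A X H T} T_rep r {n m} x h.
Arguments tl_op_range {R A X H T r n} v.

(** * Wandering vectors and the limit projection Q *)

Section RelativelyIsometric.
Variables (R : realType) (A : cstarType R) (X : subproduct_system A) (H : hilbertType R).
Variable (T : forall n, X n -> bop H H).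
Hypothesis T_rep : is_cc_covariant_rep T.
Variable r : tilde_ops T.
Hypothesis pi_T : forall n, partial_isometry (tl_op r n).

Let sigma := rep0 T.
Local Notation t n := (tl_tens r n).
Local Notation J n := (bop_adj (tl_op r n)).
Local Notation P := (range_proj r).

Let rep : representation sigma := ccr_rep0 T_rep.

Section Defect.
Variable Delta : bop H H.
Hypothesis DeltaP : is_defect r Delta.

Lemma defectE h : Delta h = h - P 1 h.
Proof.
apply: (sqrt_projection _ _ _ DeltaP); first exact: range_proj_blin.
  exact: range_projK.
exact: range_proj_sa.
Qed.

(** As Delta is the projection 1 - P_1, its range is already closed; from here on d in D is
    expressed by [P 1 d = 0]. *)
Lemma defect_range d : closure (range Delta) d <-> P 1 d = 0.
Proof.
have bP := range_proj_blin r 1; split.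
  have hP := blin_preim bP (@clsub0 _ H).
  case: hP => _ _; rewrite /subset /= => hP cd; apply: hP; move: d cd.
  apply: closure_subset => _ [h _ <-] /=.
  by rewrite defectE (blinB _ _ bP) range_projK // subrr.
move=> Pd; apply: subset_closure; exists d => //.
by rewrite defectE Pd subr0.
Qed.

Lemma clsub_defect : clsub (closure (range Delta)).
Proof.
have := blin_preim (range_proj_blin r 1) (@clsub0 _ H).
congr clsub; apply/seteqP; split => d /=; first by move=> h; apply/defect_range.
by move=> /defect_range.
Qed.

(** Under (a), x (x) d lies in the range of T~_n^*, where T~_n^* T~_n is the identity. Under (b),
    T~_n preserves the norm of x (x) d, and a vector whose norm the projection T~_n^* T~_n preserves
    is fixed by it. *)
Lemma relisom_adj : relatively_isometric r Delta ->
  forall n (x : X n) d, P 1 d = 0 -> J n (T x d) = t n x d.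
Proof.
move=> [_ ab] n x d Pd.
have dE : d = Delta d by rewrite defectE Pd subr0.
case: ab => [sub|ab].
  have [k _ kE] : range (J n) (t n x d).
    by apply: sub; apply: closed_span_in; exists x, d; rewrite -dE.
  by rewrite -(tl_opE r) -kE pi_adjK.
have iso : inner (T x d) (T x d) = inner (t n x d) (t n x d).
  have Dsa y z : inner (Delta y) z = inner y (Delta z).
    by rewrite !defectE innerBl innerBr range_proj_sa.
  rewrite tl_inner -/sigma [in LHS]dE bop_adjP.
  by rewrite Dsa ab -!dE.
apply/eqP; rewrite -subr_eq0; apply/eqP; apply: inner0_eq0.
have e1 : inner (J n (T x d)) (t n x d) = inner (T x d) (T x d).
  by rewrite bop_adjPl tl_opE.
have e2 : inner (J n (T x d)) (J n (T x d)) = inner (T x d) (T x d).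
  by rewrite bop_adjPl -/(P n (T x d)) range_proj_T.
have e3 : inner (t n x d) (J n (T x d)) = inner (T x d) (T x d).
  by rewrite innerC e1 inner_conj.
by rewrite innerBl !innerBr e1 e2 e3 -iso !subrr.
Qed.

End Defect.

Hypothesis relT : forall n (x : X n) d, P 1 d = 0 -> J n (T x d) = t n x d.

Lemma wandering_inner n (x y : X n) d k :
  P 1 d = 0 -> inner (T x d) (T y k) = inner d (sigma (minner x y) k).
Proof. by move=> Pd; rewrite -(tl_opE r y) -bop_adjPl relT // tl_inner. Qed.

Lemma wandering_orth_T d j (y : X j.+1) k : P 1 d = 0 -> inner d (T y k) = 0.
Proof.
move=> Pd; have := @range_proj_TD _ _ _ _ _ T_rep r pi_T 1 j y k => <-.
by rewrite -range_proj_sa Pd inner0l.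
Qed.

(** Split y into y1 of degree n and y2 of degree j + 1: [wandering_inner] cancels T_n(x) against
    T_n(y1), and d is orthogonal to the range of T_{j+1}. *)
Lemma wandering_orth n j (x : X n) (y : X (n + j.+1)) d k :
  P 1 d = 0 -> inner (T x d) (T y k) = 0.
Proof.
move=> Pd; apply: (closed_span_sub (clsub_orth (T x d)) _ (T_split T_rep r y k)).
move=> _ [y1 [y2 [l ->]]] /=.
by rewrite wandering_inner // (sigma_T T_rep) wandering_orth_T.
Qed.

Variable Q : bop H H.
Hypothesis Q_lim : forall h, tends (fun n => P n h) (Q h).

Lemma range_proj_Q n h : P n (Q h) = Q h.
Proof.
apply: (tends_unique (u := fun m => P m h)) => //.
move=> e e0; have [N hN] := blin_tends (range_proj_blin r n) (Q_lim h) e0.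
exists (maxn N n) => m; rewrite geq_max => /andP[Nm nm].
by rewrite -(range_proj_le T_rep pi_T h nm); exact: hN.
Qed.

Lemma Q_fix u : (forall n, P n u = u) -> Q u = u.
Proof.
move=> Pu; apply: (tends_unique (Q_lim u)) => e e0; exists 0 => n _.
by rewrite Pu subrr nr0.
Qed.

Lemma Q_idem h : Q (Q h) = Q h.
Proof. by apply: Q_fix => n; exact: range_proj_Q. Qed.

Lemma tends_inner (k : H) (u : nat -> H) l : tends u l -> tends (fun n => inner k (u n)) (inner k l).
Proof.
move=> ul e e0; have p : 0 < nr k + 1 by rewrite ltr_wpDl ?nr_ge0.
have [|N hN] := ul (e / (nr k + 1)); first by rewrite divr_gt0.
exists N => n /hN h; rewrite -innerBr; apply: le_lt_trans (cauchy_schwarz _ _) _.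
apply: (@le_lt_trans _ _ ((nr k + 1) * nr (u n - l))).
  by rewrite ler_wpM2r ?nr_ge0 ?lerDl.
by rewrite mulrC -ltr_pdivlMr.
Qed.

Lemma Q_sa h k : inner (Q h) k = inner h (Q k).
Proof.
suff : inner k (Q h) = (inner h (Q k))^*.
  by rewrite (innerC k (Q h)) => ->; rewrite conjCK.
apply: (tends_unique (tends_inner k (Q_lim h))).
move=> e e0; have [N hN] := tends_inner h (Q_lim k) e0.
exists N => n /hN h1.
by rewrite (innerC (P n h) k) -rmorphB /= nr_conj range_proj_sa.
Qed.

Lemma Q_sigma a h : Q (sigma a h) = sigma a (Q h).
Proof.
apply: (tends_unique (Q_lim _)).
have := blin_tends (bop_blin (sigma a)) (Q_lim h).
by move=> h1 e /h1[N hN]; exists N => n /hN; rewrite range_proj_sigma.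
Qed.

Lemma wandering_Q d k : P 1 d = 0 -> inner d (Q k) = 0.
Proof. by move=> Pd; rewrite -(range_proj_Q 1) -range_proj_sa Pd inner0l. Qed.

(** Named after the wandering subspace of a Wold decomposition, here D; the closed span turns out to
    be the range of 1 - Q. *)
Definition wandering : set H := [set v | exists n (x : X n) d, P 1 d = 0 /\ v = T x d].

Lemma wandering_Q_orth v k : wandering v -> inner v (Q k) = 0.
Proof.
move=> [n [x [d [Pd ->]]]].
apply: (closed_span_sub (clsub_orth (T x d)) _ (_ : closed_span [set h | exists (y : X (n + 1)) k, h = T y k] (Q k))).
  by move=> _ [y [l ->]]; exact: wandering_orth.
by rewrite -(range_proj_Q (n + 1)); exact: tl_op_range.
Qed.

(* Informally, P_n - P_(n+1) = T~_n (I (x) Delta) T~_n^*. *)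
Lemma range_proj_step n k : closed_span wandering (P n k - P n.+1 k).
Proof.
set g := P n k - P n.+1 k.
have gP : P n g = g.
  by rewrite (blinB _ _ (range_proj_blin r n)) range_projK // range_proj_le.
have gP' : P n.+1 g = 0.
  rewrite (blinB _ _ (range_proj_blin r _)) range_projK //.
  suff -> : P n.+1 (P n k) = P n.+1 k by rewrite subrr.
  apply: innerPr => z; rewrite !range_proj_sa range_proj_le //.
(* T_n(x) maps the range of P_1 into that of P_{n+1}, to which g is orthogonal. Hence T~_n^* g is
   orthogonal to X(n) (x) P_1 H, and [orth_split] places it in X(n) (x) D. *)
have Jg : closed_span [set v | exists (x : X n) d, P 1 d = 0 /\ v = t n x d] (J n g).
  pose G := [set v | exists (x : X n) k, v = t n x (P 1 k)].
  apply: (orth_split (G := G) (tl_total r n)).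
  - move=> _ [x [h ->]]; exists (t n x (h - P 1 h)), (t n x (P 1 h)); split.
    + exists x, (h - P 1 h); split => //.
      by rewrite (blinB _ _ (range_proj_blin r _)) range_projK // subrr.
    + by exists x, h.
    + by rewrite -(blinD (tl_blinr T_rep r x)) subrK.
  - move=> _ _ [x [d [Pd ->]]] [y [k' ->]]; rewrite tl_inner -/sigma.
    by rewrite -(range_proj_sigma T_rep pi_T) -range_proj_sa Pd inner0l.
  - move=> _ [x [h ->]]; rewrite -bop_adjP tl_opE -{1}gP.
    have : closed_span [set h | exists (y : X 1) k, h = T y k] (P 1 h) by exact: tl_op_range.
    have hP := blin_preim (bop_blin (T x)) (clsub_orthl g).
    rewrite gP; apply: (closed_span_sub hP) => _ [y [l ->]] /=.
    rewrite -(ccr_mul T_rep).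
    have e : P n.+1 (T (sp_mul x y) l) = T (sp_mul x y) l.
      (* [sp_mul x y] lives in X(n + 1), a fibre that has to be identified with X(n.+1). *)
      have e1 (z : X (n + 1)%N) : P n.+1 (T z l) = T z l.
        by move: z; rewrite addn1 => z; rewrite range_proj_T.
      exact: e1.
    by rewrite -e range_proj_sa gP' inner0r.
rewrite -gP; apply: (closed_span_sub (blin_preim (bop_blin (tl_op r n)) (clsub_span wandering)) _ Jg).
move=> _ [x [d [Pd ->]]] /=; rewrite tl_opE; apply: closed_span_in.
by exists n, x, d.
Qed.

(** Telescoping from P_0 = 1 writes k - P_n k as a sum of the differences in [range_proj_step]; then
    n tends to infinity. *)
Lemma Q_compl k : closed_span wandering (k - Q k).
Proof.
apply: (clsub_tends (u := fun n => k - P n k) (clsub_span _)).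
  elim=> [|n IH]; first by rewrite range_proj_0 // subrr; case: (clsub_span wandering).
  rewrite -(subrKA (P n k)).
  exact: (clsubD (clsub_span wandering) IH (@range_proj_step n k)).
move=> e /(Q_lim k)[N hN]; exists N => n /hN h.
by rewrite opprB addrC subrKA nrB.
Qed.

Lemma wandering_T m (y : X m) v : wandering v -> wandering (T y v).
Proof.
move=> [n [x [d [Pd ->]]]]; exists (m + n)%N, (sp_mul y x), d; split => //.
by rewrite (ccr_mul T_rep).
Qed.

Lemma Q_wandering v : closed_span wandering v -> Q v = 0.
Proof.
apply: (closed_span_sub (blin_preim (bop_blin Q) (@clsub0 _ H))) => w ww /=.
by apply: innerPl => z; rewrite inner0r -Q_sa innerC wandering_Q_orth // conjC0.
Qed.

Lemma Q_T_compl m (y : X m) k : Q (T y (k - Q k)) = 0.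
Proof.
apply: Q_wandering.
apply: (closed_span_sub (blin_preim (bop_blin (T y)) (clsub_span wandering)) _ (@Q_compl k)).
by move=> v wv /=; apply: closed_span_in; exact: wandering_T.
Qed.

(** T_n(x) leaves the range of 1 - Q invariant ([Q_T_compl]), so T~_n^* u is orthogonal to X(n) (x)
    (1 - Q)H, the complement of X(n) (x) QH. *)
Lemma adj_Q_total n u : Q u = u ->
  closed_span [set v | exists (x : X n) k, v = t n x (Q k)] (J n u).
Proof.
move=> Qu; pose G := [set v | exists (x : X n) k, v = t n x (k - Q k)].
apply: (orth_split (G := G) (tl_total r n)).
- move=> _ [x [h ->]]; exists (t n x (Q h)), (t n x (h - Q h)); split.
  + by exists x, h.
  + by exists x, h.
  + by rewrite -(blinD (tl_blinr T_rep r x)) addrC subrK.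
- move=> _ _ [x [d ->]] [y [k ->]]; rewrite tl_inner -/sigma Q_sa Q_sigma.
  by rewrite (blinB _ _ (bop_blin Q)) Q_idem subrr (blin0 (bop_blin _)) inner0r.
- move=> _ [x [h ->]]; rewrite -bop_adjP tl_opE -Qu -Q_sa Q_T_compl.
  exact: inner0l.
Qed.

(* For m > n, [T_n u = T_n T~_{m-n} J_{m-n} u], and [J_{m-n} u] is approximated by
   sums of [y (x) Q k]; then [<T_m(x) d, T_m(z y) Q k> = <d, sigma(<x, z y>) Q k> = 0]. *)
Lemma T_Q n (z : X n) u : Q u = u -> Q (T z u) = T z u.
Proof.
move=> Qu; have orth m (x : X m) d : P 1 d = 0 -> inner (T x d) (T z u) = 0.
  move=> Pd; have [mn|nm] := ltnP m n.
    by move: z; rewrite -(subnKC mn) addSnnS => z; exact: wandering_orth.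
  move: x; rewrite -(subnKC nm); set j := (m - n)%N => x.
  have Pu : P j u = u by rewrite -Qu range_proj_Q.
  rewrite -Pu.
  have hP := blin_preim (blin_comp (bop_blin (tl_op r j)) (bop_blin (T z))) (clsub_orth (T x d)).
  apply: (closed_span_sub hP _ (@adj_Q_total j u Qu)) => _ [y [k ->]] /=.
  by rewrite tl_opE -(ccr_mul T_rep) wandering_inner // -Q_sigma wandering_Q.
apply/eqP; rewrite eq_sym -subr_eq0; apply/eqP; apply: inner0_eq0.
set v := T z u; set c := v - Q v.
have cQ : inner c c = inner c v.
  by rewrite {1 3}/c innerBr -Q_sa (blinB _ _ (bop_blin Q)) Q_idem subrr inner0l subr0.
rewrite cQ; apply: (closed_span_sub (clsub_orthl v) _ (@Q_compl v)) => _ [m [x [d [Pd ->]]]] /=.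
exact: orth.
Qed.

Lemma Q_T n (z : X n) h : Q (T z h) = T z (Q h).
Proof.
rewrite -[in LHS](subrK (Q h) h) (blinD (bop_blin (T z))) (blinD (bop_blin Q)).
by rewrite Q_T_compl add0r T_Q // Q_idem.
Qed.

End RelativelyIsometric.

(** * The Fock module *)

Section FockComponents.
Variables (R : realType) (A : cstarType R) (X : subproduct_system A) (F : fock_module X).

Local Notation inF n := (@fock_in _ _ _ F n).

Lemma fock_in_linear n : linear (inF n).
Proof.
move=> c x y; apply/eqP; rewrite -subr_eq0; apply/eqP; apply: minner0_eq0.
set v := inF n (c *: x + y); set w := c *: _ + _.
have e z : minner (inF n z) (v - w) = 0.
  rewrite minnerBr minnerDr minnerZr !fock_in_isom minnerDr minnerZr.
  by rewrite subrr.
by rewrite minnerBl e minnerDl minnerZl !e scaler0 addr0 subr0.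
Qed.

Lemma fock_in_nr n (x : X n) : nr (inF n x) = nr x.
Proof.
by apply/eqP; rewrite -(eqrXn2 (n := 2)) ?nr_ge0 // -!minner_nr fock_in_isom.
Qed.

Lemma fock_in_blin n : blin (inF n).
Proof.
by split; [exact: fock_in_linear|exists 1 => x; rewrite mul1r fock_in_nr].
Qed.

Lemma minner_blin (G : hmodType A) (x : G) : blin (minner x).
Proof.
split; first exact: minner_linear.
by exists (4 * nr x) => y; exact: nr_minner.
Qed.

(** The degree l component of [fock_in x], a Kronecker delta between fibres: transport along n = l,
    and 0 if the degrees differ. *)
Definition fib_cast n l (x : X n) : X l :=
  if n =P l is ReflectT e then eq_rect n (fun k => X k : Type) x l e else 0.

Lemma fib_cast_id n (x : X n) : fib_cast n x = x.
Proof. by rewrite /fib_cast; case: eqP => // e; rewrite (eq_axiomK e). Qed.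

Lemma fib_cast_neq n l (x : X n) : n != l -> fib_cast l x = 0.
Proof. by rewrite /fib_cast; case: eqP. Qed.

Lemma minner_fib_cast n l (z : X l) (x : X n) :
  minner (inF l z) (inF n x) = minner z (fib_cast l x).
Proof.
have [e|nl] := eqVneq n l; last by rewrite fib_cast_neq // fock_in_orth ?minner0r // eq_sym.
by move: z; rewrite -e => z; rewrite fock_in_isom fib_cast_id.
Qed.

(** The adjoint of the inclusion of X(l), extended from the total vectors [fock_in x]. For a finite
    sum w with component u, |u|^2 = |<fock_in u, w>| gives |u| <= 4 |w|. *)
Lemma fock_comp_exists l : exists g : {linear F -> X l},
  forall z y, minner (inF l z) y = minner z (g y).
Proof.
have [|s|g [gE gC]] := @extend_total R F (X l) {n & X n} (fun p => inF (tag p) (tagged p))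
    (fun p => fib_cast l (tagged p)) 4 _ (fock_total F).
- by move=> _ [n [x ->]]; exists (existT _ n x).
- set u := \sum_(p <- s) _; set w := \sum_(p <- s) _.
  have uw z : minner (inF l z) w = minner z u.
    rewrite /w /u !(blin_sum _ _ _ (minner_blin _)); apply: eq_bigr => p _.
    by rewrite !minnerZr minner_fib_cast.
  have [->|u0] := eqVneq (nr u) 0; first by rewrite mulr_ge0 ?ler0n ?nr_ge0.
  have p : 0 < nr u by rewrite lt_def u0 nr_ge0.
  rewrite -(ler_pM2r p) -expr2 -minner_nr -uw; apply: le_trans (nr_minner _ _) _.
  by rewrite fock_in_nr mulrAC.
exists g => z y; have bg : blin g by split; [exact: linearP|exists 4].
have hP := blin_eq (minner_blin (inF l z)) (blin_comp bg (minner_blin z)).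
apply: (total_sub (fock_total F) hP) => _ [n [x ->]] /=.
by rewrite (gE (existT _ n x)) minner_fib_cast.
Qed.

Definition fock_comp l : F -> X l := sval (cid (fock_comp_exists l)).

Lemma fock_compP l z y : minner (inF l z) y = minner z (fock_comp l y).
Proof. exact: (svalP (cid (fock_comp_exists l))). Qed.

Lemma fock_comp_linear l : linear (fock_comp l).
Proof. exact: linearP. Qed.

Lemma fock_compPr l y z : minner y (inF l z) = minner (fock_comp l y) z.
Proof. by rewrite -minner_star fock_compP minner_star. Qed.

Lemma fock_comp_in n l (x : X n) : fock_comp l (inF n x) = fib_cast l x.
Proof. by apply: minnerPl => z; rewrite -fock_compP minner_fib_cast. Qed.

Lemma fock_comp_blin l : blin (fock_comp l).
Proof.
split; first exact: fock_comp_linear.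
exists 4 => y; have [->|u0] := eqVneq (nr (fock_comp l y)) 0.
  by rewrite mulr_ge0 ?ler0n ?nr_ge0.
have p : 0 < nr (fock_comp l y) by rewrite lt_def u0 nr_ge0.
rewrite -(ler_pM2r p) -expr2 -minner_nr -fock_compP; apply: le_trans (nr_minner _ _) _.
by rewrite fock_in_nr mulrAC.
Qed.

Definition fock_trunc L (y : F) : F := \sum_(l < L) inF l (fock_comp l y).

Lemma fock_trunc_inner L y z :
  minner (fock_trunc L y) (fock_trunc L z) = \sum_(l < L) minner (fock_comp l y) (fock_comp l z).
Proof.
rewrite /fock_trunc (blin_sum _ _ _ (minner_blin _)); apply: eq_bigr => l _.
rewrite fock_compPr; congr minner.
rewrite (blin_sum _ _ _ (fock_comp_blin _)) (bigD1 l) //= fock_comp_in fib_cast_id.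
rewrite big1 ?addr0 // => i il; rewrite fock_comp_in fib_cast_neq //.
Qed.

Lemma fock_truncE L y z : minner (fock_trunc L y) z = \sum_(l < L) minner (fock_comp l y) (fock_comp l z).
Proof.
rewrite -minner_star (blin_sum _ _ _ (minner_blin _)) (big_morph _ (@cstarD _ A) (@cstar0 _ A)).
by apply: eq_bigr => l _; rewrite minner_star fock_compP.
Qed.

Lemma fock_trunc_le L y : nr (fock_trunc L y) <= 4 * nr y.
Proof.
have [->|u0] := eqVneq (nr (fock_trunc L y)) 0.
  by rewrite mulr_ge0 ?ler0n ?nr_ge0.
have p : 0 < nr (fock_trunc L y) by rewrite lt_def u0 nr_ge0.
rewrite -(ler_pM2r p) -expr2 -minner_nr fock_trunc_inner -fock_truncE.
by apply: le_trans (nr_minner _ _) _; rewrite mulrAC.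
Qed.

Lemma fock_trunc_linear L : linear (fock_trunc L).
Proof.
move=> c x y; rewrite /fock_trunc scaler_sumr -big_split /=; apply: eq_bigr => l _.
by rewrite fock_comp_linear fock_in_linear.
Qed.

Lemma fock_trunc_blin L : blin (fock_trunc L).
Proof. by split; [exact: fock_trunc_linear|exists 4; exact: fock_trunc_le]. Qed.

Lemma fock_trunc_in L n (x : X n) : (n < L)%N -> fock_trunc L (fock_in F x) = fock_in F x.
Proof.
move=> nL; rewrite /fock_trunc (bigD1 (Ordinal nL)) //= fock_comp_in fib_cast_id.
rewrite big1 ?addr0 // => i /eqP il; rewrite fock_comp_in fib_cast_neq.
  by rewrite (blin0 (fock_in_blin _)).
by apply/eqP => e; apply: il; exact: val_inj.
Qed.

Lemma fock_trunc_tends y : tends (fun L => fock_trunc L y) y.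
Proof.
have span : lin_span [set v | exists n (x : X n), v = inF n x] `<=`
    [set y | exists N, forall L, (N <= L)%N -> fock_trunc L y = y].
  apply: lin_span_sub.
  - by exists 0%N => L _; rewrite (blin0 (fock_trunc_blin _)).
  - move=> c u v [N hN] [M hM]; exists (maxn N M) => L; rewrite geq_max => /andP[NL ML].
    by rewrite fock_trunc_linear hN // hM.
  - by move=> _ [n [x ->]]; exists n.+1 => L nL; exact: fock_trunc_in.
move=> e e0; have : closed_span [set v | exists n (x : X n), v = inF n x] y.
  by rewrite fock_total.
(* 5 = 4 + 1: the truncation has bound 4, and y - z itself is added. *)
move=> /closureR /(_ (e / 5) ltac:(by rewrite divr_gt0))[z /span[N hN] yz].
exists N => L /hN zL.
rewrite -[y in X in nr (_ - X)](subrK z) -{1}[y](subrK z).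
rewrite (blinD (fock_trunc_blin L)) zL opprD addrACA subrr addr0.
apply: le_lt_trans (nrD _ _) _; rewrite nrN; have := fock_trunc_le L (y - z); lra.
Qed.

End FockComponents.

(** * Operators of the form a (x) I *)

(* Log-convexity along the powers of 2, as in the spectral radius formula. *)
Lemma moment_bound (R : realType) (m : nat -> R) (C E : R) :
  0 <= m 0%N -> 0 < E -> (forall j, m j ^+ 2 <= m 0%N * m (j + j)%N) ->
  (forall n, m n <= C * E ^+ n) -> m 1%N <= E * m 0%N.
Proof.
move=> m0 E0 mlog mC; rewrite leNgt; apply/negP => m1.
have [z|nz] := eqVneq (m 0%N) 0.
  have := mlog 1%N; rewrite z mul0r => h.
  have : m 1%N = 0 by apply/eqP; rewrite -sqrf_eq0 eq_le h sqr_ge0.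
  by move=> h1; move: m1; rewrite h1 z mulr0 ltxx.
have {nz} p0 : 0 < m 0%N by rewrite lt_def nz.
(* If rho > 1, log-convexity gives m (2^j) >= m 0 (rho E)^(2^j); the growth bound then forces m 0
   rho^(2^j) <= C for every j, which contradicts Bernoulli's inequality. *)
set rho := m 1%N / (m 0%N * E).
have rho1 : 1 < rho by rewrite /rho ltr_pdivlMr ?mulr_gt0 // mul1r mulrC.
have rE0 : 0 <= rho * E by rewrite mulr_ge0 // ltW // (lt_trans _ rho1) // ltr01.
have low j : m 0%N * (rho * E) ^+ (2 ^ j) <= m (2 ^ j)%N.
  elim: j => [|j IH].
    by rewrite expn0 expr1 /rho [leLHS](_ : _ = m 1%N) //; field; rewrite !gt_eqF.
  have h := mlog (2 ^ j)%N; rewrite addnn -mul2n -expnS in h.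
  rewrite -(ler_pM2l p0); apply: le_trans h.
  have -> : m 0%N * (m 0%N * (rho * E) ^+ (2 ^ j.+1)) = (m 0%N * (rho * E) ^+ (2 ^ j)) ^+ 2.
    by rewrite expnS mulnC exprM; ring.
  have l0 : 0 <= m 0%N * (rho * E) ^+ (2 ^ j) by rewrite mulr_ge0 // exprn_ge0.
  by rewrite lerXn2r // nnegrE // (le_trans l0).
have up j : m 0%N * rho ^+ (2 ^ j) <= C.
  have := le_trans (low j) (mC _); rewrite exprMn mulrA.
  by rewrite ler_pM2r // exprn_gt0.
have bern n : 1 + n%:R * (rho - 1) <= rho ^+ n.
  elim: n => [|n IH]; first by rewrite mul0r addr0 expr0.
  rewrite exprS -natr1; have r0 : 0 <= rho by rewrite ltW // (lt_trans _ rho1).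
  apply: le_trans (ler_wpM2l r0 IH).
  have : 0 <= n%:R * (rho - 1) ^+ 2 by rewrite mulr_ge0 ?ler0n ?sqr_ge0.
  rewrite expr2; lra.
pose n := Num.truncn (C / (m 0%N * (rho - 1))).
have hn : C / (m 0%N * (rho - 1)) < n.+1%:R by exact: truncnS_gt.
have r1 : 0 < rho - 1 by rewrite subr_gt0.
have : n.+1%:R * (rho - 1) < rho ^+ (2 ^ n.+1).
  apply: lt_le_trans (bern _); rewrite ltr_pwDl // ler_wpM2r ?(ltW r1) // ler_nat.
  by apply: ltnW; exact: ltn_expl.
rewrite ltr_pdivrMr ?mulr_gt0 // in hn; have := up n.+1.
rewrite -(ltr_pM2l p0) => h1 h2; suff : C < C by rewrite ltxx.
apply: lt_le_trans h1; apply: lt_trans hn _.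
by rewrite mulrCA.
Qed.

Section Amplification.
Variables (R : realType) (A : cstarType R) (F : hmodType A) (H : hilbertType R).
Variable sigma : A -> bop H H.
Hypothesis rep : representation sigma.
Implicit Types (xi : seq (F * H)) (a b : F -> F).

(* The inner product of [\sum a y (x) h] and [\sum b y (x) h], over the [(y, h)]
   in xi, in [F (x)_sigma H]. *)
Definition qform xi a b : R[i] :=
  \sum_(p <- xi) \sum_(p' <- xi) inner p.2 (sigma (minner (a p.1) (b p'.1)) p'.2).

(** A squared seminorm, so all bounds in terms of it are quadratic. *)
Definition qnorm xi : R := complex.Re (qform xi id id).

Lemma qform_map xi a b (f : F -> F) :
  qform [seq (f p.1, p.2) | p <- xi] a b = qform xi (a \o f) (b \o f).
Proof. by rewrite /qform big_map; apply: eq_bigr => p _; rewrite big_map. Qed.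

Lemma qform_scalar xi a : scalar (qform xi a).
Proof.
move=> c b b'; rewrite /qform mulr_sumr -big_split /=; apply: eq_bigr => p _.
rewrite mulr_sumr -big_split /=; apply: eq_bigr => p' _.
rewrite [(c *: b + b') _](_ : _ = c *: b p'.1 + b' p'.1) //.
by rewrite minnerDr minnerZr (repD rep) (repZ rep) innerDr innerZr.
Qed.

Lemma qform_conj xi a b : (qform xi a b)^* = qform xi b a.
Proof.
rewrite /qform rmorph_sum exchange_big /=; apply: eq_bigr => p _.
rewrite rmorph_sum; apply: eq_bigr => p' _ /=.
by rewrite inner_conj (rep_star rep) minner_star.
Qed.

(** For the Fock module, [qnorm_ge0] derives this from the given Hilbert spaces X(l) (x)_sigma H. *)
Hypothesis qpos : forall xi, 0 <= qnorm xi.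

Lemma qform_pos xi a : 0 <= complex.Re (qform xi a a).
Proof. by have := qpos [seq (a p.1, p.2) | p <- xi]; rewrite /qnorm qform_map. Qed.

Lemma qform_adj xi (a : aop F F) (f g : F -> F) :
  qform xi (a \o f) g = qform xi f (aop_adj a \o g).
Proof.
by apply: eq_bigr => p _; apply: eq_bigr => p' _; rewrite /= aop_adjP.
Qed.

(** The usual reason is a^* a <= |a|^2 in L(F). Here [moment_bound] is applied to m j = <xi, (k (x)
    I)^j xi> with k = a^* a: these moments are log-convex by Cauchy-Schwarz and grow at most like
    E^j. The 4 in E = 4 e^2 is that of [aop_adj_le]. *)
Lemma amplification_bound xi (a : aop F F) (e : R) : 0 < e ->
  (forall y, nr (a y) <= e * nr y) ->
  qnorm [seq (a p.1, p.2) | p <- xi] <= 4 * e ^+ 2 * qnorm xi.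
Proof.
move=> e0 ae; pose k := aop_mul (aop_star a) a.
have E0 : 0 < 4 * e ^+ 2 by rewrite mulr_gt0 ?ltr0n ?exprn_gt0.
have kE y : nr (k y) <= 4 * e ^+ 2 * nr y.
  apply: le_trans (aop_adj_le (ltW e0) ae _) _; rewrite expr2 -!mulrA.
  by rewrite ler_wpM2l ?ler0n // ler_wpM2l // ltW.
set E := 4 * e ^+ 2 in E0 kE *.
pose m j := complex.Re (qform xi id (iter j k)).
have kadj i j : qform xi (iter i k) (iter j k) = qform xi id (iter (i + j) k).
  elim: i j => [|i IH] j //.
  have -> : iter i.+1 k = (k : F -> F) \o iter i k :> (F -> F) by [].
  rewrite (qform_adj xi k).
  have -> : aop_adj k \o iter j k = iter j.+1 k :> (F -> F) by [].
  by rewrite IH addnS.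
have -> : qnorm [seq (a p.1, p.2) | p <- xi] = m 1%N.
  by rewrite /qnorm qform_map /m -[id \o a]/(a \o id) (qform_adj xi a).
have iterE n y : nr (iter n k y) <= E ^+ n * nr y.
  elim: n => [|n IH]; first by rewrite expr0 mul1r.
  rewrite iterS; apply: le_trans (kE _) _; rewrite exprS -[leRHS]mulrA.
  by rewrite ler_wpM2l // ltW.
(* Any constant independent of n will do; 8 = 2 * 4 combines [rep_bounded] and [nr_minner]. *)
pose C := \sum_(p <- xi) \sum_(p' <- xi) nr p.2 * (8 * nr p.1 * nr p'.1 * nr p'.2).
apply: (@moment_bound R m C).
- exact: qpos.
- exact: E0.
- move=> j; have := psd_cauchy_schwarz (qform_scalar xi) (qform_conj xi) (qform_pos xi) id (iter j k).
  rewrite kadj; apply: le_trans; rewrite /m -[_ ^+ 2]real_normK ?num_real //.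
  rewrite lerXn2r // ?nnegrE ?nr_ge0 //.
  by rewrite -lecR -nrE; exact: normc_ge_Re.
- move=> n; apply: le_trans (Re_le_nr _) _; apply: le_trans (nr_sum _ _ _) _.
  rewrite /C mulr_suml; apply: ler_sum => p _; apply: le_trans (nr_sum _ _ _) _.
  rewrite mulr_suml; apply: ler_sum => p' _; apply: le_trans (cauchy_schwarz _ _) _.
  rewrite -[leRHS]mulrA ler_wpM2l ?nr_ge0 //; apply: le_trans (rep_bounded rep _ _) _.
  have h : nr (minner p.1 (iter n k p'.1)) <= 4 * nr p.1 * (E ^+ n * nr p'.1).
    by apply: le_trans (nr_minner _ _) _; rewrite ler_wpM2l ?mulr_ge0 ?ler0n ?nr_ge0.
  have -> : 8 * nr p.1 * nr p'.1 * nr p'.2 * E ^+ n =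
    2 * (4 * nr p.1 * (E ^+ n * nr p'.1)) * nr p'.2 by ring.
  by rewrite ler_wpM2r ?nr_ge0 // ler_wpM2l ?ler0n.
Qed.

End Amplification.

(** From Lagrange's identity. *)
Lemma sum_cauchy_schwarz (R : realType) (I : Type) (s : seq I) (a b : I -> R) :
  (\sum_(i <- s) a i * b i) ^+ 2 <= (\sum_(i <- s) a i ^+ 2) * (\sum_(i <- s) b i ^+ 2).
Proof.
have : 0 <= \sum_(i <- s) \sum_(j <- s) (a i * b j - a j * b i) ^+ 2.
  by apply: sumr_ge0 => i _; apply: sumr_ge0 => j _; exact: sqr_ge0.
have -> : \sum_(i <- s) \sum_(j <- s) (a i * b j - a j * b i) ^+ 2 =
  \sum_(i <- s) \sum_(j <- s) (a i ^+ 2 * b j ^+ 2) + \sum_(i <- s) \sum_(j <- s) (b i ^+ 2 * a j ^+ 2)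
  - (\sum_(i <- s) \sum_(j <- s) (a i * b i) * (a j * b j)) *+ 2.
  rewrite -sumrMnl -!sumrN -!big_split /=; apply: eq_bigr => i _.
  rewrite -sumrMnl -!sumrN -!big_split /=; apply: eq_bigr => j _; ring.
rewrite -!big_distrlr /= expr2; lra.
Qed.

Lemma tends_le (R : realType) (V W : normedZmodType R[i]) (u : nat -> V) l (v : nat -> W) l' (C : R) :
  (forall n, nr (u n - l) <= C * nr (v n - l')) -> tends v l' -> tends u l.
Proof.
move=> uv vl e e0; have p : 0 < `|C| + 1 by rewrite ltr_wpDl.
have [|N hN] := vl (e / (`|C| + 1)); first by rewrite divr_gt0.
exists N => n /hN h; apply: le_lt_trans (uv n) _.
apply: (@le_lt_trans _ _ ((`|C| + 1) * nr (v n - l'))).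
  by rewrite ler_wpM2r ?nr_ge0 // ler_wpDr // ler_norm.
by rewrite mulrC -ltr_pdivlMr.
Qed.

Lemma tends_sum (R : realType) (V : normedZmodType R[i]) I (s : seq I) (u : I -> nat -> V) (l : I -> V) :
  (forall i, tends (u i) (l i)) -> tends (fun n => \sum_(i <- s) u i n) (\sum_(i <- s) l i).
Proof.
move=> h; elim: s => [|i s IH].
  by move=> e e0; exists 0%N => n _; rewrite !big_nil subrr nr0.
move=> e e0; have e2 : 0 < e / 2 by rewrite divr_gt0.
have [N hN] := h i _ e2; have [M hM] := IH _ e2.
exists (maxn N M) => n; rewrite geq_max => /andP[/hN h1 /hM h2].
rewrite !big_cons opprD addrACA; apply: le_lt_trans (nrD _ _) _; lra.
Qed.

Lemma Re_sum (R : realType) I (s : seq I) (P : pred I) (f : I -> R[i]) :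
  complex.Re (\sum_(i <- s | P i) f i) = \sum_(i <- s | P i) complex.Re (f i).
Proof. by apply: (big_morph (@complex.Re R)) => // -[a b] [c d]. Qed.

(** * Vectors of F_X (x) H as bounded functionals *)

Section Bessel.
Variables (R : realType) (A : cstarType R) (X : subproduct_system A) (H : hilbertType R).
Variable (T : forall n, X n -> bop H H).
Hypothesis T_rep : is_cc_covariant_rep T.
Variable r : tilde_ops T.
Variable F : fock_module X.

Let sigma := rep0 T.
Let rep : representation sigma := ccr_rep0 T_rep.
Local Notation t n := (tl_tens r n).
Local Notation cp l := (@fock_comp _ _ _ F l).
Implicit Types (xi : seq (F * H)).

Definition fock_block l xi : tl_space r l := \sum_(p <- xi) t l (cp l p.1) p.2.

Lemma rep_blin h : blin (fun a => sigma a h).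
Proof.
split; first by move=> c a b; case: rep => ->.
by exists (2 * nr h) => a; rewrite mulrAC; exact: rep_bounded.
Qed.

Lemma qform_trunc xi L :
  complex.Re (qform sigma xi (@fock_trunc _ _ _ F L) id) = \sum_(l < L) nr (fock_block l xi) ^+ 2.
Proof.
rewrite /qform; have -> : \sum_(l < L) nr (fock_block l xi) ^+ 2 = complex.Re (\sum_(l < L) inner (fock_block l xi) (fock_block l xi)).
  by rewrite Re_sum; apply: eq_bigr => l _; rewrite nr_inner.
congr complex.Re; under [RHS]eq_bigr => l _ do rewrite {1}/fock_block inner_suml.
rewrite [RHS]exchange_big /=; apply: eq_bigr => p _.
under [RHS]eq_bigr => l _ do rewrite /fock_block inner_sumr.
rewrite [RHS]exchange_big /=; apply: eq_bigr => p' _.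
rewrite fock_truncE (blin_sum _ _ _ (rep_blin _)) inner_sumr.
by apply: eq_bigr => l _; rewrite tl_inner.
Qed.

Lemma qform_trunc_tends xi :
  tends (fun L => qform sigma xi (@fock_trunc _ _ _ F L) id) (qform sigma xi id id).
Proof.
apply: tends_sum => p; apply: tends_sum => p'.
apply: (tends_le (C := nr p.2 * (2 * (4 * nr p'.1) * nr p'.2)) _ (fock_trunc_tends p.1)) => L.
rewrite -innerBr -(blinB _ _ (rep_blin _)) -minnerBl.
apply: le_trans (cauchy_schwarz _ _) _; rewrite -mulrA ler_wpM2l ?nr_ge0 //.
apply: le_trans (rep_bounded rep _ _) _; rewrite [leRHS]mulrAC ler_wpM2r ?nr_ge0 //.
rewrite -[leRHS]mulrA ler_wpM2l ?ler0n //; apply: le_trans (nr_minner _ _) _.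
by rewrite mulrAC.
Qed.

(** Truncating one argument of the form to degrees below L gives exactly the sum of squared blocks;
    these sums increase with L and converge to [qnorm]. *)
Lemma bessel xi L : \sum_(l < L) nr (fock_block l xi) ^+ 2 <= qnorm sigma xi.
Proof.
apply/ler_addgt0Pr => e e0; have [N hN] := qform_trunc_tends xi e0.
have := hN (maxn N L) (leq_maxl _ _).
set c := qform _ _ _ _ - _ => c1.
have := Re_le_nr c; rewrite /c raddfB /= qform_trunc -/(qnorm sigma xi) => c2.
have : \sum_(l < L) nr (fock_block l xi) ^+ 2 <= \sum_(l < maxn N L) nr (fock_block l xi) ^+ 2.
  rewrite -!(big_mkord xpredT (fun l => nr (fock_block l xi) ^+ 2)).
  rewrite [leRHS](big_cat_nat (n := L)) ?leq_maxr //= lerDl.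
  by apply: sumr_ge0 => l _; rewrite exprn_ge0 // nr_ge0.
lra.
Qed.

Lemma qnorm_ge0 xi : 0 <= qnorm sigma xi.
Proof. by have := bessel xi 0; rewrite big_ord0. Qed.

Lemma qnorm_trunc xi L : (forall p, p \in xi -> fock_trunc L p.1 = p.1) ->
  qnorm sigma xi = \sum_(l < L) nr (fock_block l xi) ^+ 2.
Proof.
move=> h; rewrite -qform_trunc /qnorm; congr complex.Re.
rewrite /qform big_seq [RHS]big_seq; apply: eq_bigr => p pxi.
by rewrite h.
Qed.

Lemma fock_comp_trunc L (y : F) : fock_trunc L y = y -> cp L y = 0.
Proof.
move=> <-; rewrite /fock_trunc (blin_sum _ _ _ (fock_comp_blin _ _)) big1 // => i _.
by rewrite fock_comp_in fib_cast_neq // neq_ltn ltn_ord.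
Qed.

Lemma fock_trunc_trunc L M (y : F) : (L <= M)%N -> fock_trunc L y = y -> fock_trunc M y = y.
Proof.
move=> LM <-; rewrite {2 3}/fock_trunc (blin_sum _ _ _ (fock_trunc_blin _ _)).
apply: eq_bigr => i _; apply: fock_trunc_in; exact: leq_trans (ltn_ord i) LM.
Qed.

Lemma fock_block_cat l xi xi' : fock_block l (xi ++ xi') = fock_block l xi + fock_block l xi'.
Proof. by rewrite /fock_block big_cat. Qed.

(** Provides test vectors with prescribed components up to an error. Passing from L to L + 1 appends
    tensors of degree L only, which leaves the lower blocks unchanged. *)
Lemma fock_block_approx L (k : forall l, tl_space r l) (e : R) : 0 < e ->
  exists xi, (forall p, p \in xi -> fock_trunc L p.1 = p.1) /\
    forall l, (l < L)%N -> nr (fock_block l xi - k l) <= e.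
Proof.
move=> e0; elim: L => [|L [xi [xiL xik]]]; first by exists [::].
have : closed_span [set v | exists (x : X L) h, v = t L x h] (k L) by rewrite tl_total.
move=> /closureR /(_ e e0)[w Sw kw].
have [s wE] : exists s : seq (X L * H), w = \sum_(p <- s) t L p.1 p.2.
  move: (w) Sw; apply: lin_span_sub; first by exists [::]; rewrite big_nil.
    move=> c _ _ [s ->] [s' ->]; exists ([seq (c *: p.1, p.2) | p <- s] ++ s').
    rewrite big_cat big_map /= scaler_sumr; congr (_ + _); apply: eq_bigr => p _.
    by rewrite (blinZ _ _ (tl_blinl T_rep r _ p.2)).
  by move=> _ [x [h ->]]; exists [:: (x, h)]; rewrite big_seq1.
exists (xi ++ [seq (fock_in F p.1, p.2) | p <- s]); split.
  move=> p; rewrite mem_cat => /orP[/xiL|/mapP[q _ ->]] /=; first exact: fock_trunc_trunc.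
  exact: fock_trunc_in.
move=> l; rewrite ltnS leq_eqVlt fock_block_cat => /orP[/eqP ->|lL].
  have -> : fock_block L xi = 0.
    rewrite /fock_block big_seq big1 // => p /xiL /fock_comp_trunc ->.
    by rewrite (blin0 (tl_blinl T_rep r _ p.2)).
  rewrite add0r /fock_block big_map /= (eq_bigr (fun p => t L p.1 p.2)); last first.
    by move=> p _; rewrite fock_comp_in fib_cast_id.
  by rewrite -wE nrB ltW.
have -> : fock_block l [seq (fock_in F p.1, p.2) | p <- s] = 0.
  rewrite /fock_block big_map /= big1 // => p _; rewrite fock_comp_in fib_cast_neq.
    by rewrite (blin0 (tl_blinl T_rep r _ p.2)).
  by rewrite neq_ltn lL orbT.
by rewrite addr0; exact: xik.
Qed.

Definition eval_tensor (phi : F -> H -> R[i]) xi : R[i] := \sum_(p <- xi) phi p.1 p.2.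

(* The functional phi on [F (x)_sigma H] has norm at most [sqrt c]. *)
Definition qbounded (phi : F -> H -> R[i]) (c : R) : Prop :=
  forall xi, nr (eval_tensor phi xi) ^+ 2 <= c * qnorm sigma xi.

Lemma qbounded_le phi c d : qbounded phi c -> c <= d -> qbounded phi d.
Proof.
by move=> h cd xi; apply: le_trans (h xi) _; rewrite ler_wpM2r // qnorm_ge0.
Qed.

Lemma qbounded_ext phi psi c : (forall y h, phi y h = psi y h) -> qbounded phi c -> qbounded psi c.
Proof. by move=> e h xi; have := h xi; rewrite /eval_tensor (eq_bigr (fun p => psi p.1 p.2)). Qed.

(** The constants bound squares of norms, whence (s + t)^2 <= 2 s^2 + 2 t^2. *)
Lemma qboundedD phi psi c d : qbounded phi c -> qbounded psi d ->
  qbounded (fun y h => phi y h + psi y h) (2 * c + 2 * d).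
Proof.
move=> h1 h2 xi; rewrite /eval_tensor big_split /=; set a := \sum_(p <- xi) phi _ _; set b := \sum_(p <- xi) psi _ _.
have ha : nr a ^+ 2 <= c * qnorm sigma xi := h1 xi.
have hb : nr b ^+ 2 <= d * qnorm sigma xi := h2 xi.
have hab : nr (a + b) ^+ 2 <= (nr a + nr b) ^+ 2.
  by rewrite lerXn2r // ?nnegrE ?addr_ge0 ?nr_ge0 // nrD.
have : (nr a + nr b) ^+ 2 <= 2 * nr a ^+ 2 + 2 * nr b ^+ 2.
  by have := sqr_ge0 (nr a - nr b); rewrite !expr2; lra.
lra.
Qed.

Lemma qboundedN phi c : qbounded phi c -> qbounded (fun y h => - phi y h) c.
Proof. by move=> h xi; rewrite /eval_tensor sumrN nrN; exact: h. Qed.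

(** If phi represents v, the new functional represents (a (x) I) v. The adjoint has bound 4 e, and
    [amplification_bound] turns this into 4 (4 e)^2 = 64 e^2. *)
Lemma qbounded_adj phi c (a : aop F F) (e : R) : 0 <= c -> 0 < e -> (forall y, nr (a y) <= e * nr y) ->
  qbounded phi c -> qbounded (fun y h => phi (aop_adj a y) h) (64 * e ^+ 2 * c).
Proof.
move=> c0 e0 ae h xi; have := h [seq (aop_adj a p.1, p.2) | p <- xi].
rewrite /eval_tensor big_map => /le_trans; apply; rewrite [64 * _ * _]mulrC -mulrA ler_wpM2l //.
have e4 : 0 < 4 * e by rewrite mulr_gt0 ?ltr0n.
apply: le_trans (amplification_bound rep qnorm_ge0 xi (a := aop_star a) e4 (aop_adj_le (ltW e0) ae)) _.
by rewrite exprMn mulrA -natrX -natrM.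
Qed.

(** This functional represents the vector with component [k l] in degree m + l; Cauchy-Schwarz in
    each degree and then [bessel] give its norm. *)
Lemma qbounded_blocks m M K (k : forall l, tl_space r (m + l)%N) :
  qbounded (fun y h => \sum_(M <= l < M + K) inner (t (m + l)%N (cp (m + l)%N y) h) (k l))
    (\sum_(M <= l < M + K) nr (k l) ^+ 2).
Proof.
move=> xi.
have -> : eval_tensor (fun y h => \sum_(M <= l < M + K) inner (t (m + l)%N (cp (m + l)%N y) h) (k l)) xi =
  \sum_(M <= l < M + K) inner (fock_block (m + l)%N xi) (k l).
  by rewrite /eval_tensor exchange_big; apply: eq_bigr => l _; rewrite /fock_block inner_suml.
set s := \sum_(M <= l < M + K) inner _ _.
have hs : nr s <= \sum_(M <= l < M + K) nr (fock_block (m + l)%N xi) * nr (k l).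
  apply: le_trans (nr_sum _ _ _) _; apply: ler_sum => l _; exact: cauchy_schwarz.
have : nr s ^+ 2 <= (\sum_(M <= l < M + K) nr (fock_block (m + l)%N xi) * nr (k l)) ^+ 2.
  by rewrite lerXn2r // nnegrE ?nr_ge0 // (le_trans (nr_ge0 s)).
move=> /le_trans; apply; apply: le_trans (sum_cauchy_schwarz _ _ _) _.
rewrite mulrC ler_wpM2l //; first by apply: sumr_ge0 => l _; rewrite exprn_ge0 // nr_ge0.
apply: le_trans (bessel xi (m + (M + K))).
rewrite -(big_mkord xpredT (fun l => nr (fock_block l xi) ^+ 2)).
rewrite [leRHS](big_cat_nat (n := (m + M)%N)) ?leq_add2l ?leq_addr //=.
apply: (@le_trans _ _ (\sum_(m + M <= l < m + (M + K)) nr (fock_block l xi) ^+ 2)).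
  rewrite (addnC m M) (addnC m (M + K)%N) big_addn addnK.
  by apply: ler_sum => l _; rewrite addnC.
by rewrite lerDr; apply: sumr_ge0 => l _; rewrite exprn_ge0 // nr_ge0.
Qed.

End Bessel.

(** * Asymptotic intertwining *)

Section AsymptoticCalculus.
Variables (R : realType) (A : cstarType R) (X : subproduct_system A) (H : hilbertType R).
Variable (T : forall n, X n -> bop H H).
Hypothesis T_rep : is_cc_covariant_rep T.
Variable r : tilde_ops T.
Variable F : fock_module X.

Let sigma := rep0 T.
Let rep : representation sigma := ccr_rep0 T_rep.
Local Notation t n := (tl_tens r n).
Local Notation J n := (bop_adj (tl_op r n)).
Local Notation P := (range_proj r).
Local Notation cp l := (@fock_comp _ _ _ F l).
Local Notation S := (xshift F).
Local Notation qn := (qnorm sigma).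
Local Notation qbounded := (@qbounded R A X H T F).

Lemma fock_comp_shift_eq m (z : X m) l y : cp (m + l)%N (S z y) = sp_mul z (cp l y).
Proof.
have bz := sp_mul_blin z l.
have hP := blin_eq (blin_comp (aop_blin (S z)) (fock_comp_blin F (m + l)%N)) (blin_comp (fock_comp_blin F l) bz).
apply: (total_sub (fock_total F) hP) => _ [n [x ->]] /=.
rewrite xshiftE !fock_comp_in.
have [e|nl] := eqVneq n l.
  by move: x; rewrite e => x; rewrite !fib_cast_id.
rewrite (fib_cast_neq x nl) (blin0 bz) fib_cast_neq //.
by rewrite eqn_add2l.
Qed.

(** The functional of the sum of [J l u] over N <= l < 2N. The factor N^(-1/2) is left out; bounds
    for it are proportional to N instead. *)
Definition avg N (u : H) (y : F) (h : H) : R[i] :=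
  \sum_(N <= l < N + N) inner (T (cp l y) h) u.

Lemma avg_linear N c u v y h : avg N (c *: u + v) y h = c * avg N u y h + avg N v y h.
Proof.
rewrite /avg mulr_sumr -big_split /=; apply: eq_bigr => l _.
by rewrite innerDr innerZr.
Qed.

Lemma avgB N u v y h : avg N (u - v) y h = avg N u y h - avg N v y h.
Proof. by rewrite addrC -scaleN1r avg_linear mulN1r addrC. Qed.

Lemma qbounded_window M K u : (forall l, P l u = u) ->
  qbounded (fun y h => \sum_(M <= l < M + K) inner (T (cp l y) h) u) (K%:R * nr u ^+ 2).
Proof.
move=> Pu.
have := @qbounded_blocks _ _ _ _ _ T_rep r F 0 M K (fun l => J l u).
rewrite (eq_bigr (fun=> nr u ^+ 2)); last by move=> l _; rewrite (pi_nr (Pu l)).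
rewrite sumr_const_nat addKn -[_ *+ K]mulr_natl => hd; apply: qbounded_ext _ hd => y h.
by apply: eq_bigr => l _; rewrite -bop_adjP -(tl_opE r) bop_adjP.
Qed.

Lemma qbounded_avg N u : (forall l, P l u = u) -> qbounded (avg N u) (N%:R * nr u ^+ 2).
Proof. exact: qbounded_window. Qed.

(** The functional is tested on an approximation of the vector that it represents: the value is at
    least N |u|^2 / 2, and the squared norm of the test vector at most N (1/4 + 9/4) |u|^2. *)
Lemma avg_lower N u c : (forall l, P l u = u) -> 0 <= c -> (0 < N)%N ->
  qbounded (avg N u) c -> N%:R * nr u ^+ 2 <= 10 * c.
Proof.
move=> Pu c0 N0 hc; have Nr : 0 < N%:R :> R by rewrite ltr0n.
have [u0|u0] := eqVneq (nr u) 0.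
  by rewrite u0 expr0n mulr0 mulr_ge0 ?ler0n.
have up : 0 < nr u by rewrite lt_def u0 nr_ge0.
(* Degrees below the window are prescribed too, as 0, because they count in the norm of the test
   vector. *)
pose k l : tl_space r l := if (l < N)%N then 0 else J l u.
have [|xi [xiL xik]] := @fock_block_approx _ _ _ _ _ T_rep r F (N + N)%N k (nr u / 2).
  by rewrite divr_gt0 ?ltr0n.
have qE := qnorm_trunc T_rep r xiL.
have := hc xi.
have evE : eval_tensor (avg N u) xi = \sum_(N <= l < N + N) inner (fock_block r l xi) (J l u).
  rewrite /eval_tensor /avg exchange_big /=; apply: eq_bigr => l _; rewrite /fock_block inner_suml.
  by apply: eq_bigr => p _; rewrite -bop_adjP tl_opE.
have lowE : N%:R * (nr u ^+ 2 / 2) <= nr (eval_tensor (avg N u) xi).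
  apply: le_trans (Re_le_nr _); rewrite evE Re_sum.
  have -> : N%:R * (nr u ^+ 2 / 2) = \sum_(N <= l < N + N) (nr u ^+ 2 / 2).
    by rewrite sumr_const_nat addKn mulr_natl.
  apply: ler_sum_nat => l /andP[Nl lN].
  have h1 := xik l lN; rewrite /k ltnNge Nl /= in h1.
  have -> : inner (fock_block r l xi) (J l u) = inner (J l u) (J l u) - inner (J l u - fock_block r l xi) (J l u).
    by rewrite innerBl opprB addrC subrK.
  rewrite raddfB /= -nr_inner (pi_nr (Pu l)).
  have h2 := Re_le_nr (inner (J l u - fock_block r l xi) (J l u)).
  have h3 := cauchy_schwarz (J l u - fock_block r l xi) (J l u).
  rewrite nrB (pi_nr (Pu l)) in h3.
  have h4 : nr (fock_block r l xi - J l u) * nr u <= nr u / 2 * nr u by rewrite ler_wpM2r // ltW.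
  rewrite expr2; lra.
have upE : qn xi <= N%:R * (nr u ^+ 2 * (5 / 2)).
  rewrite qE -(big_mkord xpredT (fun l => nr (fock_block r l xi) ^+ 2)) (big_cat_nat (n := N)) ?leq_addr //=.
  have e1 : \sum_(0 <= l < N) nr (fock_block r l xi) ^+ 2 <= \sum_(0 <= l < N) (nr u ^+ 2 * (1 / 4)).
    apply: ler_sum_nat => l /andP[_ lN].
    have h1 := xik l (leq_trans lN (leq_addr _ _)); rewrite /k lN subr0 in h1.
    have : nr (fock_block r l xi) ^+ 2 <= (nr u / 2) ^+ 2.
      by rewrite lerXn2r // ?nnegrE ?nr_ge0 // divr_ge0 ?ler0n // ltW.
    rewrite !expr2; lra.
  have e2 : \sum_(N <= l < N + N) nr (fock_block r l xi) ^+ 2 <= \sum_(N <= l < N + N) (nr u ^+ 2 * (9 / 4)).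
    apply: ler_sum_nat => l /andP[Nl lN].
    have h1 := xik l lN; rewrite /k ltnNge Nl /= in h1.
    have h2 := nr_le_add (fock_block r l xi) (J l u); rewrite (pi_nr (Pu l)) in h2.
    have : nr (fock_block r l xi) ^+ 2 <= (3 / 2 * nr u) ^+ 2.
      rewrite lerXn2r // ?nnegrE ?nr_ge0 //; last by lra.
      by rewrite mulr_ge0 ?divr_ge0 ?ler0n // ltW.
    rewrite !expr2; lra.
  rewrite sumr_const_nat subn0 -[_ *+ N]mulr_natl in e1.
  rewrite sumr_const_nat addKn -[_ *+ N]mulr_natl in e2; lra.
move=> h; have {}h : nr (eval_tensor (avg N u) xi) ^+ 2 <= c * (N%:R * (nr u ^+ 2 * (5 / 2))).
  by apply: le_trans h _; rewrite ler_wpM2l.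
have {}h : (N%:R * (nr u ^+ 2 / 2)) ^+ 2 <= c * (N%:R * (nr u ^+ 2 * (5 / 2))).
  apply: le_trans h; rewrite lerXn2r // ?nnegrE ?nr_ge0 //.
  by rewrite mulr_ge0 ?ler0n // divr_ge0 ?ler0n // exprn_ge0 // ltW.
have s0 : 0 < nr u ^+ 2 by rewrite exprn_gt0.
have p : 0 < N%:R * nr u ^+ 2 by rewrite mulr_gt0.
rewrite -(ler_pM2r p).
have -> : N%:R * nr u ^+ 2 * (N%:R * nr u ^+ 2) = 4 * (N%:R * (nr u ^+ 2 / 2)) ^+ 2 by field.
have -> : 10 * c * (N%:R * nr u ^+ 2) = 4 * (c * (N%:R * (nr u ^+ 2 * (5 / 2)))) by field.
by rewrite ler_wpM2l ?ler0n.
Qed.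

End AsymptoticCalculus.

Section Transfer.
Variables (R : realType) (A : cstarType R) (X : subproduct_system A) (H : hilbertType R).
Variable (T : forall n, X n -> bop H H).
Hypothesis T_rep : is_cc_covariant_rep T.
Variable r : tilde_ops T.
Variable F : fock_module X.
Variable Q : bop H H.
Hypothesis hU : clsub [set u | Q u = u].
Hypothesis fixP : forall u, Q u = u -> forall l, range_proj r l u = u.

Let sigma := rep0 T.
Let rep : representation sigma := ccr_rep0 T_rep.
Local Notation t n := (tl_tens r n).
Local Notation J n := (bop_adj (tl_op r n)).
Local Notation cp l := (@fock_comp _ _ _ F l).
Local Notation S := (xshift F).
Local Notation qboundedT := (@qbounded R A X H T F).
Let U := sub_space hU.
Local Notation vl := (@sub_val R H [set u | Q u = u] hU).
Implicit Types (a : aop F F) (b : U -> U) (u : U).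

Local Notation davg N Pu := (@qbounded_avg _ _ _ _ _ T_rep r F N _ Pu).
Local Notation dwin M K Pu := (@qbounded_window _ _ _ _ _ T_rep r F M K _ Pu).

Lemma fixed_range u l : range_proj r l (vl u) = vl u.
Proof. by apply: fixP; exact: (subP u). Qed.

(* [a (x) I] maps the averages [(1/sqrt N) sum_(N <= l < 2N) T~_l^* u] asymptotically
   to those of [b u]. *)
Definition asymp_rel a b : Prop := forall u (e : R), 0 < e -> exists N0, forall N, (N0 <= N)%N ->
  qboundedT (fun y h => avg T N (vl u) (aop_adj a y) h - avg T N (vl (b u)) y h) (e * N%:R).

Lemma qboundedZ (c : R[i]) phi d : qboundedT phi d -> qboundedT (fun y h => c * phi y h) (nr c ^+ 2 * d).
Proof.
move=> h xi; rewrite /eval_tensor -mulr_sumr nrM exprMn -mulrA ler_wpM2l ?exprn_ge0 ?nr_ge0 //.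
exact: h.
Qed.

Lemma avg_antilinear N v c (y z : F) h :
  avg T N v (c^* *: y + z) h = c * avg T N v y h + avg T N v z h.
Proof.
rewrite /avg mulr_sumr -big_split /=; apply: eq_bigr => l _.
have [lin _] := blin_comp (fock_comp_blin F l) (T_blin T_rep r _ h).
by rewrite lin innerDl innerZl conjCK.
Qed.

Lemma asymp_rel_linear c a b a' b' : asymp_rel a b -> asymp_rel a' b' ->
  asymp_rel (aop_add (aop_scale c a) a') (fun u => c *: b u + b' u).
Proof.
move=> ab ab' u e e0; have c1 : 0 < nr c ^+ 2 + 1 by rewrite ltr_wpDl // exprn_ge0 // nr_ge0.
have [|N0 hN] := ab u (e / (4 * (nr c ^+ 2 + 1))); first by rewrite divr_gt0 ?mulr_gt0 ?ltr0n.
have [|M0 hM] := ab' u (e / 4); first by rewrite divr_gt0 ?ltr0n.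
exists (maxn N0 M0) => N; rewrite geq_max => /andP[/hN h1 /hM h2].
have h := qboundedD (qboundedZ c h1) h2.
apply: (qbounded_le T_rep r (c := 2 * (nr c ^+ 2 * (e / (4 * (nr c ^+ 2 + 1)) * N%:R)) + 2 * (e / 4 * N%:R))).
  apply: qbounded_ext h => y k /=.
  by rewrite avg_antilinear (avg_linear T N c) mulrBr; ring.
have h3 : nr c ^+ 2 * (e / (4 * (nr c ^+ 2 + 1))) <= e / 4.
  have -> : nr c ^+ 2 * (e / (4 * (nr c ^+ 2 + 1))) = e / 4 * (nr c ^+ 2 / (nr c ^+ 2 + 1)).
    by field; rewrite gt_eqF.
  rewrite ler_piMr //; first by rewrite divr_ge0 ?ler0n // ltW.
  by rewrite ler_pdivrMr // mul1r lerDl.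
have : nr c ^+ 2 * (e / (4 * (nr c ^+ 2 + 1)) * N%:R) <= e / 4 * N%:R.
  by rewrite mulrA ler_wpM2r ?ler0n.
lra.
Qed.

(** The error for a' is carried through a, which multiplies it by the 64 C^2 of [qbounded_adj]. *)
Lemma asymp_rel_mul a b a' b' : asymp_rel a b -> asymp_rel a' b' -> asymp_rel (aop_mul a a') (b \o b').
Proof.
move=> ab ab' u e e0; have [C C0 aC] := aop_bounded a.
have [|N0 hN] := ab' u (e / (4 * (64 * C ^+ 2))); first by rewrite divr_gt0 ?mulr_gt0 ?exprn_gt0 ?ltr0n.
have [|M0 hM] := ab (b' u) (e / 4); first by rewrite divr_gt0 ?ltr0n.
exists (maxn N0 M0) => N; rewrite geq_max => /andP[/hN h1 /hM h2].
have c0 : 0 <= e / (4 * (64 * C ^+ 2)) * N%:R.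
  by rewrite mulr_ge0 ?ler0n // divr_ge0 ?mulr_ge0 ?exprn_ge0 ?ler0n // ltW.
have h := qboundedD (qbounded_adj T_rep r c0 C0 aC h1) h2.
apply: (qbounded_le T_rep r (c := _)); first apply: qbounded_ext h => y k /=.
  by rewrite addrA subrK.
have -> : 64 * C ^+ 2 * (e / (4 * (64 * C ^+ 2)) * N%:R) = e / 4 * N%:R.
  by field; rewrite gt_eqF.
lra.
Qed.

(** Up to a small error the functional of b u is that of u composed with a^* (x) I. Hence
    [avg_lower] gives |b u|^2 <= 10 * 2 * 64 e^2 |u|^2, and 1280 <= 40^2. *)
Lemma asymp_rel_bound a b (e : R) : 0 < e -> (forall y, nr (a y) <= e * nr y) -> asymp_rel a b ->
  forall u, nr (b u) <= 40 * e * nr u.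
Proof.
move=> e0 ae ab u; have bu0 : 0 <= 40 * e * nr u by rewrite !mulr_ge0 ?ler0n ?nr_ge0 // ltW.
rewrite -(ler_pXn2r (n := 2)) // ?nnegrE ?nr_ge0 //.
suff : nr (b u) ^+ 2 <= 1280 * e ^+ 2 * nr u ^+ 2.
  move=> h; apply: le_trans h _; rewrite !exprMn ler_wpM2r ?exprn_ge0 ?nr_ge0 //.
  by rewrite ler_wpM2r ?exprn_ge0 ?(ltW e0) // -natrX ler_nat.
apply/ler_addgt0Pr => d d0.
have [|N0 hN] := ab u (d / 20); first by rewrite divr_gt0 ?ltr0n.
have {hN} h1 := hN N0.+1 (leqnSn _); set N := N0.+1 in h1.
have Nr : 0 < N%:R :> R by rewrite ltr0n.
have h2 := davg N (fixed_range u).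
have c0 : 0 <= N%:R * nr (vl u) ^+ 2 by rewrite mulr_ge0 ?ler0n // exprn_ge0 // nr_ge0.
have h := qboundedD (qbounded_adj T_rep r c0 e0 ae h2) (qboundedN h1).
have {h} : qboundedT (avg T N (vl (b u))) (2 * (64 * e ^+ 2 * (N%:R * nr (vl u) ^+ 2)) + 2 * (d / 20 * N%:R)).
  apply: qbounded_ext h => y k /=; ring.
move=> h; have {}h := avg_lower T_rep (fixed_range (b u)) _ (ltn0Sn _) h.
rewrite -(ler_pM2l Nr); apply: le_trans (h _) _.
  by apply: addr_ge0; do ?apply: mulr_ge0; rewrite ?exprn_ge0 ?invr_ge0 ?ler0n ?nr_ge0 ?(ltW e0) ?(ltW d0).
rewrite -sub_nrE; set z := nr u ^+ 2; set w := e ^+ 2.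
have -> : 10 * (2 * (64 * w * (N%:R * z)) + 2 * (d / 20 * N%:R)) = N%:R * (1280 * w * z + d) by field.
by [].
Qed.

(** The combination (-1) a + a acts as 0, so [asymp_rel_bound] applies to it with every e > 0. *)
Lemma asymp_rel_unique a b b' : asymp_rel a b -> asymp_rel a b' -> forall u, b u = b' u.
Proof.
move=> ab ab' u; have ab'' := asymp_rel_linear (- 1) ab' ab.
have h (e : R) : 0 < e -> nr (b u - b' u) <= 40 * e * nr u.
  move=> e0; have := @asymp_rel_bound _ _ e e0 _ ab'' u; rewrite scaleN1r addrC; apply => y.
  by rewrite /= scaleN1r addNr nr0 mulr_ge0 ?nr_ge0 // ltW.
apply/eqP; rewrite -subr_eq0; apply/eqP; apply: nr0_eq0; apply/eqP.
rewrite eq_le nr_ge0 andbT; apply/ler_addgt0Pr => d d0; rewrite add0r.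
have p : 0 < 40 * (nr u + 1) by rewrite mulr_gt0 ?ltr0n // ltr_wpDl ?nr_ge0.
apply: le_trans (h (d / (40 * (nr u + 1))) ltac:(by rewrite divr_gt0)) _.
have -> : 40 * (d / (40 * (nr u + 1))) * nr u = d * (nr u / (nr u + 1)).
  by field; rewrite gt_eqF // ltr_wpDl ?nr_ge0.
by rewrite ler_piMr ?(ltW d0) // ler_pdivrMr ?ltr_wpDl ?nr_ge0 // mul1r lerDl.
Qed.

Lemma asymp_rel_limit a b : (forall e : R, 0 < e -> exists a' b',
    [/\ asymp_rel a' b', (forall y, nr (a y - a' y) <= e * nr y) & forall u, nr (b u - b' u) <= 40 * e * nr u]) ->
  asymp_rel a b.
Proof.
move=> happ u d d0; set z := nr u.
have z1 : 0 < z + 1 by rewrite ltr_wpDl ?nr_ge0.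
(* The error terms add up to d / 4 + (4 * 64 + 2 * 1600) e^2 z^2 per unit of N, and 3456 is well
   below 8000; e <= 1 serves to replace e^2 by e. *)
set e := Num.min 1 (d / (8000 * (z + 1) ^+ 2)).
have e0 : 0 < e by rewrite lt_min ltr01 divr_gt0 ?mulr_gt0 ?exprn_gt0 ?ltr0n.
have eb : 8000 * e ^+ 2 * z ^+ 2 <= d.
  have e1 : e <= 1 by rewrite ge_min lexx.
  have e2 : e * (8000 * (z + 1) ^+ 2) <= d.
    by rewrite -ler_pdivlMr ?mulr_gt0 ?exprn_gt0 ?ltr0n // ge_min lexx orbT.
  apply: le_trans e2; have -> : 8000 * e ^+ 2 * z ^+ 2 = e * (8000 * (e * z ^+ 2)) by ring.
  rewrite ler_wpM2l ?(ltW e0) // ler_wpM2l ?ler0n //.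
  apply: (@le_trans _ _ (1 * z ^+ 2)); first by rewrite ler_wpM2r ?exprn_ge0 ?nr_ge0.
  by rewrite mul1r lerXn2r // ?nnegrE ?nr_ge0 ?(ltW z1) // lerDl.
have [a' [b' [ab' aa' bb']]] := happ e e0.
have [|N0 hN] := ab' u (d / 16); first by rewrite divr_gt0 ?ltr0n.
exists N0 => N /hN h1.
pose da := aop_add a (aop_scale (-1) a').
have dae y : nr (da y) <= e * nr y by rewrite /= scaleN1r.
have c0 : 0 <= N%:R * nr (vl u) ^+ 2 by rewrite mulr_ge0 ?ler0n // exprn_ge0 // nr_ge0.
have h2 := qbounded_adj T_rep r c0 e0 dae (davg N (fixed_range u)).
have Pd l : range_proj r l (vl (b' u) - vl (b u)) = vl (b' u) - vl (b u).
  exact: (fixed_range (b' u - b u)).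
have nd : nr (vl (b' u) - vl (b u)) = nr (b' u - b u) by [].
have h3 := davg N Pd.
have h := qboundedD (qboundedD h1 h2) h3.
apply: (qbounded_le T_rep r (c := _)); first apply: qbounded_ext h => y k /=.
  rewrite avgB.
  have -> : aop_adj a y + (-1)^* *: aop_adj a' y = (-1)^* *: aop_adj a' y + aop_adj a y by rewrite addrC.
  by rewrite avg_antilinear; ring.
rewrite nd -!sub_nrE -/z.
have h4 : nr (b' u - b u) ^+ 2 <= (40 * e * z) ^+ 2.
  by rewrite lerXn2r // ?nnegrE ?nr_ge0 ?mulr_ge0 ?ler0n ?nr_ge0 ?(ltW e0) // nrB.
have h5 : N%:R * nr (b' u - b u) ^+ 2 <= N%:R * (1600 * e ^+ 2 * z ^+ 2).
  by rewrite ler_wpM2l ?ler0n // (le_trans h4) // !exprMn -natrX.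
have h6 : N%:R * (8000 * e ^+ 2 * z ^+ 2) <= N%:R * d by rewrite ler_wpM2l ?ler0n.
have h7 : 0 <= N%:R * d by rewrite mulr_ge0 ?ler0n // ltW.
lra.
Qed.

(** Both windows lie in the one from M to M + m + K, and each misses a piece of length m. The error
    does not grow with K, which is the Folner property behind the averages. *)
Lemma window_shift (G : nat -> R[i]) M m K :
  \sum_(M + m <= l < M + m + K) G l - \sum_(M <= l < M + K) G l =
  \sum_(M + K <= l < M + K + m) G l - \sum_(M <= l < M + m) G l.
Proof.
have e1 : \sum_(M <= l < M + m + K) G l = \sum_(M <= l < M + m) G l + \sum_(M + m <= l < M + m + K) G l.
  by rewrite (big_cat_nat (n := (M + m)%N)) ?leq_addr.
have e2 : \sum_(M <= l < M + m + K) G l = \sum_(M <= l < M + K) G l + \sum_(M + K <= l < M + K + m) G l.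
  by rewrite addnAC (big_cat_nat (n := (M + K)%N)) ?leq_addr.
by apply/eqP; rewrite subr_eq addrAC eq_sym subr_eq addrC -e2 e1 addrC.
Qed.

(** 4 = 2 + 2 comes from [qboundedD], applied to the two edges of a shifted window. *)
Lemma edges_small m (v : U) (e : R) : 0 < e -> exists N0, forall N, (N0 <= N)%N ->
  4 * (m%:R * nr v ^+ 2) <= e * N%:R.
Proof.
move=> e0; exists (Num.truncn (4 * (m%:R * nr v ^+ 2) / e)).+1 => N hN.
rewrite [leRHS]mulrC -ler_pdivrMr //; apply: ltW; apply: lt_le_trans (truncnS_gt _) _.
by rewrite ler_nat.
Qed.

(** In each degree <S_m(z) y (x) k, J_{m+l} u> = <y (x) k, J_l T_m(z)^* u> exactly, so only the two
    edges left by re-indexing have to be estimated. *)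
Lemma asymp_rel_shift_adj m (z : X m) b : (forall u, vl (b u) = bop_adj (T z) (vl u)) ->
  asymp_rel (aop_star (S z)) b.
Proof.
move=> hb u e e0; have [N0 hN] := edges_small m (b u) e0.
(* N >= m allows the re-indexed window to start at M = N - m. *)
exists (maxn N0 m) => N; rewrite geq_max => /andP[/hN {}hN mN].
have [M NE] : exists M, N = (M + m)%N by exists (N - m)%N; rewrite subnK.
have h := qboundedD (dwin M m (fixed_range (b u)))
  (qboundedN (dwin (M + N) m (fixed_range (b u)))).
apply: (qbounded_le T_rep r (c := _)); first apply: qbounded_ext h => y k /=.
  pose Gs l := inner (T (cp l (S z y)) k) (vl u).
  pose G l := inner (T (cp l y) k) (vl (b u)).
  have GsE l : Gs (l + m)%N = G l.
    by rewrite addnC /Gs fock_comp_shift_eq (ccr_mul T_rep) /G hb -bop_adjP.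
  rewrite -[avg T N (vl u) _ _]/(\sum_(N <= l < N + N) Gs l) -[avg T N (vl (b u)) _ _]/(\sum_(N <= l < N + N) G l).
  have -> : \sum_(N <= l < N + N) Gs l = \sum_(M <= l < M + N) G l.
    rewrite {1 2}NE big_addn addnAC addnK; by apply: eq_bigr => l _; exact: GsE.
  have := window_shift G M m N; rewrite -NE => ws.
  by rewrite -[RHS]opprB ws opprB.
rewrite -!sub_nrE; lra.
Qed.

(** On degree l this is S_m(z) (x) Q, the operator whose norms occur in the limit hypothesis; on J_l
    u with u in U the factor Q acts trivially. *)
Variable V : forall m (z : X m) l, bop (tl_space r l) (tl_space r (m + l)%N).
Hypothesis VP : forall m (z : X m) l (x : X l) h, V z l (t l x h) = t (m + l)%N (sp_mul z x) (Q h).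
Hypothesis V_lim : forall m (z : X m) u (e : R), 0 < e -> exists N0, forall l, (N0 <= l)%N ->
  nr (V z l (J l (vl u)) - J (m + l)%N (T z (vl u))) ^+ 2 <= e.
Hypothesis Q_sa : forall h k, inner (Q h) k = inner h (Q k).
Hypothesis Q_sigma : forall (c : A) h, Q (sigma c h) = sigma c (Q h).
Hypothesis Q_T : forall n (z : X n) h, Q (T z h) = T z (Q h).

Lemma creation_adj m (z : X m) l (y : F) h k :
  inner (t l (cp l (aop_adj (S z) y)) (Q h)) k = inner (t (m + l)%N (cp (m + l)%N y) h) (V z l k).
Proof.
rewrite -bop_adjPl; congr inner.
apply: (total_innerP (tl_total r l)) => _ [x [h' ->]].
rewrite -bop_adjP VP !tl_inner -/sigma.
rewrite Q_sa Q_sigma -!fock_compP -aop_adjP xshiftE.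
by [].
Qed.

(** In degree m + l the defect is the vector [k l]. As degrees are orthogonal, the window
    contributes at most N e / 4, and re-indexing by m adds two edges. *)
Lemma asymp_rel_shift m (z : X m) b : (forall u, vl (b u) = T z (vl u)) -> asymp_rel (S z) b.
Proof.
move=> hb u e e0; have [|N0 hN] := @edges_small m (b u) (e / 4).
  by rewrite divr_gt0 ?ltr0n.
have [|M0 hM] := @V_lim m z u (e / 4); first by rewrite divr_gt0 ?ltr0n.
exists (maxn N0 M0) => N; rewrite geq_max => /andP[/hN {}hN MN].
pose k l := V z l (J l (vl u)) - J (m + l)%N (T z (vl u)).
have h1 := @qbounded_blocks _ _ _ _ _ T_rep r F m N N k.
have h2 := qboundedD (dwin (N + N) m (fixed_range (b u))) (qboundedN (dwin N m (fixed_range (b u)))).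
have h := qboundedD h1 h2.
apply: (qbounded_le T_rep r (c := _)); first apply: qbounded_ext h => y h /=.
  pose G l := inner (T (cp l y) h) (vl (b u)).
  have e1 : avg T N (vl u) (aop_adj (S z) y) h =
      \sum_(N <= l < N + N) (inner (t (m + l)%N (cp (m + l)%N y) h) (k l) + G (l + m)%N).
    apply: eq_bigr => l _; rewrite [(l + m)%N]addnC.
    (* Writing u as Q u supplies the factor Q contained in V. *)
    have Qu : Q (vl u) = vl u := subP u.
    rewrite -[in LHS]Qu -Q_sa Q_T -(tl_opE r) bop_adjP creation_adj /k innerBr /G hb.
    by rewrite -(tl_opE r (cp (m + l)%N y) h) bop_adjP subrK.
  rewrite e1 big_split /= -addrA; congr (_ + _).
  rewrite -(window_shift G N m N); congr (_ - _).
  rewrite [RHS](_ : _ = \sum_(N <= l < N + N) G (l + m)%N) //.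
  by rewrite big_addn addnAC addnK.
have h3 : \sum_(N <= l < N + N) nr (k l) ^+ 2 <= e / 4 * N%:R.
  apply: (@le_trans _ _ (\sum_(N <= l < N + N) (e / 4))).
    by apply: ler_sum_nat => l /andP[Nl _]; apply: hM; exact: leq_trans Nl.
  by rewrite sumr_const_nat addKn mulr_natr.
rewrite -!sub_nrE; have := ler0n R N; lra.
Qed.

End Transfer.

(** * Limits of operators, isometries and amplifications *)

Section HilbertExtras.
Variable R : realType.

Lemma tendsD (V : normedModType R[i]) (u v : nat -> V) l l' (c : R[i]) :
  tends u l -> tends v l' -> tends (fun n => c *: u n + v n) (c *: l + l').
Proof.
move=> ul vl e e0; have c1 : 0 < nr c + 1 by rewrite ltr_wpDl ?nr_ge0.
have [|N hN] := ul (e / (2 * (nr c + 1))); first by rewrite divr_gt0 ?mulr_gt0 ?ltr0n.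
have [|M hM] := vl (e / 2); first by rewrite divr_gt0 ?ltr0n.
exists (maxn N M) => n; rewrite geq_max => /andP[/hN h1 /hM h2].
rewrite opprD addrACA -scalerBr; apply: le_lt_trans (nrD _ _) _; rewrite nrZ.
have : nr c * nr (u n - l) <= (nr c + 1) * (e / (2 * (nr c + 1))).
  by apply: ler_pM; rewrite ?nr_ge0 ?lerDl // ltW.
have -> : (nr c + 1) * (e / (2 * (nr c + 1))) = e / 2 by field; rewrite gt_eqF.
lra.
Qed.

(** [adj_le] carries the Cauchy estimate over to the adjoints, and the two pointwise limits are
    adjoint to each other. *)
Lemma bop_limit (H K : hilbertType R) (b : nat -> bop H K) (C : R) : 0 < C ->
  (forall n m u, nr (b n u - b m u) <= C * (n.+1%:R^-1 + m.+1%:R^-1) * nr u) ->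
  exists b' : bop H K, forall n,
    (forall u, nr (b' u - b n u) <= C * n.+1%:R^-1 * nr u) /\
    (forall v, nr (bop_adj b' v - bop_adj (b n) v) <= C * n.+1%:R^-1 * nr v).
Proof.
move=> C0 hb.
have badj n m v : nr (bop_adj (b n) v - bop_adj (b m) v) <= C * (n.+1%:R^-1 + m.+1%:R^-1) * nr v.
  apply: (adj_le (f := fun x => b n x - b m x) (g := fun y => bop_adj (b n) y - bop_adj (b m) y)).
  - by rewrite mulr_ge0 ?addr_ge0 ?invr_ge0 ?ler0n // ltW.
  - by move=> x y; rewrite innerBl innerBr !bop_adjP.
  - exact: hb.
have lim (V W : hilbertType R) (f : nat -> V -> W) :
    (forall n m u, nr (f n u - f m u) <= C * (n.+1%:R^-1 + m.+1%:R^-1) * nr u) ->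
    forall u, exists l, tends (f ^~ u) l /\ forall n, nr (l - f n u) <= C * n.+1%:R^-1 * nr u.
  move=> hf u; have u1 : 0 < nr u + 1 by rewrite ltr_wpDl ?nr_ge0.
  have [|l ul] := @cvgR_complete R W (f ^~ u).
    move=> e e0; have [|N hN] := small_inv (d := e / (2 * C * (nr u + 1))).
      by rewrite divr_gt0 ?mulr_gt0 ?ltr0n.
    exists N => m n /hN h1 /hN h2; apply: le_lt_trans (hf m n u) _.
    apply: (@le_lt_trans _ _ (C * (m.+1%:R^-1 + n.+1%:R^-1) * (nr u + 1))).
      by rewrite ler_wpM2l ?lerDl // mulr_ge0 ?addr_ge0 ?invr_ge0 ?ler0n // ltW.
    have -> : e = C * (e / (2 * C * (nr u + 1)) + e / (2 * C * (nr u + 1))) * (nr u + 1).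
      by field; rewrite !gt_eqF.
    by rewrite ltr_pM2r // ltr_pM2l // ltrD.
  exists l; split => // n; apply/ler_addgt0Pr => e e0; have [M hM] := ul (e / 2) ltac:(by rewrite divr_gt0).
  have [|N hN] := small_inv (d := e / (2 * C * (nr u + 1))).
    by rewrite divr_gt0 ?mulr_gt0 ?ltr0n.
  set m := maxn M N; have h1 := hM m (leq_maxl _ _); have h2 := hN m (leq_maxr _ _).
  have h3 := nr_tri (f m u) l (f n u); have h4 := hf m n u.
  have h5 : C * m.+1%:R^-1 * nr u <= C * (e / (2 * C * (nr u + 1))) * (nr u + 1).
    apply: ler_pM; rewrite ?nr_ge0 ?lerDl // ?mulr_ge0 ?invr_ge0 ?ler0n ?(ltW C0) //.
    by rewrite ler_wpM2l ?(ltW C0) ?(ltW h2).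
  have h6 : C * (e / (2 * C * (nr u + 1))) * (nr u + 1) = e / 2.
    by field; rewrite !gt_eqF.
  rewrite h6 in h5; apply: le_trans h3 _; rewrite addrC [e](splitr e) addrA.
  apply: lerD (ltW h1); apply: le_trans h4 _.
  have -> : C * (m.+1%:R^-1 + n.+1%:R^-1) * nr u = C * n.+1%:R^-1 * nr u + C * m.+1%:R^-1 * nr u by ring.
  exact: lerD (lexx _) h5.
have [f hf] := choice (lim _ _ _ hb).
have [g hg] := choice (lim _ _ _ badj).
have bf : blin f.
  split.
    move=> c x y; apply: (tends_unique (proj1 (hf _))).
    have := tendsD c (proj1 (hf x)) (proj1 (hf y)).
    move=> h e /h[N hN]; exists N => n /hN.
    by have [lin _] := bop_blin (b n); rewrite lin.
  have [D D0 bD] := blin_pos (bop_blin (b 0%N)); exists (D + C) => x.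
  have h1 := proj2 (hf x) 0%N; rewrite /= invr1 mulr1 in h1.
  by have := nr_le_add (f x) (b 0%N x); have := bD x; lra.
have fg x y : inner (f x) y = inner x (g y).
  apply: (tends_unique _ (tends_inner x (proj1 (hg y)))).
  apply: (tends_le (C := 1) _ (tends_inner y (proj1 (hf x)))) => n.
  rewrite mul1r -bop_adjP (innerC y (b n x)) (innerC y (f x)) -rmorphB /= nr_conj.
  by [].
exists (mk_bop bf fg) => n; split; first by move=> u; exact: (proj2 (hf u)).
by move=> v; exact: (proj2 (hg v)).
Qed.

Lemma clsub_functional (V : normedModType R[i]) (f : V -> R[i]) (C : R) :
  scalar f -> (forall x, nr (f x) <= C * nr x) -> clsub [set x | f x = 0].
Proof. exact: (@clsub_ker R V R[i]^o f C). Qed.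

(** Equal Gram matrices give equal norms of all finite combinations, so [extend_total] applies with
    C = 1; preservation of inner products is then extended in one variable at a time. *)
Lemma gram_isometry (I : Type) (K L : hilbertType R) (e : I -> K) (f : I -> L) (S : set K) :
  closed_span S = setT -> (forall x, S x -> exists i, x = e i) ->
  (forall i j, inner (e i) (e j) = inner (f i) (f j)) ->
  exists2 V : K -> L, blin V & (forall i, V (e i) = f i) /\
    (forall x y, inner (V x) (V y) = inner x y).
Proof.
move=> ST Se ef.
have [|V [Ve V1]] := @extend_total R K L I e f 1 S ST Se.
  move=> s; rewrite mul1r -(ler_pXn2r (n := 2)) ?nnegrE ?nr_ge0 // !nr_inner !inner_suml.
  rewrite le_eqVlt; apply/orP; left; apply/eqP; congr complex.Re.
  apply: eq_bigr => p _; rewrite !inner_sumr; apply: eq_bigr => p' _.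
  by rewrite !innerZl !innerZr ef.
have bV : blin V by split; [exact: linearP|exists 1].
exists V => //; split => // x y; apply/eqP; rewrite -subr_eq0; apply/eqP.
have func z : clsub [set y | inner (V z) (V y) - inner z y = 0].
  apply: (@clsub_functional _ _ (nr z + nr z)) => [c u v|u].
    rewrite (blinD bV) (blinZ _ _ bV) !innerDr !innerZr; ring.
  apply: le_trans (nrD _ _) _; rewrite nrN mulrDl lerD // ?cauchy_schwarz //.
  apply: le_trans (cauchy_schwarz _ _) _; apply: ler_pM; rewrite ?nr_ge0 //.
    by have := V1 z; rewrite mul1r.
  by have := V1 u; rewrite mul1r.
apply: (total_sub ST (func x)) => _ /Se[i ->] /=.
suff h0 : inner (V (e i)) (V x) - inner (e i) x = 0.
  by rewrite (innerC (V (e i))) (innerC (e i)) -rmorphB /= h0 conjC0.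
apply: (total_sub ST (func (e i))) => _ /Se[j ->] /=.
by rewrite !Ve ef subrr.
Qed.

Lemma isometry_range_closed (K L : hilbertType R) (V : K -> L) :
  blin V -> (forall x y, inner (V x) (V y) = inner x y) -> clsub (range V).
Proof.
move=> bV iso; have nV x : nr (V x) = nr x.
  by apply/eqP; rewrite -(eqrXn2 (n := 2)) ?nr_ge0 // !nr_inner iso.
split; first by exists 0 => //; rewrite blin0.
  move=> c _ _ [x _ <-] [y _ <-]; exists (c *: x + y) => //.
  by rewrite blinD // blinZ.
move=> v /closureR cv.
have /choice[x hx] : forall n : nat, exists x, nr (v - V x) < n.+1%:R^-1.
  move=> n; have [|_ [x _ <-] vx] := cv n.+1%:R^-1; first by rewrite invr_gt0.
  by exists x.
have [|l xl] := @cvgR_complete R K x.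
  move=> e e0; have [|N hN] := small_inv (d := e / 2); first by rewrite divr_gt0.
  exists N => m n /hN h1 /hN h2; rewrite -nV blinB //.
  apply: le_lt_trans (nr_tri v _ _) _; have := lt_trans (hx m) h1; have := lt_trans (hx n) h2; lra.
exists l => //; apply: (tends_unique (blin_tends bV xl)) => e e0.
have [N hN] := small_inv e0; exists N => n /hN h; rewrite nrB.
exact: lt_trans (hx n) h.
Qed.

End HilbertExtras.

(** By [amplification_bound], y (x) h |-> a y (x) h is bounded on finite sums, with 2 C as square
    root of 4 C^2, and so extends; the extension for [aop_star a] is the adjoint. *)
Lemma amplification (R : realType) (A : cstarType R) (F : hmodType A) (H K : hilbertType R)
    (sigma : A -> bop H H) (D : set H) (t : F -> H -> K) :
  representation sigma -> clsub D -> is_hilbert_tensor sigma D t ->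
  (forall xi : seq (F * H), 0 <= qnorm sigma xi) ->
  forall a : aop F F, exists c : bop K K,
    (forall y h, D h -> c (t y h) = t (a y) h) /\
    (forall y h, D h -> bop_adj c (t y h) = t (aop_adj a y) h).
Proof.
move=> rep clD tP qpos.
have [tin total] := tP.
have ext (a : aop F F) : exists g : {linear K -> K}, (forall y h, D h -> g (t y h) = t (a y) h) /\
    exists C : R, forall x, nr (g x) <= C * nr x.
  have [C C0 aC] := aop_bounded a.
  pose I := (F * {h | D h})%type.
  have [||g [gE gC]] := @extend_total R K K I (fun i => t i.1 (sval i.2)) (fun i => t (a i.1) (sval i.2)) (2 * C) _ total.
  - by move=> _ [x [h [Dh ->]]]; exists (x, exist _ h Dh).
  (* Absorbing the coefficients into the H component turns the combination into a list as in
     [qform]. *)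
  - move=> s; pose xi := [seq (p.2.1, p.1 *: sval p.2.2) | p <- s].
    have nE (b : F -> F) : nr (\sum_(p <- s) p.1 *: t (b p.2.1) (sval p.2.2)) ^+ 2 =
        qnorm sigma [seq (b p.1, p.2) | p <- xi].
      rewrite nr_inner /qnorm qform_map /qform !big_map inner_suml; congr complex.Re.
      apply: eq_bigr => p _; rewrite !big_map inner_sumr; apply: eq_bigr => p' _ /=.
      have Dp := svalP p.2.2; have Dp' := svalP p'.2.2.
      by rewrite !innerZl !innerZr tin // (blinZ _ _ (bop_blin _)) innerZr mulrCA.
    have C2 : 0 <= 2 * C by rewrite mulr_ge0 ?ler0n // ltW.
    have hh : 0 <= 2 * C * nr (\sum_(p <- s) p.1 *: t p.2.1 (sval p.2.2)) by rewrite mulr_ge0 ?nr_ge0.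
    rewrite -(ler_pXn2r (n := 2)) ?nnegrE ?nr_ge0 // exprMn (nE id) (nE a) exprMn -natrX.
    rewrite (_ : [seq (id p.1, p.2) | p <- xi] = xi); first exact: amplification_bound.
    by rewrite -[RHS]map_id; apply: eq_map => -[].
  exists g; split; last by exists (2 * C).
  by move=> y h Dh; exact: (gE (y, exist _ h Dh)).
move=> a; have [g [gE [C gC]]] := ext a; have [g' [gE' [C' gC']]] := ext (aop_star a).
have bg : blin g by split; [exact: linearP|exists C].
have bg' : blin g' by split; [exact: linearP|exists C'].
have gadj x y : inner (g x) y = inner x (g' y).
  have h1 z : (forall w, (exists x h, D h /\ w = t x h) -> inner (g w) z = inner w (g' z)) -> inner (g x) z = inner x (g' z).
    move=> hz; apply/eqP; rewrite -subr_eq0; apply/eqP; apply/eqP; rewrite -conjC_eq0; apply/eqP.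
    have cl : clsub [set x | (inner (g x) z - inner x (g' z))^* = 0].
      apply: (@clsub_functional _ _ _ (C * nr z + nr (g' z))) => [c u v|u].
        rewrite (blinD bg) (blinZ _ _ bg) !innerDl !innerZl !(rmorphB, rmorphD, rmorphM) /= conjCK; ring.
      rewrite nr_conj; apply: le_trans (nrD _ _) _; rewrite nrN mulrDl lerD //.
        apply: le_trans (cauchy_schwarz _ _) _; rewrite mulrAC ler_wpM2r ?nr_ge0 //.
      by rewrite mulrC; exact: cauchy_schwarz.
    by apply: (total_sub total cl) => w hw /=; rewrite hz // subrr conjC0.
  apply: h1 => _ [u [h [Dh ->]]].
  apply/eqP; rewrite -subr_eq0; apply/eqP.
  have cl : clsub [set y | inner (g (t u h)) y - inner (t u h) (g' y) = 0].
    apply: (@clsub_functional _ _ _ (nr (g (t u h)) + nr (t u h) * C')) => [c w v|w].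
      rewrite (blinD bg') (blinZ _ _ bg') !innerDr !innerZr; ring.
    apply: le_trans (nrD _ _) _; rewrite nrN mulrDl lerD //; first exact: cauchy_schwarz.
    apply: le_trans (cauchy_schwarz _ _) _; rewrite -mulrA ler_wpM2l ?nr_ge0 //.
  apply: (total_sub total cl) => _ [u' [h' [Dh' ->]]] /=.
  by rewrite gE // gE' // !tin // aop_adjP subrr.
exists (mk_bop bg gadj); split; [exact: gE|exact: gE'].
Qed.

(** * The fully coisometric part *)

Lemma sub_val_blin (R : realType) (K : hilbertType R) (P : set K) (hP : clsub P) :
  blin (sub_val : sub_space hP -> K).
Proof. by split; [move=> c x y|exists 1 => x; rewrite mul1r]. Qed.

Section Restriction.
Variables (R : realType) (H : hilbertType R) (Q : bop H H).
Hypothesis Q_sa : forall h k, inner (Q h) k = inner h (Q k).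
Hypothesis Q_idem : forall h, Q (Q h) = Q h.
Hypothesis hU : clsub [set u | Q u = u].

Let U := sub_space hU.
Local Notation vl := (@sub_val R H [set u | Q u = u] hU).

Lemma fixedE (u : U) : Q (vl u) = vl u.
Proof. exact: (subP u). Qed.

Definition to_fixed (h : H) : U := @to_sub _ _ _ hU (Q h) (Q_idem h).

Lemma to_fixed_blin : blin to_fixed.
Proof.
split; first by move=> c x y; apply: sub_val_inj; have [lin _] := bop_blin Q; exact: lin.
by have [_ [C QC]] := bop_blin Q; exists C.
Qed.

Lemma to_fixedK (u : U) : to_fixed (vl u) = u.
Proof. by apply: sub_val_inj; exact: fixedE. Qed.

Lemma to_fixed_adj h (u : U) : inner (to_fixed h) u = inner h (vl u).
Proof. by rewrite sub_innerE Q_sa fixedE. Qed.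

Variable B : bop H H.

(** Q B on the range of Q, which is the restriction of B once Q commutes with B. *)
Definition compression_fun (u : U) : U := to_fixed (B (vl u)).

Fact compression_blin : blin compression_fun.
Proof. exact: (blin_comp (sub_val_blin hU) (blin_comp (bop_blin B) to_fixed_blin)). Qed.

Fact compression_adj (u v : U) :
  inner (compression_fun u) v = inner u (to_fixed (bop_adj B (vl v))).
Proof.
rewrite to_fixed_adj bop_adjP (innerC (to_fixed _) u) to_fixed_adj inner_conj.
by [].
Qed.

Definition compression : bop U U := mk_bop compression_blin compression_adj.

Hypothesis BQ : forall h, Q (B h) = B (Q h).

Lemma compressionE u : vl (compression u) = B (vl u).
Proof. by rewrite -[LHS]/(Q (B (vl u))) BQ fixedE. Qed.

Lemma compression_adjE u : vl (bop_adj compression u) = bop_adj B (vl u).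
Proof.
rewrite -[LHS]/(Q (bop_adj B (vl u))); apply: innerPl => z.
by rewrite -Q_sa -bop_adjP -BQ Q_sa fixedE bop_adjP.
Qed.

End Restriction.

Lemma sub_total_span (R : realType) (K : hilbertType R) (S : set K) (hS : clsub (closed_span S))
    (S' : set (sub_space hS)) :
  (forall s, S s -> exists2 w, S' w & sub_val w = s) -> closed_span S' = setT.
Proof.
move=> hSS; apply/seteqP; split => // v _; apply/closureR => e e0.
have := subP v => /closureR /(_ e e0)[y Sy vy].
have [y' Sy' yE] : exists2 y' : sub_space hS, lin_span S' y' & sub_val y' = y.
  move: Sy; move: (y); apply: lin_span_sub.
  - by exists 0; [exact: lin_span0|].
  - move=> c _ _ [a Sa <-] [b Sb <-]; exists (c *: a + b) => //; exact: lin_spanD.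
  - by move=> s /hSS[w Sw ws]; exists w => //; exact: lin_span_in.
by exists y' => //; rewrite sub_nrE -yE in vy *.
Qed.

(** * The representation of the Toeplitz algebra on U *)

Section ToeplitzRepresentation.
Variables (R : realType) (A : cstarType R) (X : subproduct_system A) (H : hilbertType R).
Variable (T : forall n, X n -> bop H H).
Hypothesis T_rep : is_cc_covariant_rep T.
Variable r : tilde_ops T.
Variable F : fock_module X.
Variable Q : bop H H.
Hypothesis hU : clsub [set u | Q u = u].
Hypothesis fixP : forall u, Q u = u -> forall l, range_proj r l u = u.

Let U := sub_space hU.
Local Notation relT := (@asymp_rel R A X H T F Q hU).

Definition rel_set : set (aop F F) :=
  [set a | exists b : bop U U, relT a b /\ relT (aop_star a) (bop_adj b)].

Lemma asymp_rel_ext (a a' : aop F F) (b b' : U -> U) :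
  (forall y, aop_adj a y = aop_adj a' y) -> (forall u, b u = b' u) -> relT a b -> relT a' b'.
Proof.
move=> aa bb ab u e e0; have [N0 hN] := ab u e e0; exists N0 => N /hN.
by apply: qbounded_ext => y h; rewrite aa bb.
Qed.

Lemma bop_lin_comb (c : R[i]) (b b' : bop U U) :
  exists d : bop U U, (forall u, d u = c *: b u + b' u) /\
    (forall u, bop_adj d u = c^* *: bop_adj b u + bop_adj b' u).
Proof.
have bd := blin_add (blin_scale c (bop_blin b)) (bop_blin b').
have ad x y : inner (c *: b x + b' x) y = inner x (c^* *: bop_adj b y + bop_adj b' y).
  by rewrite innerDl innerZl innerDr innerZr !bop_adjP.
by exists (mk_bop bd ad).
Qed.

Lemma rel_set_lin c a a' : rel_set a -> rel_set a' -> rel_set (aop_add (aop_scale c a) a').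
Proof.
move=> [b [ab ab']] [b' [a'b a'b']]; have [d [dE dE']] := bop_lin_comb c b b'; exists d; split.
  by apply: asymp_rel_ext (asymp_rel_linear T_rep r c ab a'b) => [y|u] //; rewrite dE.
apply: asymp_rel_ext (asymp_rel_linear T_rep r c^* ab' a'b') => [y|u]; last by rewrite dE'.
by rewrite /= conjCK.
Qed.

(** The point is closure under norm limits: [asymp_rel_bound] makes the operators attached to
    approximants of a Cauchy, and [asymp_rel_limit] passes to their limit, for a and for its
    adjoint. *)
Lemma rel_set_subalgebra : cstar_subalgebra rel_set.
Proof.
have ext (a a' : aop F F) : (forall y, a y = a' y) -> (forall y, aop_adj a y = aop_adj a' y) ->
    rel_set a -> rel_set a'.
  move=> e1 e2 [b [ab ab']]; exists b; split; exact: asymp_rel_ext ab || exact: asymp_rel_ext ab'.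
split.
- move=> a b Ba Bb; apply: ext (rel_set_lin 1 Ba Bb) => y /=; first by rewrite scale1r.
  by rewrite conjC1 scale1r.
(* c a is written as (c - 1) a + a to fit [rel_set_lin]. *)
- move=> c a Ba; apply: ext (rel_set_lin (c - 1) Ba Ba) => y /=.
    by rewrite scalerBl scale1r subrK.
  by rewrite rmorphB /= conjC1 scalerBl scale1r subrK.
- move=> a b [a1 [ha ha']] [b1 [hb hb']].
  have bd := blin_comp (bop_blin b1) (bop_blin a1).
  have ad x y : inner (a1 (b1 x)) y = inner x (bop_adj b1 (bop_adj a1 y)) by rewrite !bop_adjP.
  exists (mk_bop bd ad); split; first exact: (asymp_rel_mul T_rep r ha hb).
  exact: (asymp_rel_mul T_rep r hb' ha').
- move=> a [b [ab ab']].
  exists (mk_bop (bop_adj_blin b) (fun x y => bop_adjPl b y x)); split => //.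
- move=> a happ.
  have /choice[a_ ha] : forall n : nat, exists a', rel_set a' /\ forall y, nr (a y - a' y) <= n.+1%:R^-1 * nr y.
    move=> n; have [|a' Ba' aa'] := happ (n.+1%:R^-1 : R)%:C%C.
      by rewrite ltcR invr_gt0.
    by exists a'; split => // y; rewrite -lecR rmorphM /= -!nrE; exact: aa'.
  have /choice[b_ hb] := fun n => proj1 (ha n).
  have diff n m u : nr (b_ n u - b_ m u) <= 40 * (n.+1%:R^-1 + m.+1%:R^-1) * nr u.
    have h := asymp_rel_linear T_rep r (-1) (proj1 (hb m)) (proj1 (hb n)).
    have p : 0 < n.+1%:R^-1 + m.+1%:R^-1 :> R by rewrite addr_gt0 ?invr_gt0.
    have bnd y : nr (aop_add (aop_scale (-1) (a_ m)) (a_ n) y) <= (n.+1%:R^-1 + m.+1%:R^-1) * nr y.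
      rewrite /= scaleN1r addrC mulrDl; apply: le_trans (nr_tri (a y) _ _) _.
      exact: lerD (proj2 (ha n) y) (proj2 (ha m) y).
    by have := asymp_rel_bound T_rep fixP p bnd h u; rewrite scaleN1r addrC.
  have [b hb'] := bop_limit (ltac:(by rewrite ltr0n) : 0 < 40 :> R) diff.
  exists b; split.
    apply: (asymp_rel_limit T_rep fixP) => e /small_inv[N /(_ N (leqnn N)) hN].
    exists (a_ N), (b_ N); split; first exact: (proj1 (hb N)).
      move=> y; apply: le_trans (proj2 (ha N) y) _; rewrite ler_wpM2r ?nr_ge0 //; exact: ltW.
    move=> u; apply: le_trans (proj1 (hb' N) u) _; rewrite ler_wpM2r ?nr_ge0 // ler_wpM2l ?ler0n //; exact: ltW.
  apply: (asymp_rel_limit T_rep fixP) => e e0.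
  (* e / 4, because [aop_adj_le] loses a factor 4 in passing to adjoints. *)
  have [|N /(_ N (leqnn N)) hN] := small_inv (d := e / 4); first by rewrite divr_gt0 ?ltr0n.
  exists (aop_star (a_ N)), (bop_adj (b_ N)); split; first exact: (proj2 (hb N)).
    pose da := aop_add a (aop_scale (-1) (a_ N)).
    have dE y : nr (da y) <= N.+1%:R^-1 * nr y by rewrite /= scaleN1r; exact: (proj2 (ha N) y).
    have n0 : 0 <= N.+1%:R^-1 :> R by rewrite invr_ge0.
    move=> y; have := aop_adj_le n0 dE y; rewrite /= rmorphN /= conjC1 scaleN1r => h.
    by apply: le_trans h _; rewrite ler_wpM2r ?nr_ge0 // mulrC -ler_pdivlMr ?ltr0n // ltW.
  move=> u; apply: le_trans (proj2 (hb' N) u) _; rewrite ler_wpM2r ?nr_ge0 // ler_wpM2l ?ler0n //.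
  by apply: ltW; apply: lt_le_trans hN _; rewrite ler_pdivrMr ?ltr0n // ler_peMr ?(ltW e0) // ler1n.
Qed.

Variable Z : forall n, X n -> bop U U.
Hypothesis Z_shift : forall n (x : X n), relT (xshift F x) (Z x).
Hypothesis Z_shift_adj : forall n (x : X n), relT (aop_star (xshift F x)) (bop_adj (Z x)).
Hypothesis Z_rep : representation (rep0 Z).

Lemma toeplitz_rel_set : @toeplitz _ _ _ F `<=` rel_set.
Proof.
move=> a; apply; first exact: rel_set_subalgebra.
by move=> _ [n [x ->]]; exists (Z x).
Qed.

Lemma toeplitz_shift n (x : X n) : @toeplitz _ _ _ F (xshift F x).
Proof. by move=> B _; apply; exists n, x. Qed.

Lemma toeplitz_subalgebra : cstar_subalgebra (@toeplitz _ _ _ F).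
Proof.
split.
- by move=> a b ha hb B cB gB; have [h _ _ _ _] := cB; apply: h; [exact: ha|exact: hb].
- by move=> c a ha B cB gB; have [_ h _ _ _] := cB; apply: h; exact: ha.
- by move=> a b ha hb B cB gB; have [_ _ h _ _] := cB; apply: h; [exact: ha|exact: hb].
- by move=> a ha B cB gB; have [_ _ _ h _] := cB; apply: h; exact: ha.
- move=> a ha B cB gB; have [_ _ _ _ h] := cB; apply: h => e /ha[b hb ab].
  by exists b => //; exact: hb.
Qed.

(** Each identity for pi compares two operators related to the same element of L(F_X), so it follows
    from [asymp_rel_unique]. *)
Lemma fixed_extends : extends_to_cstar_rep Z F.
Proof.
(* [b0] only serves as a value of pi outside [rel_set]. *)
have [a0 [b0 _]] : exists a, rel_set a by exists (xshift F (0 : X 0)); exact: toeplitz_rel_set (toeplitz_shift _).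
have /choice[pi hpi] : forall a, exists b : bop U U,
    rel_set a -> relT a b /\ relT (aop_star a) (bop_adj b).
  by move=> a; have [[b hb]|na] := pselect (rel_set a); [exists b|exists b0].
have {}hpi a : @toeplitz _ _ _ F a -> relT a (pi a) /\ relT (aop_star a) (bop_adj (pi a)).
  by move=> /toeplitz_rel_set; exact: hpi.
have [tD tZ tM tS _] := toeplitz_subalgebra.
have uniq := @asymp_rel_unique _ _ _ _ _ T_rep r F Q hU fixP.
have piS n (x : X n) h : pi (xshift F x) h = Z x h.
  by apply: uniq (proj1 (hpi _ (toeplitz_shift x))) (Z_shift x) h.
exists pi; split; last exact: piS.
split.
- move=> c a b h ta tb.
  apply: uniq (proj1 (hpi _ _)) (asymp_rel_linear T_rep r c (proj1 (hpi _ ta)) (proj1 (hpi _ tb))) h.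
  by apply: tD => //; exact: tZ.
- move=> a b h ta tb.
  apply: uniq (proj1 (hpi _ _)) (asymp_rel_mul T_rep r (proj1 (hpi _ ta)) (proj1 (hpi _ tb))) h.
  exact: tM.
- move=> a h ta.
  apply: uniq (proj1 (hpi _ _)) (proj2 (hpi _ ta)) h; exact: tS.
- have [_ _ _ total] := Z_rep; apply/seteqP; split => // v _; move: v.
  apply: (total_sub total (clsub_span _)).
  move=> _ [a [h ->]]; apply: closed_span_in; exists (xshift F (sp_vac X a)), h.
  by split; [exact: toeplitz_shift|rewrite piS].
Qed.

End ToeplitzRepresentation.

Section FixedPart.
Variables (R : realType) (A : cstarType R) (X : subproduct_system A) (H : hilbertType R).
Variable (T : forall n, X n -> bop H H).
Hypothesis T_rep : is_cc_covariant_rep T.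
Variable r : tilde_ops T.
Variable Q : bop H H.
Hypothesis Q_sa : forall h k, inner (Q h) k = inner h (Q k).
Hypothesis Q_idem : forall h, Q (Q h) = Q h.
Hypothesis hU : clsub [set u | Q u = u].
Hypothesis Q_T : forall n (x : X n) h, Q (T x h) = T x (Q h).

Let U := sub_space hU.
Local Notation vl := (@sub_val R H [set u | Q u = u] hU).
Let rep : representation (rep0 T) := ccr_rep0 T_rep.

Definition fixed_part n (x : X n) : bop U U := compression Q_sa Q_idem hU (T x).

Lemma fixed_partE n (x : X n) u : vl (fixed_part x u) = T x (vl u).
Proof. exact: compressionE. Qed.

Lemma fixed_part_adjE n (x : X n) u : vl (bop_adj (fixed_part x) u) = bop_adj (T x) (vl u).
Proof. exact: compression_adjE. Qed.

Lemma val_sum I (s : seq I) (f : I -> U) : vl (\sum_(i <- s) f i) = \sum_(i <- s) vl (f i).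
Proof. exact: (blin_sum _ _ _ (sub_val_blin hU)). Qed.

Lemma fixed_part_rep : is_cc_covariant_rep fixed_part.
Proof.
split.
- move=> n c x y u; apply: sub_val_inj.
  rewrite fixed_partE (ccr_linear T_rep) -!fixed_partE.
  by [].
- split.
  + move=> c a b u; apply: sub_val_inj; rewrite fixed_partE.
    have [l _ _ _] := rep; have := l c a b (vl u); rewrite /rep0 => ->.
    by rewrite -!fixed_partE.
  + move=> a b u; apply: sub_val_inj; rewrite !fixed_partE.
    by have [_ m _ _] := rep; exact: m.
  + move=> a u; apply: sub_val_inj; rewrite fixed_partE fixed_part_adjE.
    by have [_ _ s _] := rep; exact: s.
  + have [_ _ _ total] := rep; apply/seteqP; split => // u _.
    rewrite -(to_fixedK Q_idem u).
    have hP := blin_preim (to_fixed_blin Q_idem hU) (clsub_span [set v | exists a h, v = rep0 fixed_part a h]).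
    apply: (total_sub total hP) => _ [a [h ->]] /=; apply: closed_span_in.
    exists a, (to_fixed Q_idem hU h); apply: sub_val_inj.
    by rewrite fixed_partE -[LHS]/(Q (T (sp_vac X a) h)) Q_T.
- move=> n k z c c0 zc h.
  have hT := ccr_cc T_rep c0 zc (fun j => vl (h j)).
  rewrite [leLHS](eq_bigr (fun i => `|\sum_j T (z i j) (vl (h j))| ^+ 2)); first exact: hT.
  move=> i _; congr (_ ^+ 2).
  rewrite -[LHS]/(`|vl (\sum_j fixed_part (z i j) (h j))|) val_sum.
  by congr (`| _ |); apply: eq_bigr => j _; rewrite fixed_partE.
- by move=> n x a u; apply: sub_val_inj; rewrite !fixed_partE (ccr_ract T_rep).
- by move=> n a x u; apply: sub_val_inj; rewrite !fixed_partE (ccr_lact T_rep).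
- by move=> n m x y u; apply: sub_val_inj; rewrite !fixed_partE (ccr_mul T_rep).
Qed.

Local Notation t n := (tl_tens r n).
Local Notation J n := (bop_adj (tl_op r n)).
Hypothesis J_total : forall n u, Q u = u ->
  closed_span [set v | exists (x : X n) k, v = t n x (Q k)] (J n u).
Hypothesis fixP : forall u, Q u = u -> forall l, range_proj r l u = u.

Definition fixed_tensors n : set (tl_space r n) := [set v | exists (x : X n) k, v = t n x (Q k)].

(** X(n) (x) U is realized inside the given X(n) (x) H. *)
Definition fixed_space n : hilbertType R := sub_space (clsub_span (@fixed_tensors n)).

Fact fixed_tens_in n (x : X n) (u : U) : closed_span (@fixed_tensors n) (t n x (vl u)).
Proof. by apply: closed_span_in; exists x, (vl u); rewrite (fixedE u). Qed.

Definition fixed_tens n (x : X n) (u : U) : fixed_space n :=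
  to_sub (clsub_span (@fixed_tensors n)) (@fixed_tens_in n x u).

Lemma fixed_tensP n : is_hilbert_tensor (rep0 fixed_part) setT (@fixed_tens n).
Proof.
split.
  move=> x y u v _ _; rewrite [RHS]sub_innerE /rep0 fixed_partE.
  exact: tl_inner.
apply: sub_total_span => _ [x [k ->]].
by exists (fixed_tens x (to_fixed Q_idem hU k)) => //; exists x, (to_fixed Q_idem hU k).
Qed.

Definition fixed_op_fun n (v : fixed_space n) : U := to_fixed Q_idem hU (tl_op r n (sub_val v)).

Lemma fixed_op_val n (v : fixed_space n) : vl (fixed_op_fun v) = tl_op r n (sub_val v).
Proof.
have hP := blin_preim (bop_blin (tl_op r n)) hU.
apply: (closed_span_sub hP _ (subP v)) => _ [x [k ->]] /=.
by rewrite tl_opE Q_T Q_idem.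
Qed.

Fact fixed_op_blin n : blin (@fixed_op_fun n).
Proof.
exact: (blin_comp (sub_val_blin _) (blin_comp (bop_blin (tl_op r n)) (to_fixed_blin Q_idem hU))).
Qed.

(** By [J_total], T~_n^* u lies in the subspace that realizes X(n) (x) U. So the adjoint of Z~_n is
    a restriction of T~_n^*, and Z~_n is coisometric because P_n u = u. *)
Definition fixed_op_adj n (u : U) : fixed_space n :=
  to_sub (clsub_span (@fixed_tensors n)) (@J_total n _ (fixedE u)).

Fact fixed_op_adjP n (v : fixed_space n) (u : U) : inner (fixed_op_fun v) u = inner v (fixed_op_adj n u).
Proof. by rewrite !sub_innerE fixed_op_val bop_adjP. Qed.

Fact fixed_opE n (x : X n) (u : U) : mk_bop (@fixed_op_blin n) (@fixed_op_adjP n) (fixed_tens x u) = fixed_part x u.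
Proof.
apply: sub_val_inj; rewrite -[LHS]/(vl (fixed_op_fun (fixed_tens x u))) fixed_op_val fixed_partE.
exact: tl_opE.
Qed.

Lemma fixed_coisometric : fully_coisometric fixed_part.
Proof.
exists (TildeOps fixed_tensP fixed_opE) => n u; apply: sub_val_inj.
rewrite -[LHS]/(vl (fixed_op_fun (fixed_op_adj n u))) fixed_op_val.
exact: (fixP (fixedE u)).
Qed.

End FixedPart.

(** * From convergence of norms to convergence of vectors *)

Section AsymptoticIsometry.
Variables (R : realType) (A : cstarType R) (X : subproduct_system A) (H : hilbertType R).
Variable (T : forall n, X n -> bop H H).
Hypothesis T_rep : is_cc_covariant_rep T.
Variable r : tilde_ops T.
Variable Q : bop H H.
Hypothesis Q_T : forall n (x : X n) h, Q (T x h) = T x (Q h).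
Hypothesis Q_sa : forall h k, inner (Q h) k = inner h (Q k).
Hypothesis fixP : forall u, Q u = u -> forall l, range_proj r l u = u.
Local Notation t n := (tl_tens r n).
Local Notation J n := (bop_adj (tl_op r n)).
Variables (m : nat) (z : X m).
Variable V : forall l, bop (tl_space r l) (tl_space r (m + l)%N).
Hypothesis VP : forall l (x : X l) h, V l (t l x h) = t (m + l)%N (sp_mul z x) (Q h).

Lemma tl_op_creation l k : tl_op r (m + l)%N (V l k) = T z (Q (tl_op r l k)).
Proof.
have hP := blin_eq (blin_comp (bop_blin (V l)) (bop_blin (tl_op r (m + l)%N)))
  (blin_comp (bop_blin (tl_op r l)) (blin_comp (bop_blin Q) (bop_blin (T z)))).
apply: (total_sub (tl_total r l) hP) => _ [x [h ->]] /=.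
by rewrite VP !tl_opE (ccr_mul T_rep) Q_T.
Qed.

(** By [tl_op_creation], T~_{m+l} maps V J_l u to T_m(z) u, so the inner product of the two vectors
    is |T_m(z) u|^2, which is also the squared norm of the second. *)
Lemma creation_defect l u : Q u = u ->
  nr (V l (J l u) - J (m + l)%N (T z u)) ^+ 2 = nr (V l (J l u)) ^+ 2 - nr (T z u) ^+ 2.
Proof.
move=> Qu; have QT : Q (T z u) = T z u by rewrite Q_T Qu.
rewrite nr_subsq (pi_nr (fixP QT _)) -bop_adjP tl_op_creation.
have -> : tl_op r l (J l u) = u by exact: (fixP Qu l).
by rewrite Qu -nr_inner; ring.
Qed.

Lemma creation_lim_pos u (e : R) : Q u = u -> 0 < e ->
  (`|V l (J l u)| @[l --> \oo] --> `|T z u|) ->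
  exists N0, forall l, (N0 <= l)%N -> nr (V l (J l u) - J (m + l)%N (T z u)) ^+ 2 <= e.
Proof.
move=> Qu e0 /(@cvgR R R[i]^o) h.
set w := nr (T z u); have w0 : 0 <= w := nr_ge0 _.
have p : 0 < 2 * w + 1 by rewrite ltr_wpDl // mulr_ge0 ?ler0n.
(* v^2 - w^2 = (v - w) (v + w), and the 1 in the minimum ensures v + w <= 2 w + 1. *)
have d0 : 0 < Num.min 1 (e / (2 * w + 1)) by rewrite lt_min ltr01 divr_gt0.
have [N hN] := h _ d0; exists N => l /hN; rewrite creation_defect // -/w.
set v := nr (V l (J l u)).
have -> : nr (`|V l (J l u)| - `|T z u| : R[i]^o) = `|v - w|.
  by rewrite !nrE -rmorphB /=; exact: nr_real.
rewrite lt_min => /andP[h1 h2]; rewrite ltr_pdivlMr // in h2.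
have -> : v ^+ 2 - w ^+ 2 = (v - w) * (v + w) by ring.
apply: le_trans (ler_norm _) _; rewrite normrM; apply: le_trans (ltW h2).
rewrite ler_wpM2l // ger0_norm; last by rewrite addr_ge0 // nr_ge0.
move: h1; rewrite ltr_norml => /andP[_]; lra.
Qed.

End AsymptoticIsometry.

(** Degree m = 0 lies outside the limit hypothesis, but there z comes from some a in A and
    multiplication by z is the left action of a. Against x (x) h both sides give <a^* x (x) Q h, J_l
    u>. *)
Lemma creation_lim0 (R : realType) (A : cstarType R) (X : subproduct_system A) (H : hilbertType R)
    (T : forall n, X n -> bop H H) (T_rep : is_cc_covariant_rep T) (r : tilde_ops T) (Q : bop H H) 
    (Q_T : forall n (x : X n) h, Q (T n x h) = T n x (Q h))
    (Q_sa : forall h k, inner (Q h) k = inner h (Q k))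
    (Q_sigma : forall a h, Q (rep0 T a h) = rep0 T a (Q h))
    (z : X 0) l (V : bop (tl_space r l) (tl_space r (0 + l)%N))
    (VP : forall (x : X l) h, V (tl_tens r l x h) = tl_tens r (0 + l)%N (sp_mul z x) (Q h)) u :
  Q u = u -> V (bop_adj (tl_op r l) u) = bop_adj (tl_op r (0 + l)%N) (T 0%N z u).
Proof.
move=> Qu; have rep := ccr_rep0 T_rep; have [a zE] := sp_vac_surj z.
apply: (total_innerP (tl_total r l)) => _ [x [h ->]].
rewrite -[RHS]bop_adjP tl_opE.
have -> : inner (tl_tens r l x h) (V (bop_adj (tl_op r l) u)) =
    inner (tl_tens r l (lact (cstar a) x) (Q h)) (bop_adj (tl_op r l) u).
  rewrite -[LHS]bop_adjPl; congr inner.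
  apply: (total_innerP (tl_total r l)) => _ [y [k ->]].
  rewrite -bop_adjP VP zE sp_mul_vac !tl_inner Q_sa -Q_sigma.
  by rewrite lact_adj.
rewrite -bop_adjP tl_opE (ccr_lact T_rep) (rep_star rep) cstarK -Q_T Q_sa.
by rewrite Q_sigma Qu zE.
Qed.

(** * The decomposition *)

Section WanderingPart.
Variables (R : realType) (A : cstarType R) (X : subproduct_system A) (H : hilbertType R).
Variable (T : forall n, X n -> bop H H).
Hypothesis T_rep : is_cc_covariant_rep T.
Variable r : tilde_ops T.
Hypothesis pi_T : forall n, partial_isometry (tl_op r n).
Hypothesis relT : forall n (x : X n) d, range_proj r 1 d = 0 -> bop_adj (tl_op r n) (T x d) = tl_tens r n x d.
Variable Q : bop H H.
Hypothesis Q_lim : forall h, tends (fun n => range_proj r n h) (Q h).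
Variable (F : fock_module X) (D : set H) (FD : hilbertType R) (tD : F -> H -> FD).

Hypothesis DP : forall d, D d <-> range_proj r 1 d = 0.
Hypothesis tDP : is_hilbert_tensor (rep0 T) D tD.
Let rep : representation (rep0 T) := ccr_rep0 T_rep.

Definition fock_elementary : set FD :=
  [set v | exists n (x : X n) d, D d /\ v = tD (fock_in F x) d].

Lemma fock_elementary_total : closed_span fock_elementary = setT.
Proof.
have [_ total] := tDP; apply/seteqP; split => // v _; move: v.
apply: (total_sub total (clsub_span _)) => _ [y [d [Dd ->]]].
have hP := blin_preim (tens_blin rep tDP Dd) (clsub_span fock_elementary).
apply: (total_sub (fock_total F) hP) => _ [n [x ->]] /=.
by apply: closed_span_in; exists n, x, d.
Qed.

Lemma wandering_isometry : exists V : bop FD H,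
  [/\ forall n (x : X n) d, D d -> V (tD (fock_in F x) d) = T x d,
      forall f g, inner (V f) (V g) = inner f g,
      forall f, Q (V f) = 0 &
      forall h, V (bop_adj V h) = h - Q h].
Proof.
pose I := {n : nat & (X n * {d | D d})%type}.
have [|i j|V bV [Ve Viso]] := @gram_isometry R I FD H
    (fun i => tD (fock_in F (tagged i).1) (sval (tagged i).2))
    (fun i => T (tagged i).1 (sval (tagged i).2)) _ fock_elementary_total.
- move=> _ [n [x [d [Dd ->]]]].
  by exists (existT (fun n => (X n * {d | D d})%type) n (x, exist _ d Dd)).
- case: i => n [x [d Dd]]; case: j => m [y [d' Dd']] /=.
  rewrite (tens_inner tDP) //.
  have Pd : range_proj r 1 d = 0 by apply/DP.
  have Pd' : range_proj r 1 d' = 0 by apply/DP.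
  have [nm|mn|e] := ltngtP n m.
  + rewrite fock_in_orth ?neq_ltn ?nm // (rep_zero rep) inner0r.
    move: y; rewrite -(subnKC nm) addSnnS => y.
    by rewrite (wandering_orth T_rep pi_T relT).
  + rewrite fock_in_orth ?neq_ltn ?mn ?orbT // (rep_zero rep) inner0r.
    move: x; rewrite -(subnKC mn) addSnnS => x.
    by rewrite innerC (wandering_orth T_rep pi_T relT) // conjC0.
  + move: y; rewrite -e => y.
    by rewrite fock_in_isom (wandering_inner relT).
have VT n (x : X n) d : D d -> V (tD (fock_in F x) d) = T x d.
  by move=> Dd; exact: (Ve (existT (fun n => (X n * {d | D d})%type) n (x, exist _ d Dd))).
have QV f : Q (V f) = 0.
  have hP := blin_preim (blin_comp bV (bop_blin Q)) (@clsub0 _ H).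
  apply: (total_sub fock_elementary_total hP) => _ [n [x [d [Dd ->]]]] /=.
  rewrite VT //; apply: (Q_wandering T_rep pi_T relT Q_lim); apply: closed_span_in.
  by exists n, x, d; split => //; apply/DP.
(* The preimage of h - Q h is the value of the adjoint at h, since the range of V is orthogonal to
   that of Q. *)
have /choice[Vs VsP] : forall h, exists f, V f = h - Q h.
  move=> h; have [f _ fE] : range V (h - Q h); last by exists f.
  apply: (closed_span_sub (isometry_range_closed bV Viso) _ (@Q_compl _ _ _ _ _ T_rep r pi_T Q Q_lim h)).
  move=> _ [n [x [d [Pd ->]]]]; exists (tD (fock_in F x) d) => //.
  by apply: VT; apply/DP.
have VVs f h : inner (V f) h = inner f (Vs h).
  rewrite -{1}(subrK (Q h) h) innerDr -VsP Viso.
  by rewrite -(Q_sa Q_lim) QV inner0l addr0.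
by exists (mk_bop bV VVs); split.
Qed.

End WanderingPart.

Theorem theorem5p1
  (R : realType) (A : cstarType R) (X : subproduct_system A) (H : hilbertType R)
  (T : forall n, X n -> bop H H) (T_rep : is_cc_covariant_rep T)
  (r : tilde_ops T) (w : power_space r)
  (Q : bop H H)
  (Q_lim : forall h, tl_op r n (bop_adj (tl_op r n) h) @[n --> \oo] --> Q h)
  (pQ : forall l, bop (pw_space w l) (tl_space r l))
  (pQP : forall l, is_tensor_op setT (pw_tens w l) (tl_tens r l)
                     (sp_proj l) Q (pQ l))
  (Delta : bop H H) (DeltaP : is_defect r Delta)
  (T_relisom : relatively_isometric r Delta)
  (T_lim : forall (m : nat) (eta : X m) (h : H), (0 < m)%N ->
     `|pQ (m + k)%N (pw_creation w k eta (bop_adj (tl_op r k) h))|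
       @[k --> \oo] --> `|T m eta (Q h)|)
  (F : fock_module X) (FD : hilbertType R) (tD : F -> H -> FD)
  (tDP : is_hilbert_tensor (rep0 T) (closure (range Delta)) tD) :
  (exists (U : hilbertType R) (W : H -> FD * U) (W' : FD * U -> H)
          (Z : forall n, X n -> bop U U) (SI : forall n, X n -> bop FD FD),
     [/\ unitary_sum W W',
         is_cc_covariant_rep Z /\ fully_coisometric Z,
         extends_to_cstar_rep Z F,
         (forall n (zeta : X n),
            is_tensor_op (closure (range Delta)) tD tD (xshift F zeta) id (SI n zeta)) &
         (forall n (zeta : X n) f u,
            W (T n zeta (W' (f, u))) = (SI n zeta f, Z n zeta u))]) /\
  extends_to_cstar_rep T F.
Proof.
have rep := ccr_rep0 T_rep.
have [pi_T _] := T_relisom.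
have {}Q_lim h : tends (fun n => range_proj r n h) (Q h) by apply/cvgR; exact: Q_lim.
have relT := relisom_adj pi_T DeltaP T_relisom.
have clD := clsub_defect pi_T DeltaP.
have DP := defect_range pi_T DeltaP.
have Q_idem := Q_idem T_rep pi_T Q_lim.
have Q_sa := Q_sa Q_lim.
have Q_sigma := Q_sigma T_rep pi_T Q_lim.
have Q_T := Q_T T_rep pi_T relT Q_lim.
have fixP u : Q u = u -> forall l, range_proj r l u = u.
  by move=> <- l; exact: (range_proj_Q T_rep pi_T Q_lim).
have hU : clsub [set u | Q u = u] := blin_eq (bop_blin Q) (blin_id H).
pose U := sub_space hU.
pose Z n (x : X n) : bop U U := fixed_part T Q_sa Q_idem hU x.
have Z_rep : is_cc_covariant_rep Z := fixed_part_rep T_rep Q_sa Q_idem hU Q_T.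
have J_total n u : Q u = u -> closed_span [set v | exists (x : X n) k, v = tl_tens r n x (Q k)] (bop_adj (tl_op r n) u).
  exact: (adj_Q_total T_rep pi_T relT Q_lim).
have Z_cois : fully_coisometric Z := fixed_coisometric Q_sa Q_idem hU Q_T J_total fixP.
have Vex m (z : X m) l : exists V : bop (tl_space r l) (tl_space r (m + l)%N),
    forall k, V k = pQ (m + l)%N (pw_creation w l z k).
  have bf := blin_comp (bop_blin (pw_creation w l z)) (bop_blin (pQ (m + l)%N)).
  have ad x y : inner (pQ (m + l)%N (pw_creation w l z x)) y =
      inner x (bop_adj (pw_creation w l z) (bop_adj (pQ (m + l)%N) y)) by rewrite !bop_adjP.
  by exists (mk_bop bf ad).
pose V m (z : X m) l := sval (cid (Vex m z l)).
have VE m (z : X m) l k : V m z l k = pQ (m + l)%N (pw_creation w l z k) := svalP (cid (Vex m z l)) k.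
have VP m (z : X m) l (x : X l) h : V m z l (tl_tens r l x h) = tl_tens r (m + l)%N (sp_mul z x) (Q h).
  by rewrite VE (pw_creationP w) // pQP.
have V_lim m (z : X m) (u : U) (e : R) : 0 < e -> exists N0, forall l, (N0 <= l)%N ->
    nr (V m z l (bop_adj (tl_op r l) (sub_val u)) - bop_adj (tl_op r (m + l)%N) (T m z (sub_val u))) ^+ 2 <= e.
  (* [T_lim] covers m > 0; for m = 0 the difference is exactly 0. *)
  move=> e0; have Qu := fixedE u; case: m z => [|m] z.
    exists 0%N => l _.
    rewrite (creation_lim0 T_rep Q_T Q_sa Q_sigma (VP 0%N z l) Qu) subrr nr0 expr0n.
    exact: ltW.
  apply: (creation_lim_pos T_rep Q_T fixP (VP m.+1 z) Qu e0).
  have := T_lim m.+1 z (sub_val u) (ltn0Sn m); rewrite Qu.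
  by under eq_fun do rewrite -VE.
have Z_val n (x : X n) (u : U) : sub_val (Z n x u) = T n x (sub_val u) :=
  fixed_partE Q_sa Q_idem Q_T x u.
have Z_shift n (x : X n) : @asymp_rel R A X H T F Q hU (xshift F x) (Z n x).
  exact: (asymp_rel_shift T_rep F fixP VP V_lim Q_sa Q_sigma Q_T (Z_val n x)).
have Z_shift_adj n (x : X n) : @asymp_rel R A X H T F Q hU (aop_star (xshift F x)) (bop_adj (Z n x)).
  exact: (asymp_rel_shift_adj T_rep F fixP (fixed_part_adjE Q_sa Q_idem Q_T x)).
have Z_ext : extends_to_cstar_rep Z F.
  exact: (fixed_extends T_rep fixP Z_shift Z_shift_adj (ccr_rep0 Z_rep)).
have [I [IT Iiso QI IIs]] := wandering_isometry T_rep pi_T relT Q_lim DP tDP.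
have qpos : forall xi : seq (F * H), 0 <= qnorm (rep0 T) xi := qnorm_ge0 T_rep r (F := F).
have /choice[c cP] := amplification rep clD tDP qpos.
have total := fock_elementary_total T_rep tDP.
have IsI f : bop_adj I (I f) = f by apply: innerPl => g; rewrite -bop_adjP Iiso.
have IsQ h : bop_adj I (Q h) = 0.
  by apply: innerPl => g; rewrite -bop_adjP -Q_sa QI inner0l inner0r.
have IcT n (x : X n) f : I (c (xshift F x) f) = T n x (I f).
  have hP := blin_eq (blin_comp (bop_blin (c (xshift F x))) (bop_blin I)) (blin_comp (bop_blin I) (bop_blin (T n x))).
  apply: (total_sub total hP) => _ [m [y [d [Dd ->]]]] /=.
  by rewrite (proj1 (cP _)) // xshiftE !IT // (ccr_mul T_rep).
pose pU : H -> U := to_fixed Q_idem hU.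
have pU_blin : blin pU := to_fixed_blin Q_idem hU.
have pU_val h : sub_val (pU h) = Q h by [].
have pUI f : pU (I f) = 0 by apply: sub_val_inj; rewrite pU_val QI.
have IsU (u : U) : bop_adj I (sub_val u) = 0 by rewrite -(fixedE u) IsQ.
have pUK (u : U) : pU (sub_val u) = u := to_fixedK Q_idem u.
have bI := bop_blin I; have bIs := bop_adj_blin I.
split.
  exists U, (fun h => (bop_adj I h, pU h)), (fun p => I p.1 + sub_val p.2), Z, (fun n x => c (xshift F x)).
  split => //.
  - split.
    + by move=> k x y; congr pair; [have [l _] := bIs|have [l _] := pU_blin]; exact: l.
    + by move=> h; rewrite -[LHS]/(I (bop_adj I h) + Q h) IIs subrK.
    + move=> [f u]; congr pair; first by rewrite (blinD bIs) IsI IsU addr0.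
      by rewrite (blinD pU_blin) pUI add0r pUK.
    + move=> x y; rewrite -[LHS]/(inner (bop_adj I x) (bop_adj I y) + inner (Q x) (Q y)).
      rewrite -Iiso !IIs innerBl !innerBr -!Q_sa Q_idem.
      by rewrite subrr subr0 subrK.
  - by move=> n x y d Dd /=; rewrite (proj1 (cP _)).
  - move=> n x f u /=; rewrite (blinD (bop_blin (T n x))) -IcT -Z_val; congr pair.
      by rewrite (blinD bIs) IsI IsU addr0.
    by rewrite (blinD pU_blin) pUI add0r pUK.
have [pi [[pi_lin pi_mul pi_star _] pi_shift]] := Z_ext.
have c_lin k a b f : c (aop_add (aop_scale k a) b) f = k *: c a f + c b f.
  have hP := blin_eq (bop_blin (c (aop_add (aop_scale k a) b))) (blin_add (blin_scale k (bop_blin (c a))) (bop_blin (c b))).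
  have [_ tD_total] := tDP; apply: (total_sub tD_total hP) => _ [y [d [Dd ->]]] /=.
  by rewrite !(proj1 (cP _)) //; have [l _] := tens_blin rep tDP Dd; exact: l.
have c_mul a b f : c (aop_mul a b) f = c a (c b f).
  have hP := blin_eq (bop_blin (c (aop_mul a b))) (blin_comp (bop_blin (c b)) (bop_blin (c a))).
  have [_ tD_total] := tDP; apply: (total_sub tD_total hP) => _ [y [d [Dd ->]]] /=.
  by rewrite !(proj1 (cP _)).
have c_star a f : c (aop_star a) f = bop_adj (c a) f.
  have hP := blin_eq (bop_blin (c (aop_star a))) (bop_adj_blin (c a)).
  have [_ tD_total] := tDP; apply: (total_sub tD_total hP) => _ [y [d [Dd ->]]] /=.
  by rewrite (proj1 (cP _)) // (proj2 (cP _)).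
(* The sum of [c a] on F_X (x) D and [pi a] on U, carried over to H by the unitary. *)
pose rho a h := I (c a (bop_adj I h)) + sub_val (pi a (pU h)).
have rho_blin a : blin (rho a).
  apply: blin_add; first exact: (blin_comp bIs (blin_comp (bop_blin (c a)) bI)).
  exact: (blin_comp pU_blin (blin_comp (bop_blin (pi a)) (sub_val_blin hU))).
have rho_adj a x y : inner (rho a x) y = inner x (I (bop_adj (c a) (bop_adj I y)) + sub_val (bop_adj (pi a) (pU y))).
  rewrite innerDl innerDr bop_adjP bop_adjP bop_adjPl; congr (_ + _).
  rewrite -(to_fixed_adj Q_sa Q_idem x) -bop_adjP.
  by rewrite (innerC y) -(to_fixed_adj Q_sa Q_idem y) inner_conj.
have rhoE a h : mk_bop (rho_blin a) (rho_adj a) h = rho a h by [].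
have rho_shift n (x : X n) h : rho (xshift F x) h = T n x h.
  rewrite /rho IcT IIs pi_shift Z_val pU_val -(blinD (bop_blin (T n x))) subrK.
  by [].
exists (fun a => mk_bop (rho_blin a) (rho_adj a)); split; last by move=> n x h; rewrite rhoE rho_shift.
split.
- move=> k a b h ta tb; rewrite !rhoE /rho c_lin pi_lin // (blinD bI) (blinZ _ _ bI) scalerDr addrACA.
  by [].
- move=> a b h ta tb; rewrite !rhoE /rho c_mul pi_mul //.
  by rewrite (blinD bIs) IsI IsU addr0 (blinD pU_blin) pUI add0r pUK.
- by move=> a h ta; rewrite rhoE /rho c_star pi_star.
(* Nondegeneracy is inherited from T_0, whose values are those of rho at the shifts of degree 0. *)
- have [_ _ _ tot] := rep; apply/seteqP; split => // v _; move: v.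
  apply: (total_sub tot (clsub_span _)) => _ [a [h ->]]; apply: closed_span_in.
  exists (xshift F (sp_vac X a)), h; split; first exact: toeplitz_shift.
  by rewrite rhoE rho_shift.
Qed.
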